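(* Let $-\infty\leqslant a<b\leqslant\infty$ and let $f$ be an $\mathbb{R}$-valued measurable function on $(a,b)$. Then $\mathfrak D(\Phi_{f,\mathrm{es}})$ equals the class $\{\delta_\gamma\colon\gamma\in\mathbb{R}^d\}$ if and only if $f(s)$ is locally integrable on $(a,b)$ and $\int_a^b(f(s)^2\wedge1)\,ds=\infty$.
   Context: $\delta_\gamma$ is the distribution concentrated at $\gamma$. Locally integrable on $(a,b)$ means $\int_p^q|f(s)|ds<\infty$ whenever $a<p<q<b$. $ID(\mathbb{R}^d)$ ($d$ fixed) is the class of infinitely divisible distributions on $\mathbb{R}^d$. Random measure. For $\mu\in ID(\mathbb{R}^d)$, $X^{(\mu)}=\{X^{(\mu)}(B)\colon B\text{ bounded Borel in }\mathbb{R}\}$ is the (unique in law) $\mathbb{R}^d$-valued homogeneous independently scattered random measure on $\mathbb{R}$ such that $X^{(\mu)}((t,t+1])$ has distribution $\mu$ for all $t$: (1) for disjoint bounded Borel sets $B_1,B_2,\dots$ with bounded union, $\sum_n X^{(\mu)}(B_n)$ converges a.s. and equals $X^{(\mu)}(\bigcup_n B_n)$ a.s.; (2) values on finitely many disjoint sets are independent; (3) $X^{(\mu)}(\{t\})=0$ a.s.; and the law of $X^{(\mu)}(B+t)$ equals that of $X^{(\mu)}(B)$. Integrals. Let $\mathcal B^0_{(a,b)}$ be the class of Borel sets $B\subset(a,b)$ with $\inf B>a$, $\sup B<b$. For a simple function $f=\sum_{j=1}^n r_j1_{B_j}$ ($B_j$ disjoint Borel in $(a,b)$, $r_j\in\mathbb{R}$),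 $\int_B f\,dX^{(\mu)}=\sum_j r_jX^{(\mu)}(B\cap B_j)$ for $B\in\mathcal B^0_{(a,b)}$. A measurable $f\colon(a,b)\to\mathbb{R}$ belongs to $\mathbf L_{(a,b)}(X^{(\mu)})$ (locally $X^{(\mu)}$-integrable) if there are simple $f_n\to f$ Lebesgue-a.e. such that $\int_B f_n\,dX^{(\mu)}$ converges in probability for every $B\in\mathcal B^0_{(a,b)}$; the limit is $\int_B f(s)X^{(\mu)}(ds)$, and $\int_p^q$ is the integral over $(p,q]$, $a<p<q<b$. Domain. $\mathfrak D(\Phi_{f,\mathrm{es}})$ is the class of $\mu\in ID(\mathbb{R}^d)$ with $f\in\mathbf L_{(a,b)}(X^{(\mu)})$ for which there is a nonrandom $\mathbb{R}^d$-valued function $g(p,q)$ such that $\int_p^q f(s)X^{(\mu)}(ds)-g(p,q)$ converges in probability as $p\downarrow a$, $q\uparrow b$. *)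

(* Defs.v *)
From HB Require Import structures.
From mathcomp Require Import all_boot all_order all_algebra.
From mathcomp Require Import all_classical all_reals all_analysis.

Set Implicit Arguments.
Unset Strict Implicit.
Unset Printing Implicit Defensive.

Import Order.TTheory GRing.Theory Num.Theory.
Import numFieldNormedType.Exports.
Import HBSimple.

Local Open Scope classical_set_scope.
Local Open Scope ring_scope.

(* The Borel sigma-algebra of R^d.  The norm of ['rV[R]_d] is the sup norm, so
   [open] is the usual topology. *)
HB.instance Definition _ (R : realType) (d : nat) :=
  @isMeasurable.Build (sigma_display (@open 'rV[R]_d)) 'rV[R]_d
    <<s @open 'rV[R]_d >> (@sigma_algebra0 _ setT _) (@sigma_algebraC _ _)
    (@sigma_algebra_bigcup _ setT _).

Section infinitely_divisible.
Context {R : realType} {d : nat}.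
Local Open Scope ereal_scope.

Fixpoint convolution_power (nu : probability 'rV[R]_d R) (n : nat) :
    set 'rV[R]_d -> \bar R :=
  if n is m.+1
  then fun A => \int[nu]_x convolution_power nu m [set y | A (x + y)%R]
  else fun A => \d_(0%R : 'rV[R]_d) A.

(* As everywhere below, laws are compared on Borel sets only: the value of a
   [probability] at a non-measurable set is meaningless. *)
Definition infinitely_divisible (mu : probability 'rV[R]_d R) :=
  forall n, (0 < n)%N -> exists nu : probability 'rV[R]_d R,
    forall A, measurable A -> mu A = convolution_power nu n A.

End infinitely_divisible.

Definition cvg_in_probability {R : realType} {dO : measure_display}
    {Omega : measurableType dO} (P : probability Omega R)
    {V : normedModType R} {I : Type} (F : set_system I)
    (Y : I -> Omega -> V) (Z : Omega -> V) :=
  forall e : R, 0 < e ->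
    P [set w | e <= `|Y i w - Z w|] @[i --> F] --> (0 : \bar R).

(* Taking some of the [A i] to be the whole space gives the product rule for
   the subfamilies. *)
Definition independent_RVs {R : realType} {dO dV : measure_display}
    {Omega : measurableType dO} {V : measurableType dV}
    (P : probability Omega R) (n : nat) (Y : 'I_n -> {RV P >-> V}) :=
  forall A : 'I_n -> set V, (forall i, measurable (A i)) ->
    P (\bigcap_(i in [set: 'I_n]) (Y i @^-1` A i)) =
    (\prod_(i < n) P (Y i @^-1` A i))%E.

Section random_measure.
Context {R : realType} {d : nat} {dO : measure_display}
  {Omega : measurableType dO} (P : probability Omega R).

Definition bounded_borel : set (set R) :=
  [set B : set R | measurable B /\ bounded_set B].

(* Only the values of [X] on bounded Borel sets are meaningful. *)
Definition is_random_measure (mu : probability 'rV[R]_d R)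
    (X : set R -> {RV P >-> 'rV[R]_d}) :=
  [/\ forall B : (set R)^nat, (forall n, bounded_borel (B n)) ->
        trivIset setT B -> bounded_set (\bigcup_n B n) ->
        {ae P, forall w,
          \sum_(i < n) X (B i) w @[n --> \oo] --> X (\bigcup_n B n) w},
      forall n (B : 'I_n -> set R), (forall i, bounded_borel (B i)) ->
        trivIset setT B -> independent_RVs (fun i => X (B i)),
      forall t : R, {ae P, forall w, X [set t] w = 0},
      forall B (t : R), bounded_borel B -> forall A, measurable A ->
        distribution P (X [set s + t | s in B]) A = distribution P (X B) A &
      forall (t : R) A, measurable A ->
        distribution P (X [set` `]t, t + 1]]) A = mu A].

End random_measure.

Section stochastic_integral.
Context {R : realType} {d : nat} {dO : measure_display}
  {Omega : measurableType dO} (P : probability Omega R).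
Variables (a b : \bar R) (X : set R -> {RV P >-> 'rV[R]_d}).
Implicit Types (f : R -> R) (h : {sfun R >-> R}).

(* [ereal_inf] and [ereal_sup] of the empty set are [+oo] and [-oo], so
   [set0] belongs to the class. *)
Definition inner_borel : set (set R) :=
  [set B : set R | [/\ measurable B, B `<=` [set s | (a < s%:E < b)%E],
               (a < ereal_inf [set s%:E | s in B])%E &
               (ereal_sup [set s%:E | s in B] < b)%E]].

(* A simple function on (a, b) is represented by an extension to R, written
   with its level sets; for [B] in [inner_borel] only its restriction to (a, b)
   matters.  By additivity of [X], a different representation by disjoint sets
   changes the integral on a null set only. *)
Definition simple_integral h (B : set R) (w : Omega) : 'rV[R]_d :=
  \sum_(r \in range h) r *: X (B `&` h @^-1` [set r]) w.

Definition approximating f (fn : {sfun R >-> R}^nat) :=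
  {ae lebesgue_measure, forall s : R, (a < s%:E < b)%E ->
     fn n s @[n --> \oo] --> f s} /\
  forall B, inner_borel B -> exists Y : {RV P >-> 'rV[R]_d},
    cvg_in_probability P \oo (fun n => simple_integral (fn n) B) Y.

Definition locally_X_integrable f := exists fn, approximating f fn.

(* [Y] is a version of the integral of [f] over [B] with respect to [X]. *)
Definition is_stochastic_integral f (B : set R) (Y : {RV P >-> 'rV[R]_d}) :=
  exists2 fn, approximating f fn &
    cvg_in_probability P \oo (fun n => simple_integral (fn n) B) Y.

End stochastic_integral.

Section essential_domain.
Context {R : realType}.

Definition downto (a : \bar R) : set_system R :=
  match a with r%:E => r^'+ | -oo%E => -oo | +oo%E => +oo end.

Definition upto (b : \bar R) : set_system R :=
  match b with r%:E => r^'- | -oo%E => -oo | +oo%E => +oo end.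

(* The random measure with law determined by [mu] is unique in law, and the
   conditions imposed on it depend on its law only; hence any realization on
   any probability space may be used. *)
Definition essential_domain (d : nat) (a b : \bar R) (f : R -> R) :
    set (probability 'rV[R]_d R) :=
  [set mu | infinitely_divisible mu /\
    exists (dO : measure_display) (Omega : measurableType dO)
           (P : probability Omega R) (X : set R -> {RV P >-> 'rV[R]_d}),
      [/\ is_random_measure mu X,
          locally_X_integrable a b X f &
          exists (g : R -> R -> 'rV[R]_d)
                 (J : R -> R -> {RV P >-> 'rV[R]_d}) (Z : {RV P >-> 'rV[R]_d}),
            (forall p q, (a < p%:E)%E -> p < q -> (q%:E < b)%E ->
               is_stochastic_integral a b X f [set` `]p, q]] (J p q)) /\
            cvg_in_probability P (filter_prod (downto a) (upto b))
              (fun pq w => J pq.1 pq.2 w - g pq.1 pq.2) Z]].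

Definition delta_distributions (d : nat) : set (probability 'rV[R]_d R) :=
  [set mu | exists gamma : 'rV[R]_d,
     forall A, measurable A -> mu A = \d_gamma A].

Definition locally_integrable_on (a b : \bar R) (f : R -> R) :=
  forall p q : R, (a < p%:E)%E -> p < q -> (q%:E < b)%E ->
    (\int[lebesgue_measure]_(s in `[p, q]) `|f s|%:E < +oo)%E.

End essential_domain.

Arguments essential_domain {R} d a b f _.
Arguments delta_distributions {R} d _.

(* Main.v *)
Require Import Defs.
From HB Require Import structures.
From mathcomp Require Import all_boot all_order all_algebra.
From mathcomp Require Import all_classical all_reals all_analysis.
From mathcomp Require Import measurable_realfun.
From mathcomp Require Import ring lra zify.

Set Implicit Arguments.
Unset Strict Implicit.
Unset Printing Implicit Defensive.

Import Order.TTheory GRing.Theory Num.Theory.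
Import numFieldNormedType.Exports.

Local Open Scope classical_set_scope.
Local Open Scope ring_scope.

(** When [min (f ^ 2, 1)] is not integrable, only degenerate laws allow the
    centred integrals of [f] to converge; when it is integrable a Poisson law
    allows it as well; and a nonzero degenerate law allows the integral to be
    defined only if [f] is locally integrable.

    Suppose that the integral of [min (f ^ 2, 1)] diverges and that [mu] is in
    the domain.  Let [phi2] be the squared modulus of a characteristic
    function.  On each coordinate of [X], the map [- ln phi2] is additive over
    disjoint sets and shift invariant, hence a multiple of Lebesgue measure
    ([additive_shift_invariantE], [psi_exp]).  For simple functions, and then
    for [f], this gives
      [phi2 (t * integral of f) <= exp (- integral of kappa (t * f))],
    where [kappa t = 1 - phi2 (t * X(]0, 1]))] ([phi2_integral_le]).  The
    centring does not change [phi2], and the limit has [phi2] close to one for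
    small [t], so the integral of [kappa (t * f)] over the whole interval stays
    bounded for [t] near zero ([kappa_integral_bound]).  Averaged over [t],
    [kappa (t * r)] dominates [min (r ^ 2, 1)] times a constant that is positive
    unless the coordinate is degenerate ([avg_one_minus_phi2]).  Hence every
    coordinate is degenerate ([coord_cst_or_integrable]).

    A degenerate random measure is Lebesgue measure times a vector
    ([degenerate_coord]), and stochastic integrals of simple functions are
    Lebesgue integrals.  If [f] is locally integrable, dominated convergence
    puts all degenerate laws into the domain ([delta_in_essential_domain]).
    Conversely, if a nonzero degenerate law is in the domain, there are simple
    functions converging almost everywhere to [f] whose integrals are bounded
    over every Borel subset of a compact interval, and a gliding hump argument
    yields the integrability of [f] there ([gliding_hump],
    [degenerate_locally_integrable]).

    Suppose finally that the integral of [min (f ^ 2, 1)] is finite.  Then the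
    domain contains a law that is not degenerate, that of a Poisson random
    measure: it has finitely many points in bounded sets, so that every [f] is
    integrated by summation over the points.  Near the ends, values of [f] of
    modulus above one meet no point with large probability, and the sum of the
    other values, centred by its mean, is small by Chebyshev's inequality
    ([increment_tail], [poisson_in_essential_domain]).  The Poisson process is
    built from a single uniform number, whose binary digits are distributed
    over countably many independent uniform numbers ([integral_prod_parts]);
    its law is read off from the exponential functional
    ([exponential_functional]) and from generating functions
    ([generating_independent]).  Membership in the domain requires infinite
    divisibility, which holds for every random measure
    ([random_measure_infinitely_divisible]). *)

(** * Bounded Borel sets and shift-invariant set functions *)

Lemma cvg_uniq {R : realType} {I : Type} (F : set_system I) {FF : ProperFilter F}
    (u : I -> R) (x y : R) :
  u i @[i --> F] --> x -> u i @[i --> F] --> y -> x = y.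
Proof. by move=> ux uy; exact: (@cvg_unique _ _ _ _ _ _ ux uy). Qed.

Section bounded_borel_sets.
Context {R : realType}.
Implicit Types (A B : set R).

Lemma bounded_setE (B : set R) :
  bounded_set B <-> exists M : R, forall x, B x -> `|x| <= M.
Proof.
split=> [[M [_ HM]]|[M HM]].
  by exists (M + 1) => x Bx; apply: (HM (M + 1)) => //; rewrite ltrDl.
exists M; split; first exact: num_real.
by move=> N MN x Bx /=; rewrite (le_trans (HM x Bx))// ltW.
Qed.

Lemma bounded_setS A B : A `<=` B -> bounded_set B -> bounded_set A.
Proof.
move=> AB /bounded_setE[M HM]; apply/bounded_setE; exists M => x Ax.
exact/HM/AB.
Qed.

Lemma bounded_borelS A B :
  measurable A -> A `<=` B -> bounded_borel B -> bounded_borel A.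
Proof. by move=> mA AB [_ bB]; split => //; exact: bounded_setS AB bB. Qed.

Lemma bounded_borel_itv (x y : R) b1 b2 :
  bounded_borel [set` Interval (BSide b1 x) (BSide b2 y)].
Proof.
split; first exact: measurable_itv.
apply/bounded_setE; exists (`|x| + `|y|) => z /=.
move=> zI; have {zI} : x <= z <= y.
  by case: b1 b2 zI => -[]; rewrite in_itv/= => /andP[]; lra.
have := ler_norm x; have := ler_norm y.
have := ler_norm (- x); have := ler_norm (- y); rewrite !normrN.
by rewrite ler_norml; lra.
Qed.

Lemma bounded_borelP B : bounded_borel B ->
  exists2 M : R, 0 < M & B `<=` `](- M), M]%classic.
Proof.
move=> [mB /bounded_setE[M HM]]; exists (`|M| + 1) => [|x Bx].
  by rewrite ltr_wpDl.
have := HM _ Bx; have := ler_norm M; rewrite /= in_itv/= ler_norml; lra.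
Qed.

Lemma bounded_borel_shift B (t : R) :
  bounded_borel B -> bounded_borel [set s + t | s in B].
Proof.
move=> bB; have E : [set s + t | s in B] = (fun x => x - t) @^-1` B.
  apply/seteqP; split=> [_ [x Bx <-]|x Bx] /=; first by rewrite addrK.
  by exists (x - t) => //; rewrite subrK.
split.
  rewrite E -[X in measurable X]setTI; apply: measurable_funB => //.
  by case: bB.
have [M M0 HM] := bounded_borelP bB.
apply/bounded_setE; exists (M + `|t|) => _ [x /HM + <-].
rewrite /= in_itv/= => xM; rewrite (le_trans (ler_normD _ _))// lerD2r.
by rewrite ler_norml; lra.
Qed.

Lemma lebesgue_itvoc (x y : R) : x <= y ->
  lebesgue_measure (`]x, y]%classic : set R) = (y - x)%:E.
Proof.
move=> xy; rewrite lebesgue_measure_itv/= lte_fin; case: ltP => //.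
by move=> yx; rewrite (@le_anti _ _ x y) ?xy// subrr.
Qed.

Lemma lebesgue_bounded_borel_lty B :
  bounded_borel B -> (lebesgue_measure B < +oo)%E.
Proof.
move=> bB; have [M M0 HM] := bounded_borelP bB.
have mI : measurable (`](- M), M]%classic : set R) by exact: measurable_itv.
have le : (lebesgue_measure B <=
           lebesgue_measure (`](- M)%R, M]%classic : set R))%E.
  by apply: le_measure => //; rewrite inE//; case: bB.
by rewrite (le_lt_trans le)// lebesgue_itvoc ?ltry//; lra.
Qed.

Lemma lebesgue_bounded_borel_fin B :
  bounded_borel B -> lebesgue_measure B \is a fin_num.
Proof.
by move=> bB; rewrite ge0_fin_numE//; exact: lebesgue_bounded_borel_lty.
Qed.

End bounded_borel_sets.

Section affine_images.
Context {R : realType}.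

Lemma measurable_fun_affine (c t : R) :
  measurable_fun setT (fun x : R => c * x + t).
Proof. by apply: measurable_funD => //; exact: measurable_funM. Qed.

Lemma lebesgue_measure_affine (c t : R) (A : set R) : 0 < c -> measurable A ->
  lebesgue_measure ((fun x : R => c * x + t) @^-1` A) =
  (c^-1%:E * lebesgue_measure A)%E.
Proof.
move=> c0 mA; have c0' : 0 <= c by exact: ltW.
have mf : measurable_fun setT (fun x : R => c * x + t : measurableTypeR R).
  exact: measurable_fun_affine.
pose m := HB.pack_for (measure (measurableTypeR R) R) (pushforward lebesgue_measure
     (fun x : R => c * x + t : measurableTypeR R))
  (Measure.on (pushforward lebesgue_measure
     (fun x : R => c * x + t : measurableTypeR R))).
suff -> : lebesgue_measure A = mscale (NngNum c0') (m mf) A.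
  by rewrite /mscale/= muleA -EFinM mulVf ?gt_eqF// mul1e.
apply: lebesgue_measure_unique => //= _ [[x y]] _ <-.
rewrite /mscale /m /pushforward/=.
rewrite (_ : _ @^-1` _ = `]((x - t) / c)%R, ((y - t) / c)%R]%classic); last first.
  apply/seteqP; split => z /=; rewrite !in_itv/=;
  by rewrite ltr_pdivrMr// ler_pdivlMr// ltrBlDr lerBrDr ![z * c]mulrC.
rewrite !lebesgue_measure_itv/= !lte_fin ltr_pM2r ?invr_gt0// ltrD2r.
case: ifP => _; last by rewrite mule0.
by rewrite -!EFinB -EFinM; congr EFin; field; rewrite gt_eqF.
Qed.

Lemma shift_preimage (B : set R) (t : R) :
  [set s + t | s in B] = (fun x => 1 * x + - t) @^-1` B.
Proof.
apply/seteqP; split=> [_ [x Bx <-]|x Bx] /=; first by rewrite mul1r addrK.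
by exists (x - t); rewrite ?subrK//; move: Bx; rewrite /= mul1r.
Qed.

Lemma lebesgue_measure_shift (B : set R) (t : R) : measurable B ->
  lebesgue_measure [set s + t | s in B] = lebesgue_measure B.
Proof.
by move=> mB; rewrite shift_preimage lebesgue_measure_affine// invr1 mul1e.
Qed.

End affine_images.

Section additive_set_functions.
Context {R : realType}.
Variable F : set R -> R.
Hypothesis F_sigma_additive : forall B : (set R)^nat,
  (forall n, bounded_borel (B n)) -> trivIset setT B ->
  bounded_set (\bigcup_n B n) ->
  \sum_(i < n) F (B i) @[n --> \oo] --> F (\bigcup_n B n).
Hypothesis F_shift : forall B (t : R), bounded_borel B ->
  F [set s + t | s in B] = F B.

Let bb0 : bounded_borel (set0 : set R).
Proof. by split; [exact: measurable0|apply/bounded_setE; exists 0]. Qed.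

Let term_cvg0 (u : R^nat) (l : R) :
  \sum_(i < n) u i @[n --> \oo] --> l -> u @ \oo --> 0.
Proof.
move=> ul; rewrite -(subrr l).
rewrite (_ : u = fun n => \sum_(i < n.+1) u i - \sum_(i < n) u i); last first.
  by apply/funext => n; rewrite big_ord_recr/= addrAC subrr add0r.
apply: cvgB => //.
by rewrite (cvg_shiftS (fun n => \sum_(i < n) u i)).
Qed.

Lemma additive0 : F set0 = 0.
Proof.
have t0 : trivIset setT (fun _ : nat => (set0 : set R)).
  by apply/trivIsetP => i j _ _ _; rewrite setI0.
have := @F_sigma_additive (fun=> set0) (fun=> bb0) t0.
rewrite bigcup0// => /(_ (proj2 bb0)) h.
have {}h := @term_cvg0 (fun=> F set0) _ h.
apply: cvg_uniq h.
exact: cvg_cst.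
Qed.

Lemma additiveU A B : bounded_borel A -> bounded_borel B -> A `&` B = set0 ->
  F (A `|` B) = F A + F B.
Proof.
move=> bA bB AB0.
have bAB : bounded_set (A `|` B).
  have [_ /bounded_setE[M HM]] := bA; have [_ /bounded_setE[N HN]] := bB.
  apply/bounded_setE; exists (Num.max M N) => x [/HM|/HN] h;
  by rewrite le_max h ?orbT.
have b2 n : bounded_borel (bigcup2 A B n) by case: n => [|[|n]].
have := F_sigma_additive b2; rewrite bigcup2E -trivIset_bigcup2.
move=> /(_ AB0 bAB) h; apply: cvg_uniq h _.
rewrite -(cvg_shiftn 2)/=; apply: cvg_near_cst; near=> n.
  rewrite addn2 !big_ord_recl/= big1 ?addr0// => i _.
  exact: additive0.
Unshelve. all: by end_near. Qed.

Let c := F `]0, 1].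

Let G (x : R) := F `]0, x].

Let F_itvoc (x y : R) : F `]x, y] = G (y - x).
Proof.
rewrite /G -(F_shift x (bounded_borel_itv 0 (y - x) false false)).
congr F; rewrite shift_preimage; apply/seteqP; split => z /=;
  rewrite !in_itv/=; lra.
Qed.

Let GD (x y : R) : 0 <= x -> 0 <= y -> G (x + y) = G x + G y.
Proof.
move=> x0 y0; have -> : G y = F `]x, x + y] by rewrite F_itvoc addrC addKr.
rewrite /G -additiveU; [|exact: bounded_borel_itv|exact: bounded_borel_itv|].
  by congr F; apply/seteqP; split => z /=; rewrite !in_itv/=; [move=> ?|case];
    [case: (leP z x) => ?; [left|right]| |]; lra.
by rewrite -subset0 => z /= []; rewrite !in_itv/=; lra.
Qed.

Let G0 : G 0 = 0.
Proof. by have := GD (lexx 0) (lexx 0); rewrite addr0; lra. Qed.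

Let GMn (x : R) n : 0 <= x -> G (n%:R * x) = n%:R * G x.
Proof.
move=> x0; elim: n => [|n IH]; first by rewrite !mul0r G0.
by rewrite -natr1 mulrDl mul1r GD ?IH ?mulr_ge0//; lra.
Qed.

Let G_dyadic (k n : nat) : G (k%:R / 2 ^+ n) = c * (k%:R / 2 ^+ n).
Proof.
have n0 : 0 < 2 ^+ n :> R by rewrite exprn_gt0.
rewrite GMn ?invr_ge0 ?ltW//.
have : G 1 = 2 ^+ n * G (2 ^+ n)^-1.
  by rewrite -natrX -GMn ?invr_ge0// natrX divff ?gt_eqF.
rewrite -/c /G -/c => ->; field.
by rewrite gt_eqF.
Qed.

(** Continuity at the origin: the intervals between consecutive terms
    partition the first interval, so that their values telescope. *)
Let G_cvg0 (y : R^nat) : (forall n, 0 <= y n) -> nonincreasing_seq y ->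
  y @ \oo --> 0 -> G (y n) @[n --> \oo] --> 0.
Proof.
move=> y0 dy yc.
pose B n := `]y n.+1, y n]%classic.
have bB n : bounded_borel (B n) by exact: bounded_borel_itv.
have tB : trivIset setT B.
  have dB i j : (i < j)%N -> B i `&` B j = set0.
    move=> ij; rewrite -subset0 => z []; rewrite /B/= !in_itv/= => /andP[h _].
    by move=> /andP[_ /(lt_le_trans h)]; rewrite ltNge dy.
  apply/trivIsetP => i j _ _; rewrite neq_ltn => /orP[|] ij.
    exact: dB.
  by rewrite setIC; exact: dB.
have UB : \bigcup_n B n = `]0, y 0%N]%classic.
  apply/seteqP; split=> [z [n _]|z]; rewrite /B/= !in_itv/=.
    by have := y0 n.+1; have := dy 0%N n (leq0n n); lra.
  move=> /andP[z0 zy].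
  have ex : exists n, y n < z.
    have /cvgrPdist_lt/(_ _ z0)[n _ /(_ n (leqnn n))] := yc.
    by rewrite /= sub0r normrN ger0_norm//; exists n.
  case: (ex_minnP ex) => -[|n] yn nmin; first by move: yn; rewrite ltNge zy.
  exists n => //; rewrite /B/= in_itv/= yn/= leNgt; apply/negP => /nmin.
  by rewrite ltnn.
have := F_sigma_additive bB tB.
rewrite UB => /(_ (proj2 (bounded_borel_itv _ _ _ _))) h.
have S n : \sum_(i < n) F (B i) = G (y 0%N) - G (y n).
  elim: n => [|n IH]; first by rewrite big_ord0 subrr.
  rewrite big_ord_recr/= IH F_itvoc.
  have -> : G (y n) = G (y n - y n.+1) + G (y n.+1).
    by rewrite -GD ?subrK ?subr_ge0 ?dy.
  lra.
rewrite -(subrr (G (y 0%N))).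
have -> : (fun n => G (y n)) = (fun n => G (y 0%N) - \sum_(i < n) F (B i)).
  by apply/funext => n; rewrite S; lra.
by apply: cvgB => //; exact: cvg_cst.
Qed.

Let GE (x : R) : 0 <= x -> G x = c * x.
Proof.
move=> x0; pose k n : nat := (Num.truncn (x * 2 ^+ n)).+1.
pose q n : R := (k n)%:R / 2 ^+ n.
have e0 n : 0 < 2 ^+ n :> R by rewrite exprn_gt0.
have xq n : x <= q n.
  rewrite /q ler_pdivlMr// /k ltW// real_truncnS_gt//.
  exact: num_real.
have qx n : q n - x <= (2 ^+ n)^-1.
  have /truncn_itv/andP[] : 0 <= x * 2 ^+ n by rewrite mulr_ge0// ltW.
  rewrite /q /k -(natr1 (Num.truncn _)) mulrDl mul1r -ler_pdivrMr//; lra.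
have dq : nonincreasing_seq (fun n => q n - x).
  apply/nonincreasing_seqP => n; rewrite lerD2r /q exprS invfM mulrA.
  rewrite ler_pM2r ?invr_gt0// ler_pdivrMr// -natrM ler_nat /k.
  rewrite truncn_lt_nat ?mulr_ge0 ?exprn_ge0// natrM exprS.
  by rewrite mulrCA mulrC ltr_pM2r// truncnS_gt.
have q0 n : 0 <= q n - x by rewrite subr_ge0.
have qc0 : q n - x @[n --> \oo] --> 0.
  apply: (@squeeze_cvgr _ _ _ _ (fun=> 0) (fun n => (2^-1) ^+ n)).
  - by apply: nearW => n; rewrite q0 exprVn qx.
  - exact: cvg_cst.
  - by apply: cvg_expr; rewrite ger0_norm ?invr_lt1 ?unitfE//; lra.
have qc : q @ \oo --> x.
  rewrite -[x]add0r (_ : q = fun n => q n - x + x); last first.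
    by apply/funext => n; rewrite subrK.
  by apply: cvgD => //; exact: cvg_cst.
have h := G_cvg0 q0 dq qc0.
have {}h : G (q n) - G (q n - x) @[n --> \oo] --> c * x.
  rewrite -[c * x]subr0; apply: cvgB => //.
  rewrite (_ : (fun n => G (q n)) = (fun n => c * q n)); last first.
    by apply/funext => n; rewrite /q G_dyadic.
  by apply: cvgM => //; exact: cvg_cst.
apply: cvg_uniq h; rewrite (_ : (fun n => _) = cst (G x)).
  exact: cvg_cst.
apply/funext => n /=.
have -> : G (q n) = G (q n - x) + G x by rewrite -GD ?subrK.
by rewrite addrAC subrr add0r.
Qed.

(** Lebesgue measure is characterized by shift invariance even for signed set
    functions: on intervals from the origin this is Cauchy's functional
    equation, solved on dyadic numbers and extended by one-sided continuity,
    and the identity passes from intervals to Borel sets by Dynkin induction. *)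
Lemma additive_shift_invariantE B : bounded_borel B ->
  F B = F `]0, 1] * fine (lebesgue_measure B).
Proof.
move=> bB; have [M M0 BM] := bounded_borelP bB.
pose W : set R := `](- M), M]%classic.
have bW : bounded_borel W by exact: bounded_borel_itv.
suff H S : measurable S -> F (S `&` W) = c * fine (lebesgue_measure (S `&` W)).
  by have := H B (proj1 bB); rewrite setIidl.
have bSW (T : set R) : measurable T -> bounded_borel (T `&` W).
  move=> mT; apply: (bounded_borelS _ _ bW) => //.
  by apply: measurableI => //; case: bW.
have oc x y : F `]x, y] = c * fine (lebesgue_measure (`]x, y]%classic : set R)).
  case: (leP x y) => xy; first by rewrite F_itvoc lebesgue_itvoc//= GE ?subr_ge0.
  rewrite set_itv_ge ?bnd_simp -?leNgt ?ltW// ?additive0 ?measure0 ?mulr0//.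
move=> mS; move: (mS); apply: (@dynkin_induction _ _ (@ocitv R)
  (fun S => F (S `&` W) = c * fine (lebesgue_measure (S `&` W)))) => // {S mS}.
- exact: ocitvI.
- by rewrite setTI oc.
- move=> S oS; have : ocitv (S `&` W) by apply: ocitvI => //; exact: is_ocitv.
  move=> /ocitvP[->|[[x y] /= _ ->]]; last exact: oc.
  by rewrite additive0 measure0 mulr0.
- move=> S mS HS.
  have E : W = (S `&` W) `|` (~` S `&` W) by rewrite -setIUl setUv setTI.
  have D0 : (S `&` W) `&` (~` S `&` W) = set0.
    by rewrite setIACA setICr set0I.
  have mS' := measurableC mS.
  have FU := additiveU (bSW _ mS) (bSW _ mS') D0.
  rewrite -E HS oc in FU.
  have mU : fine (lebesgue_measure W) = fine (lebesgue_measure (S `&` W)) +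
      fine (lebesgue_measure (~` S `&` W)).
    rewrite -fineD ?lebesgue_bounded_borel_fin//; try exact: bSW.
    rewrite -measureU// -?E//; [exact: (proj1 (bSW _ mS))|].
    exact: (proj1 (bSW _ mS')).
  by apply: (@addrI _ (c * fine (lebesgue_measure (S `&` W)))); rewrite -FU mU mulrDr.
- move=> S mS tS HS.
  have tSW : trivIset setT (fun n => S n `&` W) by exact: trivIset_setIr.
  have bU : bounded_borel (\bigcup_n (S n `&` W)).
    rewrite -setI_bigcupl; apply: bSW; exact: bigcup_measurable.
  have h1 := F_sigma_additive (fun n => bSW _ (mS n)) tSW (proj2 bU).
  have : (\sum_(0 <= i < n) lebesgue_measure (S i `&` W))%E @[n --> \oo] -->
      (fine (lebesgue_measure (\bigcup_n (S n `&` W))))%:E.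
    rewrite fineK ?lebesgue_bounded_borel_fin//.
    apply: measure_semi_sigma_additive => //; last exact: (proj1 bU).
    by move=> n; exact: (proj1 (bSW _ (mS n))).
  move=> /fine_cvg h2.
  rewrite setI_bigcupl; apply: cvg_uniq h1 _.
  rewrite (_ : (fun n => _) = (fun n => c *
      (fine \o (fun n => \sum_(0 <= i < n) lebesgue_measure (S i `&` W))%E) n)).
    by apply: cvgM => //; exact: cvg_cst.
  apply/funext => n /=; rewrite big_mkord -sum_fine; last first.
    by move=> i _; exact/lebesgue_bounded_borel_fin/bSW.
  by rewrite mulr_sumr; apply: eq_bigr => i _; exact: HS.
Qed.

End additive_set_functions.

(** * The two ends of the interval *)

Section open_interval.
Context {R : realType}.
Variables (a b : \bar R).
Local Notation D := [set s : R | (a < s%:E < b)%E].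

Lemma downto_proper : ProperFilter (downto a).
Proof. by case: a => [r||] /=; [exact: at_right_proper_filter|exact: proper_pinfty_nbhs|exact: proper_ninfty_nbhs]. Qed.

Lemma upto_proper : ProperFilter (upto b).
Proof. by case: b => [r||] /=; [exact: at_left_proper_filter|exact: proper_pinfty_nbhs|exact: proper_ninfty_nbhs]. Qed.

Lemma ends_proper : ProperFilter (filter_prod (downto a) (upto b)).
Proof.
have Fa := downto_proper; have Fb := upto_proper.
exact: filter_prod_proper.
Qed.

Lemma downto_near (p : R) : (a < p%:E)%E ->
  \forall x \near downto a, (a < x%:E)%E /\ x <= p.
Proof.
case: a => [r| |]; rewrite ?lte_fin//= => rp.
  near=> x; rewrite lte_fin; split => //.
  by near: x; apply: nbhs_right_le.
near=> x; rewrite ltNyr; split => //.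
Unshelve. all: by end_near. Qed.

Lemma upto_near (q : R) : (q%:E < b)%E ->
  \forall x \near upto b, (x%:E < b)%E /\ q <= x.
Proof.
case: b => [r| |]; rewrite ?lte_fin//= => rp.
  near=> x; rewrite lte_fin; split => //.
  by near: x; apply: nbhs_left_ge.
near=> x; rewrite ltry; split => //.
Unshelve. all: by end_near. Qed.

(** What tending to both ends of the interval means in practice: every compact
    subinterval is eventually covered. *)
Lemma ends_near (p q : R) : (a < p%:E)%E -> (q%:E < b)%E ->
  \forall x \near filter_prod (downto a) (upto b),
    [/\ (a < x.1%:E)%E, x.1 <= p, (x.2%:E < b)%E & q <= x.2].
Proof.
move=> ap qb; have Fa := downto_proper; have Fb := upto_proper.
exists ([set x | (a < x%:E)%E /\ x <= p], [set x | (x%:E < b)%E /\ q <= x]).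
  by split; [exact: downto_near|exact: upto_near].
by move=> [x y] [[? ?] [? ?]].
Qed.

Lemma itv_sub_open (p q : R) : (a < p%:E)%E -> (q%:E < b)%E -> `[p, q]%classic `<=` D.
Proof.
move=> ap qb x /=; rewrite in_itv/= => /andP[px xq].
by rewrite (lt_le_trans ap) ?lee_fin// (le_lt_trans _ qb) ?lee_fin.
Qed.

Lemma itvoc_sub_open (p q : R) : (a < p%:E)%E -> (q%:E < b)%E -> `]p, q]%classic `<=` D.
Proof.
move=> ap qb x px; apply: (itv_sub_open ap qb).
by move: px; rewrite /= !in_itv/= => /andP[/ltW -> ->].
Qed.

Lemma measurable_open : measurable D.
Proof.
have : measurable_fun setT (EFin \o id : R -> \bar R) by exact/measurable_EFinP.
move=> /(_ measurableT _ (emeasurable_itv `]a, b[%O)); rewrite setTI.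
by congr measurable; apply/seteqP; split => x; rewrite /= in_itv.
Qed.

Lemma inner_borel_sub (p q : R) B : (a < p%:E)%E -> (q%:E < b)%E ->
  measurable B -> B `<=` `[p, q]%classic -> inner_borel a b B.
Proof.
move=> ap qb mB Bpq; split => //.
- exact: subset_trans Bpq (itv_sub_open ap qb).
- apply: (lt_le_trans ap); apply: le_ereal_inf_tmp => _ [x Bx <-].
  by have := Bpq _ Bx; rewrite /= in_itv/= lee_fin => /andP[].
- apply: le_lt_trans qb; apply: ge_ereal_sup => _ [x Bx <-].
  by have := Bpq _ Bx; rewrite /= in_itv/= lee_fin => /andP[].
Qed.

(** The strict inequalities for the extended infimum and supremum leave room
    for real endpoints. *)
Lemma inner_borel_itv B : inner_borel a b B ->
  exists p q, [/\ (a < p%:E)%E, (q%:E < b)%E & B `<=` `]p, q]%classic].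
Proof.
move=> [mB BD ainf supb].
have [p ap Bp] : exists2 p : R, (a < p%:E)%E & (p%:E < ereal_inf [set s%:E | s in B])%E.
  move: ainf; case: a => [r| |]; case: (ereal_inf _) => [i| |]//=.
  - by rewrite lte_fin => ri; exists ((r + i) / 2); rewrite lte_fin; lra.
  - by move=> _; exists (r + 1); rewrite ?lte_fin ?ltry//; lra.
  - by move=> _; exists (i - 1); rewrite ?ltNyr ?lte_fin//; lra.
  - by move=> _; exists 0; rewrite ?ltNyr ?ltry.
have [q qb Bq] : exists2 q : R, (q%:E < b)%E & (ereal_sup [set s%:E | s in B] < q%:E)%E.
  move: supb; case: b => [r| |]; case: (ereal_sup _) => [i| |]//=.
  - by rewrite lte_fin => ri; exists ((r + i) / 2); rewrite lte_fin; lra.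
  - by move=> _; exists (r - 1); rewrite ?lte_fin ?ltNyr//; lra.
  - by move=> _; exists (i + 1); rewrite ?ltry ?lte_fin//; lra.
  - by move=> _; exists 0; rewrite ?ltNyr ?ltry.
exists p, q; split => // x Bx; rewrite /= in_itv/= -!lte_fin -lee_fin.
apply/andP; split.
  by apply: (lt_le_trans Bp); apply: ereal_inf_lbound; exists x.
by apply/ltW/(le_lt_trans _ Bq); apply: ereal_sup_ubound; exists x.
Qed.

Lemma inner_bounded_borel B : inner_borel a b B -> bounded_borel B.
Proof.
move=> iB; have [p [q [_ _ Bpq]]] := inner_borel_itv iB.
by case: iB => mB _ _ _; apply: (bounded_borelS mB Bpq); exact: bounded_borel_itv.
Qed.

(** Countable exhaustion, by which limits at the two ends reduce to sequences. *)
Lemma open_exhaustion : (a < b)%E -> exists p q : nat -> R,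
  [/\ forall n, (a < (p n)%:E)%E, forall n, ((q n)%:E < b)%E,
      forall m n, (m <= n)%N -> p n <= p m /\ q m <= q n &
      D = \bigcup_n `]p n, q n]%classic].
Proof.
move=> ab.
have iN m n : (m <= n)%N -> n.+1%:R^-1 <= m.+1%:R^-1 :> R.
  by move=> mn; rewrite lef_pV2 ?posrE// ler_nat.
have i0 n : 0 < n.+1%:R^-1 :> R by rewrite invr_gt0.
have small (e : R) : 0 < e -> exists N, forall n, (N <= n)%N -> n.+1%:R^-1 < e.
  move=> e0; exists (Num.truncn e^-1) => n Nn; apply: (le_lt_trans (iN _ _ Nn)).
  by rewrite invf_plt ?posrE//; exact: truncnS_gt.
have large (x : R) : exists N, forall n, (N <= n)%N -> x < n%:R.
  exists (Num.truncn x).+1 => n Nn; apply: (lt_le_trans (truncnS_gt x)).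
  by rewrite ler_nat.
have [p [ap pmono pex]] : exists p : nat -> R, [/\ forall n, (a < (p n)%:E)%E,
    forall m n, (m <= n)%N -> p n <= p m &
    forall s : R, (a < s%:E)%E -> exists N, forall n, (N <= n)%N -> p n < s].
  move: ab; case: a => [r| |] h.
  - exists (fun n => r + n.+1%:R^-1); split => [n|m n mn|s].
    + by rewrite lte_fin ltrDl.
    + by rewrite lerD2l iN.
    + rewrite lte_fin -subr_gt0 => /small[N hN]; exists N => n /hN.
      by rewrite ltrBrDl.
  - by move: h; rewrite ltNge leey.
  - exists (fun n => - n%:R); split => [n|m n mn|s _].
    + by rewrite ltNyr.
    + by rewrite lerN2 ler_nat.
    + by have [N hN] := large (- s); exists N => n /hN; rewrite ltrNl.
have [q [qb qmono qex]] : exists q : nat -> R, [/\ forall n, ((q n)%:E < b)%E,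
    forall m n, (m <= n)%N -> q m <= q n &
    forall s : R, (s%:E < b)%E -> exists N, forall n, (N <= n)%N -> s < q n].
  move: ab; case: b => [r| |] h.
  - exists (fun n => r - n.+1%:R^-1); split => [n|m n mn|s].
    + by rewrite lte_fin ltrBlDr ltrDl.
    + by rewrite lerD2l lerN2 iN.
    + rewrite lte_fin -subr_gt0 => /small[N hN]; exists N => n /hN.
      by rewrite ltrBrDl ltrBrDl addrC.
  - exists (fun n => n%:R); split => [n|m n mn|s _].
    + by rewrite ltry.
    + by rewrite ler_nat.
    + exact: large.
  - by move: h; rewrite ltNge leNye.
exists p, q; split => // [m n mn|]; first by split; [exact: pmono|exact: qmono].
apply/seteqP; split => [s /= /andP[/pex[N hN] /qex[M hM]]|s [n _]]; last first.
  exact: itvoc_sub_open.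
exists (maxn N M) => //=; rewrite in_itv/= hN ?leq_maxl//=.
by rewrite ltW// hM// leq_maxr.
Qed.

(** Monotone convergence along compact subintervals. *)
Lemma open_integral_le (F : R -> \bar R) (M : \bar R) : (a < b)%E ->
  measurable_fun D F -> (forall x, D x -> 0 <= F x)%E -> (0 <= M)%E ->
  (forall p q : R, (a < p%:E)%E -> p < q -> (q%:E < b)%E ->
    (\int[@lebesgue_measure R]_(x in `]p, q]) F x <= M)%E) ->
  (\int[@lebesgue_measure R]_(x in D) F x <= M)%E.
Proof.
move=> ab mF F0 M0 FM; have [p [q [ap qb mono DE]]] := open_exhaustion ab.
have mI n : measurable (`]p n, q n]%classic : set (measurableTypeR R)).
  exact: measurable_itv.
have nI : nondecreasing_seq (fun n => `]p n, q n]%classic : set (measurableTypeR R)).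
  move=> m n mn; apply/subsetPset => x /=; rewrite !in_itv/= => /andP[h1 h2].
  by have [pm qm] := mono m n mn; rewrite (le_lt_trans pm h1) (le_trans h2 qm).
have mFn n : measurable_fun (`]p n, q n]%classic : set (measurableTypeR R)) F.
  exact: (measurable_funS measurable_open (itvoc_sub_open (ap n) (qb n))).
have F0n n x : (`]p n, q n]%classic : set (measurableTypeR R)) x -> (0 <= F x)%E.
  by move=> /(itvoc_sub_open (ap n) (qb n)); exact: F0.
have := @ge0_nondecreasing_set_cvg_integral _ (measurableTypeR R) R _ F
  (@lebesgue_measure R) nI mI mFn F0n.
rewrite -DE => h.
rewrite -(cvg_lim _ h)//; apply: lime_le; first by apply/cvg_ex; eexists; exact: h.
apply: nearW => n; have [pq|qp] := ltP (p n) (q n); first exact: FM.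
by rewrite set_itv_ge ?integral_set0// bnd_simp -leNgt.
Qed.

(** The finite integral is absolutely continuous at both ends. *)
Lemma open_integral_tail (F : R -> \bar R) (theta : R) : (a < b)%E ->
  measurable_fun D F -> (forall x, D x -> 0 <= F x)%E ->
  (\int[@lebesgue_measure R]_(x in D) F x < +oo)%E -> 0 < theta ->
  exists p q : R, [/\ (a < p%:E)%E, (q%:E < b)%E &
    (\int[@lebesgue_measure R]_(x in D `\` `]p, q]%classic) F x <= theta%:E)%E].
Proof.
move=> ab mF F0 Ffin t0; have [p [q [ap qb mono DE]]] := open_exhaustion ab.
have mI n : measurable (`]p n, q n]%classic : set (measurableTypeR R)).
  exact: measurable_itv.
have ID n : `]p n, q n]%classic `<=` D by exact: itvoc_sub_open.
have nI : nondecreasing_seq (fun n => `]p n, q n]%classic : set (measurableTypeR R)).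
  move=> m n mn; apply/subsetPset => x /=; rewrite !in_itv/= => /andP[h1 h2].
  by have [pm qm] := mono m n mn; rewrite (le_lt_trans pm h1) (le_trans h2 qm).
have mFn n : measurable_fun (`]p n, q n]%classic : set (measurableTypeR R)) F.
  exact: (measurable_funS measurable_open (ID n)).
have F0n n x : (`]p n, q n]%classic : set (measurableTypeR R)) x -> (0 <= F x)%E.
  by move=> /(ID n); exact: F0.
have := @ge0_nondecreasing_set_cvg_integral _ (measurableTypeR R) R _ F
  (@lebesgue_measure R) nI mI mFn F0n.
rewrite -DE; pose V := (\int[@lebesgue_measure R]_(x in D) F x)%E.
rewrite -[X in _ --> X -> _]/V.
have Vfin : V \is a fin_num by rewrite ge0_fin_numE// integral_ge0.
rewrite -(fineK Vfin) => /fine_cvgP[_ /cvgrPdist_le/(_ _ t0)[n _ hn]].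
exists (p n), (q n); split => //.
have mDI : measurable (D `\` `]p n, q n]%classic : set (measurableTypeR R)).
  by apply: measurableD => //; exact: measurable_open.
have E : V = (\int[@lebesgue_measure R]_(x in `]p n, q n]) F x +
    \int[@lebesgue_measure R]_(x in D `\` `]p n, q n]%classic) F x)%E.
  rewrite /V -[in LHS](setDUK (ID n)) ge0_integral_setU//.
  - by rewrite setDUK.
  - by rewrite setDUK.
  - by apply/disj_setPS => x [h []].
have u0 : (0 <= \int[@lebesgue_measure R]_(x in `]p n, q n]) F x)%E.
  by apply: integral_ge0 => x; exact: F0n.
have v0 : (0 <= \int[@lebesgue_measure R]_(x in D `\` `]p n, q n]%classic) F x)%E.
  by apply: integral_ge0 => x [Dx _]; exact: F0.
have := hn n (leqnn n); rewrite /=.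
have ufin : (\int[@lebesgue_measure R]_(x in `]p n, q n]) F x)%E \is a fin_num.
  rewrite ge0_fin_numE//; apply: le_lt_trans Ffin; rewrite -/V E; exact: leeDl.
have vfin : (\int[@lebesgue_measure R]_(x in D `\` `]p n, q n]%classic) F x)%E \is a fin_num.
  rewrite ge0_fin_numE//; apply: le_lt_trans Ffin; rewrite -/V E; exact: leeDr.
rewrite {1}E fineD// addrAC subrr add0r -{2}(fineK vfin) lee_fin.
exact/le_trans/ler_norm.
Qed.

End open_interval.

(** * Convergence in probability *)

Section convergence_in_probability.
Context {R : realType} {d : measure_display} {T : measurableType d}
  (P : probability T R).

Lemma cvg_probability0 {I : Type} (F : set_system I) {FF : Filter F}
    (A : I -> set T) : (forall i, measurable (A i)) ->
  P (A i) @[i --> F] --> 0%E <->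
  forall e : R, 0 < e -> \forall i \near F, (P (A i) <= e%:E)%E.
Proof.
move=> mA; have fA i : P (A i) \is a fin_num by exact: fin_num_measure.
split=> [/fine_cvgP[_ /cvgrPdist_le h] e e0|h].
  have := h _ e0; apply: filterS => i /=.
  by rewrite sub0r normrN ger0_norm ?fine_ge0// -lee_fin fineK.
apply/fine_cvgP; split; first exact: nearW.
apply/cvgrPdist_le => e e0; have := h _ e0; apply: filterS => i /=.
by rewrite sub0r normrN ger0_norm ?fine_ge0// -lee_fin fineK.
Qed.

Lemma measurable_ge_dist (e : R) (f g : T -> R) : measurable_fun setT f ->
  measurable_fun setT g -> measurable [set w | e <= `|f w - g w|].
Proof.
move=> mf mg; rewrite -[X in measurable X]setTI.
apply: (measurable_fun_ler (measurable_cst e) _) => //.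
  by apply: measurableT_comp => //; exact: measurable_funB.
Qed.

(** A family that is Cauchy in probability converges in probability: along a
    subfamily with geometrically small increments, the increments are almost
    surely summable by Borel-Cantelli. *)
Lemma cauchy_cvg_in_probability {I : Type} (F : set_system I)
    {FF : ProperFilter F} (Y : I -> T -> R) :
  (forall i, measurable_fun setT (Y i)) ->
  (forall e : R, 0 < e -> exists i0, \forall i \near F,
     (P [set w | (e <= `|Y i w - Y i0 w|)%R] <= e%:E)%E) ->
  exists Z : T -> R, measurable_fun setT Z /\
    forall e : R, 0 < e -> P [set w | (e <= `|Y i w - Z w|)%R] @[i --> F] --> 0%E.
Proof.
move=> mY cY; pose d_ n : R := (2 ^+ n)^-1.
have d0 n : 0 < d_ n by rewrite invr_gt0 exprn_gt0.
have dS n : d_ n.+1 = d_ n / 2 by rewrite /d_ exprS invfM mulrC.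
have [i_ Hi] : {i_ : nat -> I & forall n, \forall i \near F,
     (P [set w | (d_ n <= `|Y i w - Y (i_ n) w|)%R] <= (d_ n)%:E)%E}.
  exact: (@choice _ _ (fun n j => \forall i \near F,
     (P [set w | (d_ n <= `|Y i w - Y j w|)%R] <= (d_ n)%:E)%E)
     (fun n => cY _ (d0 n))).
pose u n := Y (i_ n).
pose E n := [set w | 2 * d_ n <= `|u n w - u n.+1 w|].
have mE n : measurable (E n) by exact: (measurable_ge_dist (2 * d_ n) (mY _) (mY _)).
have PE n : (P (E n) <= (2 * d_ n)%:E)%E.
  have [i [h1 h2]] := filter_ex (filterI (Hi n) (Hi n.+1)).
  have m1 := @measurable_ge_dist (d_ n) _ _ (mY i) (mY (i_ n)).
  have m2 := @measurable_ge_dist (d_ n.+1) _ _ (mY i) (mY (i_ n.+1)).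
  apply: (@le_trans _ _ (P ([set w | (d_ n <= `|Y i w - Y (i_ n) w|)%R] `|`
    [set w | (d_ n.+1 <= `|Y i w - Y (i_ n.+1) w|)%R]))).
    apply: le_measure; rewrite ?inE//; first exact: measurableU.
    move=> w; rewrite /E /= => h; apply/orP; rewrite !leNgt -negb_and.
    apply/negP => /andP[h3 h4]; move: h; apply/negP; rewrite -ltNge.
    have := ler_normD (u n w - Y i w) (Y i w - u n.+1 w).
    rewrite addrA subrK (distrC (u n w) (Y i w)) /u => /le_lt_trans; apply.
    by have := dS n; have := d0 n; lra.
  apply: (le_trans (measureU2 _ _ _)) => //.
  apply: (le_trans (leeD h1 h2)); rewrite -EFinD lee_fin dS.
  by have := d0 n; lra.
pose H n := \bigcup_i E (n + i)%N.
have mH n : measurable (H n) by apply: bigcup_measurable.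
have PH n : (P (H n) <= (4 * d_ n)%:E)%E.
  apply: (@le_trans _ _ (\sum_(0 <= i <oo) P (E (n + i)%N))%E).
    by apply: le_mu_bigcup => //; exact: mH.
  apply: le_trans (@epsilon_trick0 R (4 * d_ n) xpredT _); last first.
    by rewrite mulr_ge0// ltW.
  apply: lee_nneseries => // i _; apply: (le_trans (PE _)).
  rewrite lee_fin /d_ exprD natrX exprS !invfM; lra.
have outH n w : ~ H n w -> forall m k, (n <= m)%N ->
    `|u m w - u (m + k)%N w| <= 4 * d_ m - 4 * d_ (m + k)%N.
  move=> Hw m k nm; elim: k => [|k IH]; first by rewrite addn0 !subrr normr0.
  have := ler_normD (u m w - u (m + k)%N w) (u (m + k)%N w - u (m + k).+1 w).
  rewrite addrA subrK addnS => /le_trans; apply; rewrite dS.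
  have : `|u (m + k)%N w - u (m + k).+1 w| < 2 * d_ (m + k)%N.
    rewrite ltNge; apply/negP => h; apply: Hw; exists (m + k - n)%N => //.
    by rewrite /E /= subnKC// (leq_trans nm)// leq_addr.
  lra.
have d_cvg : d_ @ \oo --> (0 : R).
  rewrite (_ : d_ = (fun n => (2^-1) ^+ n)); last first.
    by apply/funext => n; rewrite exprVn.
  by apply: cvg_expr; rewrite ger0_norm ?invr_lt1 ?unitfE//; lra.
have d_small (e : R) : 0 < e -> exists n, d_ n < e.
  move=> e0; move/cvgrPdist_lt : d_cvg => /(_ _ e0)[n _ /(_ n (leqnn n))] /=.
  by rewrite sub0r normrN gtr0_norm// => ?; exists n.
have cvgH n w : ~ H n w -> cvgn (fun n => u n w).
  move=> Hw; apply/cauchy_cvgP/cauchy_exP => e e0.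
  have [m hm] := d_small (e / 4) ltac:(lra).
  exists (u (maxn n m) w); exists (maxn n m) => // k /= nk.
  rewrite -ball_normE /=; have := outH _ _ Hw (maxn n m) (k - maxn n m)%N.
  rewrite subnKC// leq_maxl => /(_ isT) /le_lt_trans; apply.
  have : d_ (maxn n m) <= d_ m.
    by rewrite /d_ lef_pV2 ?posrE ?exprn_gt0// ler_eXn2l ?leq_maxr//; lra.
  by have := d0 k; lra.
pose N := \bigcap_n H n.
have mN : measurable N by apply: bigcap_measurable.
pose v n w : R := u n w * \1_(~` N) w.
have mv n : measurable_fun setT (v n).
  apply: measurable_funM; first exact: mY.
  by apply: measurable_indic; exact: measurableC.
have cv w : cvgn (fun n => v n w).
  have [Nw|Nw] := pselect (N w).
    rewrite (_ : (fun n => v n w) = cst 0); first exact: is_cvg_cst.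
    apply/funext => n; rewrite /v indicE memNset/= ?mulr0//.
  rewrite /v indicE mem_set//; under eq_fun do rewrite mulr1.
  move: Nw => /existsNP[n /not_implyP[_]]; exact: cvgH.
pose Z w := limn (fun n => v n w).
have mZ : measurable_fun setT Z.
  by apply: (@measurable_fun_cvg _ _ _ _ v) => // w _; exact: cv.
have ZH n w : ~ H n w -> `|u n w - Z w| <= 4 * d_ n.
  move=> Hw; have c : (fun k => `|u n w - u k w|) @ \oo --> `|u n w - Z w|.
    apply: cvg_norm; apply: cvgB; first exact: cvg_cst.
    rewrite (_ : (fun k => u k w) = (fun k => v k w)); first exact: cv.
    apply/funext => k; rewrite /v indicE mem_set ?mulr1//.
    by move=> /(_ n Logic.I).
  apply: (cvgr_to_le c); exists n => // k /= nk.
  have := outH _ _ Hw n (k - n)%N (leqnn n); rewrite subnKC//.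
  by have := d0 k; lra.
exists Z; split => // e e0.
apply/cvg_probability0 => [i|r r0]; first exact: measurable_ge_dist.
(* Four for the tail of the subsequence, one for the distance to it. *)
have [n] := d_small (Num.min e r / 5) ltac:(by rewrite divr_gt0// lt_min e0).
rewrite ltr_pdivlMr// lt_min => /andP[ne nr].
have := Hi n; apply: filterS => i h.
have m1 := @measurable_ge_dist (d_ n) _ _ (mY i) (mY (i_ n)).
apply: (@le_trans _ _ (P ([set w | (d_ n <= `|Y i w - Y (i_ n) w|)%R] `|` H n))).
  apply: le_measure; rewrite ?inE//; first exact: measurable_ge_dist.
    exact: measurableU.
  move=> w /= h1; have [Hw|Hw] := pselect (H n w); [by right|left].
  have := ler_normD (Y i w - u n w) (u n w - Z w); rewrite addrA subrK.
  by have := ZH _ _ Hw; rewrite /u; lra.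
apply: (le_trans (measureU2 _ _ _)) => //.
apply: (le_trans (leeD h (PH n))); rewrite -EFinD lee_fin; lra.
Qed.

End convergence_in_probability.

(** * Independence and expectations *)

Section bounded_integrals.
Context {R : realType} {d : measure_display} {T : measurableType d}
  (P : probability T R).

Lemma bounded_integrable (f : T -> R) (M : R) : measurable_fun setT f ->
  (forall w, `|f w| <= M) -> P.-integrable setT (EFin \o f).
Proof.
move=> mf fM; apply: measurable_bounded_integrable => //.
  by rewrite -ge0_fin_numE// fin_num_measure.
by exists M; split; [exact: num_real|move=> N MN x _ /=; rewrite (le_trans (fM x))// ltW].
Qed.

Lemma bounded_Rintegral_cvg (f_ : nat -> T -> R) (f : T -> R) (M : R) :
  (forall n, measurable_fun setT (f_ n)) -> measurable_fun setT f ->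
  (forall n w, `|f_ n w| <= M) ->
  {ae P, forall w, f_ n w @[n --> \oo] --> f w} ->
  \int[P]_w f_ n w @[n --> \oo] --> \int[P]_w f w.
Proof.
move=> mf_ mf fM fc.
have [] := @dominated_convergence _ _ _ P setT measurableT
  (fun n w => (f_ n w)%:E) (EFin \o f) (cst M%:E).
- by move=> n; exact/measurable_EFinP.
- exact/measurable_EFinP.
- move: fc; apply: filterS => w fw _;
  by apply/fine_cvgP; split; [exact: nearW|exact: fw].
- have -> : cst M%:E = EFin \o (cst M : T -> R) by [].
  by apply: (@bounded_integrable _ `|M|) => // w; exact: lexx.
- by apply: aeW => w n _ /=; rewrite lee_fin.
move=> intf _ h.
have : (\int[P]_w f w)%:E = (\int[P]_w (EFin \o f) w)%E.
  by rewrite fineK//; exact: integrable_fin_num.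
by move=> E; move: h; rewrite -E => /fine_cvg.
Qed.

Lemma Rintegral_prob_cst (c : R) : \int[P]_w c = c.
Proof.
rewrite Rintegral_cst//; transitivity (c * fine 1%E); last by rewrite mulr1.
by congr (c * fine _); exact: probability_setT.
Qed.

Lemma Rintegral_sum_seq (I : Type) (s : seq I) (f : I -> T -> R) :
  (forall i, P.-integrable setT (EFin \o f i)) ->
  \int[P]_w (\sum_(i <- s) f i w) = \sum_(i <- s) \int[P]_w f i w.
Proof.
move=> If; elim: s => [|i s IH].
  by under eq_Rintegral do rewrite big_nil; rewrite Rintegral_prob_cst big_nil.
under eq_Rintegral do rewrite big_cons.
rewrite big_cons RintegralD ?IH//.
have -> : EFin \o (fun w => \sum_(i <- s) f i w) =
    (fun w => \sum_(i <- s) (EFin \o f i) w)%E.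
  by apply/funext => w /=; rewrite sumEFin.
exact: integrable_sum.
Qed.

End bounded_integrals.

Section independence_expectation.
Import HBSimple HBNNSimple.
Context {R : realType} {dO dV : measure_display}
  {Omega : measurableType dO} {V : measurableType dV} (P : probability Omega R).

(** An identity between integrals of [r * G Y] that holds for indicators [G]
    extends to bounded measurable [G], by uniform approximation. *)
Lemma bounded_class (Y : Omega -> V) (r : Omega -> R) (c : R) :
  measurable_fun setT Y -> measurable_fun setT r -> (forall w, `|r w| <= 1) ->
  (forall A, measurable A ->
     \int[P]_w (r w * \1_A (Y w)) = c * \int[P]_w \1_A (Y w)) ->
  forall G : V -> R, measurable_fun setT G -> (forall v, `|G v| <= 1) ->
     \int[P]_w (r w * G (Y w)) = c * \int[P]_w G (Y w).
Proof.
move=> mY mr r1 HA G mG G1.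
have mEG : measurable_fun setT (fun v => (G v + 1)%:E).
  by apply/measurable_EFinP; exact: measurable_funD.
have EG0 v : setT v -> (0 <= (G v + 1)%:E)%E.
  by move=> _; rewrite lee_fin; have := G1 v; rewrite ler_norml; lra.
pose g_ n := nnsfun_approx measurableT mEG n.
have mgY n : measurable_fun setT (fun w => g_ n (Y w)).
  exact: measurableT_comp.
have g0 n v : 0 <= g_ n v by [].
have g2 n v : g_ n v <= 2.
  have := @le_approx _ _ _ setT (fun v => (G v + 1)%:E) n v EG0 Logic.I.
  rewrite -nnsfun_approxE lee_fin => /le_trans; apply.
  by have := G1 v; rewrite ler_norml; lra.
have cg v : g_ n v @[n --> \oo] --> G v + 1.
  have := @cvg_nnsfun_approx _ _ _ setT measurableT _ mEG EG0 v Logic.I.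
  by move=> /fine_cvg.
have gn n w : `|g_ n (Y w)| <= 2 by rewrite ger0_norm.
have Hs (s : seq R) (g : R -> set V) : (forall i, measurable (g i)) ->
    \int[P]_w (r w * \sum_(i <- s) i * \1_(g i) (Y w)) =
    c * \int[P]_w (\sum_(i <- s) i * \1_(g i) (Y w)).
  move=> mg.
  have mi i : measurable_fun setT (fun w => \1_(g i) (Y w) : R).
    apply: measurableT_comp mY; exact: measurable_indic.
  have i1 i w : `|\1_(g i) (Y w) : R| <= 1.
    by rewrite indicE; case: (_ \in _); rewrite ?normr1 ?normr0.
  have ri i w : `|r w * \1_(g i) (Y w)| <= 1.
    by rewrite normrM mulr_ile1.
  have int1 i : P.-integrable setT (EFin \o (fun w => \1_(g i) (Y w) : R)).
    exact: (bounded_integrable P (mi i) (i1 i)).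
  have int2 i : P.-integrable setT (EFin \o (fun w => r w * \1_(g i) (Y w) : R)).
    by apply: (bounded_integrable P _ (ri i)); exact: measurable_funM.
  under eq_Rintegral do rewrite mulr_sumr.
  have int3 (i : R) (f : Omega -> R) : P.-integrable setT (EFin \o f) ->
      P.-integrable setT (EFin \o (fun w => i * f w)).
    by move=> h; have := integrableZl measurableT i h.
  rewrite !Rintegral_sum_seq.
  - rewrite mulr_sumr; apply: eq_bigr => i _.
    under eq_Rintegral do rewrite mulrCA.
    by rewrite !RintegralZl// HA// mulrCA.
  - by move=> i; apply: int3.
  - move=> i; rewrite (_ : (fun w => _) = (fun w => i * (r w * \1_(g i) (Y w)))).
      exact: int3.
    by apply/funext => w; rewrite mulrCA.
have Hg n : \int[P]_w (r w * g_ n (Y w)) = c * \int[P]_w g_ n (Y w).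
  have E v : g_ n v = \sum_(i <- finmap.enum_fset (fset_set (range (g_ n))))
      i * \1_(g_ n @^-1` [set i]) v.
    by rewrite fimfunE fsbig_finite.
  under eq_Rintegral do rewrite E.
  under [in RHS]eq_Rintegral do rewrite E.
  apply: Hs => i; exact: measurable_funPTI.
have c1 : \int[P]_w (r w * g_ n (Y w)) @[n --> \oo] -->
    \int[P]_w (r w * (G (Y w) + 1)).
  apply: (@bounded_Rintegral_cvg _ _ _ _ _ _ 2).
  - by move=> n; apply: measurable_funM.
  - apply: measurable_funM => //; apply: measurable_funD => //.
    exact: measurableT_comp.
  - by move=> n w; rewrite normrM; have := gn n w; have := r1 w;
      have := normr_ge0 (r w); have := normr_ge0 (g_ n (Y w)); nra.
  - by apply: aeW => w; apply: cvgM; [exact: cvg_cst|exact: cg].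
have c2 : \int[P]_w g_ n (Y w) @[n --> \oo] --> \int[P]_w (G (Y w) + 1).
  apply: (@bounded_Rintegral_cvg _ _ _ _ _ _ 2) => //.
  - by apply: measurable_funD => //; exact: measurableT_comp.
  - by apply: aeW => w; exact: cg.
have mGY : measurable_fun setT (fun w => G (Y w)) by exact: measurableT_comp.
have iG : P.-integrable setT (EFin \o (fun w => G (Y w))).
  by apply: (bounded_integrable P mGY (M := 1)).
have irG : P.-integrable setT (EFin \o (fun w => r w * G (Y w))).
  apply: (bounded_integrable P _ (M := 1)); first exact: measurable_funM.
  by move=> w; rewrite normrM mulr_ile1.
have ir : P.-integrable setT (EFin \o r).
  exact: (bounded_integrable P mr r1).
have i1 : P.-integrable setT (EFin \o (fun _ : Omega => 1 : R)).
  by apply: (@bounded_integrable _ _ _ _ _ 1) => // w; rewrite normr1.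
have rc : \int[P]_w r w = c.
  have := HA setT measurableT.
  under eq_Rintegral do rewrite indicT mulr1.
  by under [in RHS]eq_Rintegral do rewrite indicT; rewrite Rintegral_prob_cst mulr1.
have : \int[P]_w (r w * (G (Y w) + 1)) = c * \int[P]_w (G (Y w) + 1).
  apply: cvg_uniq c1 _; under eq_fun do rewrite Hg.
  by apply: cvgM => //; exact: cvg_cst.
under eq_Rintegral do rewrite mulrDr mulr1.
have -> : \int[P]_w (r w * G (Y w) + r w) = \int[P]_w (r w * G (Y w)) + c.
  by rewrite -rc; exact: (RintegralD measurableT irG ir).
have -> : \int[P]_w (G (Y w) + 1) = \int[P]_w (G (Y w)) + 1.
  by rewrite -[X in _ + X](Rintegral_prob_cst P); exact: (RintegralD measurableT iG i1).
rewrite mulrDr mulr1.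
exact: addIr.
Qed.

(** The indicators in the definition of independence are replaced by the
    functions [F i] one variable at a time. *)
Lemma independent_prod n (Y : 'I_n -> {RV P >-> V}) : independent_RVs Y ->
  forall F : 'I_n -> V -> R, (forall i, measurable_fun setT (F i)) ->
  (forall i v, `|F i v| <= 1) ->
  \int[P]_w (\prod_(i < n) F i (Y i w)) = \prod_(i < n) \int[P]_w F i (Y i w).
Proof.
move=> indY F mF F1.
pose mix (k : nat) (A : 'I_n -> set V) (i : 'I_n) (v : V) : R :=
  if (i < k)%N then F i v else \1_(A i) v.
have mmix k A i : (forall i, measurable (A i)) -> measurable_fun setT (mix k A i).
  move=> mA; rewrite /mix; case: (i < k)%N; [exact: mF|exact: measurable_indic].
have mix1 k A i v : `|mix k A i v| <= 1.
  rewrite /mix; case: ifP => // _.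
  by rewrite indicE; case: (_ \in _); rewrite ?normr1 ?normr0.
suff H k : (k <= n)%N -> forall A : 'I_n -> set V, (forall i, measurable (A i)) ->
    \int[P]_w (\prod_(i < n) mix k A i (Y i w)) =
    \prod_(i < n) \int[P]_w mix k A i (Y i w).
  have := H n (leqnn n) (fun=> setT) (fun=> measurableT).
  under eq_Rintegral do under eq_bigr do rewrite /mix ltn_ord.
  by under [in RHS]eq_bigr do under eq_Rintegral do rewrite /mix ltn_ord.
elim: k => [_ A mA|k IH kn A mA].
  have indI (B : set V) : measurable B -> forall i, \int[P]_w (\1_B (Y i w)) = fine (P (Y i @^-1` B)).
    move=> mB i; rewrite /Rintegral; congr fine.
    rewrite (_ : (fun w => _) = (fun w => (\1_(Y i @^-1` B) w)%:E))//.
    rewrite integral_indic ?setIT//; exact: measurable_funPTI.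
  under [RHS]eq_bigr do rewrite /mix/= indI//.
  have := indY A mA => /(congr1 fine).
  have fP i : P (Y i @^-1` A i) = (fine (P (Y i @^-1` A i)))%:E.
    by rewrite fineK// fin_num_measure//; exact: measurable_funPTI.
  have -> : (\prod_(i < n) P (Y i @^-1` A i))%E =
      (\prod_(i < n) fine (P (Y i @^-1` A i)))%:E.
    by rewrite -prodEFin; apply: eq_bigr => i _; exact: fP.
  rewrite /= => <-.
  rewrite /Rintegral; congr fine.
  rewrite -[X in P X]setIT -integral_indic//; last first.
    apply: fin_bigcap_measurable => [|i _]; first exact: finite_finset.
    exact: measurable_funPTI.
  apply: eq_integral => w _; congr EFin; rewrite /mix/=.
  under eq_bigr do rewrite indicE.
  rewrite indicE; have [h|h] := pselect ((\bigcap_(i in [set: 'I_n]) (Y i @^-1` A i)) w).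
    rewrite (mem_set h) big1// => i _; rewrite mem_set//; exact: h.
  rewrite (memNset h).
  have /existsNP[i /not_implyP[_ hi]] := h.
  by rewrite (bigD1 i)//= memNset// mul0r.
pose j : 'I_n := Ordinal kn.
pose r w := \prod_(i < n | i != j) mix k A i (Y i w).
pose c := \prod_(i < n | i != j) \int[P]_w mix k A i (Y i w).
have mmY i B : (forall i, measurable (B i)) -> measurable_fun setT (fun w => mix k B i (Y i w)).
  by move=> mB; apply: measurableT_comp => //; exact: mmix.
have mr : measurable_fun setT r.
  rewrite /r; under eq_fun do rewrite big_mkcond/=.
  apply: measurable_prod => i _; case: (i != j) => //; first exact: mmY.
have r1 w : `|r w| <= 1.
  rewrite /r normr_prod; apply: prodr_ile1 => i _.
  by rewrite normr_ge0 mix1.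
have mixj B i : i != j -> mix k.+1 B i = mix k B i.
  move=> ij; apply/funext => v; rewrite /mix ltnS leq_eqVlt.
  by have -> : (i == k :> nat) = false by apply/negbTE.
have HB (B : set V) : measurable B ->
    \int[P]_w (r w * \1_B (Y j w)) = c * \int[P]_w \1_B (Y j w).
  move=> mB; pose A' i := if i == j then B else A i.
  have mA' i : measurable (A' i) by rewrite /A'; case: ifP.
  have := IH (ltnW kn) A' mA'.
  have E i v : i != j -> mix k A' i v = mix k A i v.
    by move=> ij; rewrite /mix /A' (negbTE ij).
  have Ej v : mix k A' j v = \1_B v by rewrite /mix ltnn /A' eqxx.
  rewrite [RHS](bigD1 j)//= mulrC => h.
  transitivity (\int[P]_w \prod_(i < n) mix k A' i (Y i w)).
    apply: eq_Rintegral => w _; rewrite (bigD1 j)//= Ej mulrC; congr (_ * _).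
    by apply: eq_bigr => i ij; rewrite E.
  rewrite h; congr (_ * _); last by apply: eq_Rintegral => w _; rewrite Ej.
  by apply: eq_bigr => i ij; apply: eq_Rintegral => w _; rewrite E.
have h := bounded_class (@measurable_funPT _ _ _ _ (Y j)) mr r1 HB (mF j) (F1 j).
rewrite [RHS](bigD1 j)//=.
transitivity (\int[P]_w (r w * F j (Y j w))).
  apply: eq_Rintegral => w _; rewrite (bigD1 j)//= mulrC; congr (_ * _).
    by apply: eq_bigr => i ij; rewrite mixj.
  by rewrite /mix ltnSn.
rewrite h mulrC; congr (_ * _).
  by apply: eq_Rintegral => w _; rewrite /mix ltnSn.
by apply: eq_bigr => i ij; apply: eq_Rintegral => w _; rewrite mixj.
Qed.

End independence_expectation.

(** * The gliding hump *)

Section gliding_hump.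
Context {R : realType} {d : measure_display} {T : measurableType d}
  (mu : {measure set T -> \bar R}).
Variable D : set T.
Hypotheses (mD : measurable D) (finD : (mu D < +oo)%E).
Variables (g : nat -> T -> R) (f : T -> R).
Hypothesis mg : forall n, measurable_fun D (g n).
Hypothesis mf : measurable_fun D f.
Hypothesis g_bounded : forall n, exists M, forall x, D x -> `|g n x| <= M.
Hypothesis g_cvg : {ae mu, forall x, D x -> g n x @[n --> \oo] --> f x}.

Let bint (B : set T) (h : T -> R) (M : R) : measurable B -> B `<=` D ->
  measurable_fun D h -> (forall x, B x -> `|h x| <= M) ->
  mu.-integrable B (EFin \o h).
Proof.
move=> mB BD mh hM; apply: measurable_bounded_integrable => //.
- by apply: le_lt_trans finD; apply: le_measure; rewrite ?inE.
- exact: measurable_funS mh.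
exists M; split; [exact: num_real|move=> N MN x Bx /=].
by rewrite (le_trans (hM x Bx))// ltW.
Qed.

(** On [level k] the functions are bounded by [k], so that their integrals
    converge there; these sets exhaust the part of [D] where [f] is
    positive. *)
Let level (k : nat) : set T :=
  D `&` [set x | 0 < f x] `&` [set x | f x <= k%:R]
    `&` \bigcap_n [set x | D x /\ `|g n x| <= k%:R].

(** Almost everywhere convergence makes the sequence bounded at almost every
    point, so this is the positivity set of [f] up to a null set. *)
Let pos : set T := \bigcup_k level k.

Let mDle (h h' : T -> R) : measurable_fun D h -> measurable_fun D h' ->
  measurable (D `&` [set x | h x <= h' x]).
Proof. by move=> mh mh'; exact: measurable_fun_le. Qed.

Let mlevel k : measurable (level k).
Proof.
rewrite /level; apply: measurableI; last first.
  apply: bigcapT_measurable => n.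
  rewrite (_ : [set x | _] = D `&` [set x | `|g n x| <= k%:R]); last by [].
  by apply: mDle; [apply: measurableT_comp|exact: measurable_cst].
rewrite (_ : _ `&` _ = (D `&` [set x | 0 < f x]) `&` (D `&` [set x | f x <= k%:R])).
  apply: measurableI; last by apply: mDle => //; exact: measurable_cst.
  rewrite (_ : _ `&` _ = D `\` (D `&` [set x | f x <= 0])).
    apply: measurableD => //; apply: mDle => //; exact: measurable_cst.
  apply/seteqP; split => x [Dx] /=; rewrite ltNge.
    by move=> /negP h; split => // -[].
  by move=> h; split => //; apply/negP => h'; apply: h.
by rewrite setIACA setIid setIA.
Qed.

Let levelD k : level k `<=` D.
Proof. by move=> x [[[]]]. Qed.

Let level_le k l : (k <= l)%N -> level k `<=` level l.
Proof.
move=> kl x [[[Dx fx] fk] gk]; split; first (split => //).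
  by rewrite /= (le_trans fk)// ler_nat.
by move=> n _; split => //; rewrite (le_trans (gk n Logic.I).2)// ler_nat.
Qed.

Let mpos : measurable pos.
Proof. exact: bigcup_measurable. Qed.

Let posD : pos `<=` D.
Proof. by move=> x [k _]; exact: levelD. Qed.

Let int_level (B : set T) k (h : T -> R) : measurable B -> B `<=` level k -> measurable_fun D h ->
  (forall x, level k x -> `|h x| <= k%:R) -> mu.-integrable B (EFin \o h).
Proof.
move=> mB Bk mh hk; apply: (@bint _ _ k%:R) => // [x /Bk|x /Bk].
  exact: levelD.
exact: hk.
Qed.

Let f_level k x : level k x -> `|f x| <= k%:R.
Proof. by move=> [[[_ fx] fk] _]; rewrite ger0_norm// ltW. Qed.

Let g_level n k x : level k x -> `|g n x| <= k%:R.
Proof. by move=> [_ /(_ n Logic.I)[]]. Qed.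

Let cvg_level k :
  \int[mu]_(x in level k) `|g n x - f x| @[n --> \oo] --> 0.
Proof.
have [] := @dominated_convergence _ _ _ mu (level k) (mlevel k)
  (fun n x => (g n x)%:E) (EFin \o f) (cst k%:R%:E).
- by move=> n; apply/measurable_EFinP; exact: measurable_funS (@levelD k) (mg n).
- by apply/measurable_EFinP; exact: measurable_funS (@levelD k) mf.
- move: g_cvg; apply: filterS => x gx /levelD Dx.
  by apply/fine_cvgP; split; [exact: nearW|exact: gx].
- have -> : cst k%:R%:E = EFin \o (cst k%:R : T -> R) by [].
  by apply: (@bint _ _ k%:R) => // x _; rewrite ger0_norm.
- by apply: aeW => x n kx /=; rewrite lee_fin g_level.
by move=> _ /fine_cvg h _; exact: h.
Qed.

Let tail_level n : \int[mu]_(x in pos `\` level k) `|g n x| @[k --> \oo] --> 0.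
Proof.
have [M HM] := g_bounded n.
have intn (B : set T) : measurable B -> B `<=` D ->
    mu.-integrable B (EFin \o (fun x => `|g n x|)).
  move=> mB BD; apply: (@bint _ _ M) => //; first exact: measurableT_comp.
  by move=> x /BD /HM; rewrite normr_id.
have := @ge0_nondecreasing_set_cvg_integral _ _ _ level
  (fun x => `|g n x|%:E) mu.
move=> /(_ _ mlevel) h.
have {}h : (\int[mu]_(x in level i) `|g n x|%:E)%E @[i --> \oo] -->
    (\int[mu]_(x in pos) `|g n x|)%:E.
  rewrite fineK; last by apply: integrable_fin_num => //; exact: intn.
  apply: h => //.
  - by move=> k l kl; rewrite subsetEset; exact: level_le.
  - move=> k; apply/measurable_EFinP/measurableT_comp => //.
    exact: measurable_funS (@levelD k) (mg n).
move/fine_cvg : h => h.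
rewrite -(subrr (\int[mu]_(x in pos) `|g n x|)).
rewrite (_ : (fun k => _) = (fun k => \int[mu]_(x in pos) `|g n x| -
    \int[mu]_(x in level k) `|g n x|)).
  by apply: cvgB => //; exact: cvg_cst.
apply/funext => k.
have kpos : level k `<=` pos by move=> x kx; exists k.
rewrite -[X in \int[mu]_(x in X) _ - _](setDUK kpos) Rintegral_setU.
- by rewrite addrAC subrr add0r.
- exact: mlevel.
- exact: measurableD.
- by rewrite setDUK//; exact: intn.
- by apply/disj_setPS => x [kx []].
Qed.

(** Gliding hump: if the integral of the positive part of [f] were infinite,
    a union of successive humps [level k `\` level m] would have unbounded
    integrals. *)
Lemma pos_part_lty :
  (forall B, measurable B -> B `<=` D -> exists M : R,
     \forall n \near \oo, `|\int[mu]_(x in B) g n x| <= M) ->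
  (\int[mu]_(x in pos) (f x)%:E < +oo)%E.
Proof.
move=> H; rewrite ltNge leye_eq; apply/negP => /eqP oo.
have f0 k x : level k x -> 0 <= f x by move=> [[[_ /ltW]]].
have intf (B : set T) k : measurable B -> B `<=` level k -> mu.-integrable B (EFin \o f).
  by move=> mB Bk; apply: (@int_level _ k) => //; exact: f_level.
have intg (B : set T) n : measurable B -> B `<=` D -> mu.-integrable B (EFin \o g n).
  by move=> mB BD; have [M HM] := g_bounded n; apply: (@bint _ _ M) => // x /BD /HM.
pose s k := \int[mu]_(x in level k) f x.
have s_large (A : R) (m : nat) : exists2 k, (m <= k)%N & A <= s k.
  have := @ge0_nondecreasing_set_cvg_integral _ _ _ level (EFin \o f) mu.
  move=> /(_ _ mlevel); rewrite -/pos oo => h.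
  have {}h : (\int[mu]_(x in level i) (EFin \o f) x)%E @[i --> \oo] --> +oo%E.
    apply: h.
    - by move=> k l kl; rewrite subsetEset; exact: level_le.
    - by move=> k; apply/measurable_EFinP; exact: measurable_funS (@levelD k) mf.
    - by move=> k x /f0; rewrite lee_fin.
  move/cvgeyPge : h => /(_ A)[k0 _ hk].
  exists (maxn m k0); first exact: leq_maxl.
  have := hk (maxn m k0) (leq_maxr _ _); rewrite /= -lee_fin /s /Rintegral fineK//.
  by apply: integrable_fin_num => //; exact: (intf _ _ (mlevel _) (@subset_refl _ _)).
have step (j m : nat) : exists t : nat * nat * nat, [/\ (m <= t.1.1)%N,
    (t.1.1 <= t.2)%N, (j <= t.1.2)%N, s m + j%:R <= s t.1.1 &
    \int[mu]_(x in level t.1.1) `|g t.1.2 x - f x| <= 1 /\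
    \int[mu]_(x in pos `\` level t.2) `|g t.1.2 x| <= 1].
  have [k mk sk] := s_large (s m + j%:R) m.
  have /cvgrPdist_le/(_ _ ltr01)[n0 _ hn] := cvg_level k.
  pose n := maxn j n0.
  have /cvgrPdist_le/(_ _ ltr01)[l0 _ hl] := tail_level n.
  exists (k, n, maxn k l0); split => //=; rewrite ?leq_maxl//; split.
    have := hn n (leq_maxr _ _); rewrite /= sub0r normrN; exact/le_trans/ler_norm.
  have := hl (maxn k l0) (leq_maxr _ _); rewrite /= sub0r normrN.
  exact/le_trans/ler_norm.
have [t_ Ht] := @choice _ _ (fun jm t => _) (fun jm : nat * nat => step jm.1 jm.2).
pose m_ := fix m_ j := if j is i.+1 then (t_ (i, m_ i)).2 else 0%N.
pose k_ j := (t_ (j, m_ j)).1.1.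
pose n_ j := (t_ (j, m_ j)).1.2.
have mk j : (m_ j <= k_ j)%N by have [] := Ht (j, m_ j).
have km j : (k_ j <= m_ j.+1)%N by have [] := Ht (j, m_ j).
have jn j : (j <= n_ j)%N by have [] := Ht (j, m_ j).
have sj j : s (m_ j) + j%:R <= s (k_ j) by have [] := Ht (j, m_ j).
have e1 j : \int[mu]_(x in level (k_ j)) `|g (n_ j) x - f x| <= 1.
  by have [_ _ _ _ []] := Ht (j, m_ j).
have e2 j : \int[mu]_(x in pos `\` level (m_ j.+1)) `|g (n_ j) x| <= 1.
  by have [_ _ _ _ []] := Ht (j, m_ j).
have m_mono i j : (i <= j)%N -> (m_ i <= m_ j)%N.
  move=> /subnKC <-; elim: (j - i)%N => [|l IH]; first by rewrite addn0.
  by rewrite addnS (leq_trans IH)// (leq_trans (mk _)).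
pose B := \bigcup_j (level (k_ j) `\` level (m_ j)).
have mB : measurable B by apply: bigcup_measurable => j _; exact: measurableD.
have Bpos : B `<=` pos by move=> x [j _ [kx _]]; exists (k_ j).
have BD : B `<=` D by apply: subset_trans Bpos posD.
have [M [N _ HM]] := H B mB BD.
pose j := maxn N (Num.truncn (M + 2)).+1.
have := HM (n_ j) (leq_trans (leq_maxl _ _) (jn j)).
apply/negP; rewrite -ltNge.
pose B1 := B `&` level (k_ j); pose B2 := B `\` level (m_ j.+1).
have mB1 : measurable B1 by exact: measurableI.
have mB2 : measurable B2 by exact: measurableD.
have B12 : B = B1 `|` B2.
  apply/seteqP; split => [x Bx|x [[]|[]]//].
  have [i _ [kx mx]] := Bx; have [ij|ji] := leqP i j.
    left; split => //; move: ij; rewrite leq_eqVlt => /predU1P[<-//|ij].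
    have : (k_ i <= k_ j)%N.
      by rewrite (leq_trans (km i))// (leq_trans _ (mk j))// m_mono.
    by move=> /level_le; apply.
  by right; split => // /(level_le (m_mono _ _ ji)).
have B12_0 : [disjoint B1 & B2].
  apply/disj_setPS => x [[_ kx] [_]]; apply.
  exact: level_le (km j) _ kx.
have B1D : B1 `<=` D by move=> x [/BD].
have B2D : B2 `<=` D by move=> x [/BD].
have intB : mu.-integrable B (EFin \o g (n_ j)) by exact: intg.
have -> : \int[mu]_(x in B) g (n_ j) x =
    \int[mu]_(x in B1) g (n_ j) x + \int[mu]_(x in B2) g (n_ j) x.
  by rewrite {1}B12 Rintegral_setU// -B12.
have B1k : B1 `<=` level (k_ j) by move=> x [].
have h2 : `|\int[mu]_(x in B2) g (n_ j) x| <= 1.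
  rewrite (le_trans (le_normr_Rintegral mB2 (intg _ _ mB2 B2D)))//.
  apply: le_trans (e2 j); apply: fine_le.
  - apply: integrable_fin_num => //; exact/integrable_norm/intg.
  - apply: integrable_fin_num; first exact: measurableD.
    apply/integrable_norm/intg; first exact: measurableD.
    by move=> x [/posD].
  apply: ge0_subset_integral => //; first exact: measurableD.
    apply/measurable_EFinP/measurableT_comp => //.
    by apply: measurable_funS (mg _) => // x [/posD].
  by move=> x [/Bpos ? ?]; split.
have h1 : `|\int[mu]_(x in B1) g (n_ j) x - \int[mu]_(x in B1) f x| <= 1.
  have igf (C : set T) : measurable C -> C `<=` level (k_ j) ->
      mu.-integrable C (EFin \o (fun x => g (n_ j) x - f x)).
    move=> mC Ck; have := integrableB mC (intg C (n_ j) mC _) (intf C _ mC Ck).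
    by apply; move=> x /Ck; exact: levelD.
  rewrite -RintegralB//; [|exact: intg|exact: intf B1k].
  rewrite (le_trans (le_normr_Rintegral mB1 (igf _ mB1 B1k)))//.
  apply: le_trans (e1 j); apply: fine_le.
  - by apply: integrable_fin_num => //; exact/integrable_norm/igf.
  - by apply: integrable_fin_num => //; apply/integrable_norm/igf.
  apply: ge0_subset_integral => //.
  apply/measurable_EFinP/measurableT_comp => //; apply: measurable_funB.
    exact: measurable_funS (@levelD _) (mg _).
  exact: measurable_funS (@levelD _) mf.
have h3 : j%:R <= \int[mu]_(x in B1) f x.
  have mKM : level (m_ j) `<=` level (k_ j) by exact: level_le.
  have mC : measurable (level (k_ j) `\` level (m_ j)) by exact: measurableD.
  have E : s (k_ j) = s (m_ j) + \int[mu]_(x in level (k_ j) `\` level (m_ j)) f x.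
    have := @Rintegral_setU _ _ _ mu _ _ f (mlevel (m_ j)) mC.
    rewrite /s setDUK// => -> //.
      exact: (intf _ _ (mlevel _) (@subset_refl _ _)).
    by apply/disj_setPS => x [kx []].
  have : j%:R <= \int[mu]_(x in level (k_ j) `\` level (m_ j)) f x.
    by have := sj j; rewrite E lerD2l.
  move=> /le_trans; apply; apply: fine_le.
  - by apply: integrable_fin_num => //; apply: (intf _ (k_ j)) => // x [].
  - by apply: integrable_fin_num => //; exact: intf B1k.
  apply: ge0_subset_integral => //.
  - apply/measurable_EFinP; apply: measurable_funS mf => //.
  - by move=> x /B1k /f0; rewrite lee_fin.
  - by move=> x [kx mx]; split => //; exists j.
have : M + 2 < j%:R.
  apply: (@lt_le_trans _ _ (Num.truncn (M + 2)).+1%:R); first exact: truncnS_gt.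
  by rewrite ler_nat leq_maxr.
move: h1 h2; rewrite !ler_norml => /andP[? ?] /andP[? ?] ?.
apply: (lt_le_trans _ (ler_norm _)); lra.
Qed.

Lemma pos_partE : (\int[mu]_(x in D) (f^\+ x)%:E = \int[mu]_(x in pos) (f x)%:E)%E.
Proof.
have mf0 : measurable_fun D (fun x => (f^\+ x)%:E).
  by apply/measurable_EFinP; exact: measurable_funrpos.
transitivity (\int[mu]_(x in pos) (f^\+ x)%:E)%E; last first.
  apply: eq_integral => x /set_mem [k _ [[[_ fx] _] _]].
  by rewrite /funrpos max_l// ltW.
have [N [mN N0 HN]] := g_cvg.
rewrite -[in LHS](setDUK posD) ge0_integral_setU//=.
- rewrite [X in (_ + X)%E](_ : _ = 0%E) ?adde0//.
  rewrite (ge0_negligible_integral _ _ _ _ N0)//; last 3 first.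
  + exact: measurableD.
  + by apply: measurable_funS mf0 => // x [].
  + by move=> x _; rewrite lee_fin /funrpos le_max lexx orbT.
  apply: integral0_eq => x [[Dx npos] nNx]; congr EFin.
  rewrite /funrpos max_r// leNgt; apply/negP => fx; apply: npos.
  have gc : g n x @[n --> \oo] --> f x.
    have : ~ ~ (D x -> g n x @[n --> \oo] --> f x) by move=> h; apply: nNx; exact: HN.
    by move/contrapT; apply.
  have [M [_ /(_ (M + 1))]] := cvg_seq_bounded (cvgP _ gc).
  rewrite ltrDl ltr01 => /(_ isT) gM.
  pose A := Num.max (M + 1) (f x).
  exists (Num.truncn A).+1 => //.
  have AS : A <= (Num.truncn A).+1%:R by rewrite ltW// truncnS_gt.
  split; [split => //=|].
    by rewrite (le_trans _ AS)// le_max lexx orbT.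
  by move=> n _; split => //; rewrite (le_trans (gM n Logic.I))// (le_trans _ AS)// le_max lexx.
- exact: measurableD.
- by rewrite setDUK.
- by move=> x _; rewrite lee_fin /funrpos le_max lexx orbT.
- by apply/disj_setPS => x [kx []].
Qed.

(** The set [pos] carries the whole positive part, by [pos_partE]. *)
Lemma gliding_hump :
  (forall B, measurable B -> B `<=` D -> exists M : R,
     \forall n \near \oo, `|\int[mu]_(x in B) g n x| <= M) ->
  (\int[mu]_(x in D) (f^\+ x)%:E < +oo)%E.
Proof. by move=> H; rewrite pos_partE; exact: pos_part_lty. Qed.

End gliding_hump.

(** * Splitting a uniform number *)

Section digits.
Context {R : realType}.
Implicit Types (x y : R) (A : set R).

Let I01 : set R := `[0, 1[%classic.

Lemma measurable_I01 : measurable I01. Proof. exact: measurable_itv. Qed.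

(** Every random object constructed below lives on this probability space. *)
Definition unif (A : set R) : \bar R := lebesgue_measure (A `&` I01).

Let unif0 : unif set0 = 0%E.
Proof. by rewrite /unif set0I measure0. Qed.

Let unif_ge0 A : (0 <= unif A)%E.
Proof. exact: measure_ge0. Qed.

Let unif_sigma_additive : semi_sigma_additive unif.
Proof.
exact: (@measure_semi_sigma_additive _ _ _ (mrestr (@lebesgue_measure R) measurable_I01)).
Qed.

HB.instance Definition _ := isMeasure.Build _ R R unif
  unif0 unif_ge0 unif_sigma_additive.

Let unif_setT : unif setT = 1%E.
Proof.
rewrite /unif setTI /I01 lebesgue_measure_itv/= lte_fin ltr01.
by rewrite -EFinB subr0.
Qed.

HB.instance Definition _ := @Measure_isProbability.Build _ _ _ unif unif_setT.

Lemma unifE A : unif A = lebesgue_measure (A `&` I01).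
Proof. by []. Qed.

Lemma eq_unif A B : (forall x, 0 <= x < 1 -> A x <-> B x) -> unif A = unif B.
Proof.
move=> AB; rewrite !unifE; congr lebesgue_measure.
by apply/seteqP; split => x [? Ix]; split => //; apply/AB => //;
  move: Ix; rewrite /I01/= in_itv.
Qed.

Definition bit x : R := if x < 2^-1 then 0 else 1.

Definition doubling x : R := 2 * x - bit x.

Lemma bit_ge0 x : 0 <= bit x.
Proof. by rewrite /bit; case: ifP. Qed.

Lemma bit_le1 x : bit x <= 1.
Proof. by rewrite /bit; case: ifP. Qed.

Lemma bit_half0 x : 0 <= x < 1 -> bit ((x + 0) / 2) = 0.
Proof. by move=> x01; rewrite /bit ifT//; lra. Qed.

Lemma bit_half1 x : 0 <= x < 1 -> bit ((x + 1) / 2) = 1.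
Proof. by move=> x01; rewrite /bit ifF//; apply/negbTE; lra. Qed.

Lemma doubling_half0 x : 0 <= x < 1 -> doubling ((x + 0) / 2) = x.
Proof. by move=> x01; rewrite /doubling bit_half0//; lra. Qed.

Lemma doubling_half1 x : 0 <= x < 1 -> doubling ((x + 1) / 2) = x.
Proof. by move=> x01; rewrite /doubling bit_half1//; lra. Qed.

Lemma measurable_bit : measurable_fun setT bit.
Proof.
apply: measurable_fun_ifT => //.
by apply: measurable_fun_ltr => //; exact: measurable_id.
Qed.

Lemma measurable_doubling : measurable_fun setT doubling.
Proof.
apply: measurable_funB; last exact: measurable_bit.
exact: measurable_funM.
Qed.

Lemma measurable_half (c : R) A : measurable A ->
  measurable [set x | A ((x + c) / 2)].
Proof.
move=> mA; rewrite (_ : [set x | _] = (fun x => 2^-1 * x + c / 2) @^-1` A).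
  by rewrite -[X in measurable X]setTI; exact: measurable_fun_affine.
by apply/seteqP; split => x /=; rewrite mulrDl mulrC.
Qed.

(** The first binary digit of a uniform number is a fair coin, independent of
    the number formed by the other digits. *)
Lemma unif_half A : measurable A ->
  unif A = (2^-1%:E * (unif [set x | A ((x + 0)%R / 2)%R] +
                      unif [set x | A ((x + 1)%R / 2)%R]))%E.
Proof.
move=> mA.
have mi b1 b2 (x y : R) : measurable [set` Interval (BSide b1 x) (BSide b2 y)].
  exact: measurable_itv.
have mI := measurable_I01.
rewrite unifE (_ : A `&` I01 = (A `&` `[0, 2^-1[%classic) `|` (A `&` `[2^-1, 1[%classic)); last first.
  rewrite -setIUr; congr (_ `&` _); apply/seteqP; split => x; rewrite /I01/= !in_itv/=.
    move=> x01; case: (ltP x 2^-1) => h; [left|right]; lra.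
  by case=> ?; lra.
rewrite measureU/=; last 3 first.
- by apply: measurableI => //; exact: mi.
- by apply: measurableI => //; exact: mi.
- by rewrite -subset0 => x [] [_] /=; rewrite !in_itv/= => ? [_]; lra.
rewrite ge0_muleDr//.
have h c : measurable ([set x | A ((x + c) / 2)] `&` I01).
  by apply: measurableI => //; exact: measurable_half.
have h2 : (0 : R) < 2 by [].
congr (_ + _)%E; rewrite !unifE.
  rewrite -(lebesgue_measure_affine 0 h2 (h 0)); congr lebesgue_measure.
  apply/seteqP; split => x; rewrite /I01/= !in_itv/= !addr0 mulrAC divff ?mul1r//;
    by move=> [? ?]; split => //; lra.
rewrite -(lebesgue_measure_affine (- 1) h2 (h 1)); congr lebesgue_measure.
apply/seteqP; split => x; rewrite /I01/= !in_itv/= subrK mulrAC divff ?mul1r//;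
  by move=> [? ?]; split => //; lra.
Qed.

(** [evens n x] keeps the first [n] binary digits of even rank of [x]; the
    digits of odd rank are those of even rank of [doubling x]. *)
Fixpoint evens n x : R :=
  if n is m.+1 then (evens m (doubling (doubling x)) + bit x) / 2 else 0.

Lemma measurable_evens n : measurable_fun setT (evens n).
Proof.
elim: n => [|n IH]; first exact: measurable_cst.
apply: measurable_funM => //; apply: measurable_funD; last exact: measurable_bit.
apply: measurableT_comp IH _; apply: measurableT_comp; exact: measurable_doubling.
Qed.

Lemma evens_le n k x :
  evens n x <= evens (n + k) x <= evens n x + (2 ^+ n)^-1.
Proof.
elim: n x => [|n IH] x.
  rewrite add0n /= expr0 invr1 add0r.
  elim: k x => [|k IH] x /=; first by lra.
  by have := IH (doubling (doubling x)); have := bit_ge0 x; have := bit_le1 x; lra.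
rewrite addSn /= exprS invfM; have := IH (doubling (doubling x)); lra.
Qed.

(** The binary digits of even rank, and in [odd_part] those of odd rank, form
    two numbers that turn out independent and uniform: one uniform number
    carries the randomness of two, hence of countably many. *)
Definition even_part x : R := limn (fun n => evens n x).

Lemma cvg_evens x : evens n x @[n --> \oo] --> even_part x.
Proof.
apply: nondecreasing_is_cvgn.
  by move=> m n mn; have := evens_le m (n - m) x; rewrite subnKC// => /andP[].
by exists 1 => _ [n _ <-]; have := evens_le 0 n x; rewrite add0n /= expr0 invr1; lra.
Qed.

Lemma even_part_le n x :
  evens n x <= even_part x <= evens n x + (2 ^+ n)^-1.
Proof.
have c := @cvg_evens x; apply/andP; split.
- apply: (cvgr_to_ge c); exists n => // m /= nm.
  by have := evens_le n (m - n) x; rewrite subnKC// => /andP[].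
- apply: (cvgr_to_le c); exists n => // m /= nm.
  by have := evens_le n (m - n) x; rewrite subnKC// => /andP[].
Qed.

Lemma measurable_even_part : measurable_fun setT even_part.
Proof.
apply: (@measurable_fun_cvg _ _ _ _ evens) => [n|x _].
  exact: measurable_evens.
exact: cvg_evens.
Qed.

Definition odd_part x : R := even_part (doubling x).

Lemma measurable_odd_part : measurable_fun setT odd_part.
Proof.
apply: measurableT_comp measurable_even_part _; exact: measurable_doubling.
Qed.

(** The distribution function of the uniform law. *)
Definition clamp x : R := Num.max 0 (Num.min x 1).

Lemma clamp_half x : clamp x = (clamp (2 * x) + clamp (2 * x - 1)) / 2.
Proof.
by rewrite /clamp /Num.max /Num.min; repeat case: ifPn; rewrite -?leNgt; lra.
Qed.

Lemma clamp_ge0 x : 0 <= clamp x.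
Proof. by rewrite /clamp le_max lexx. Qed.

Lemma clamp_le1 x : clamp x <= 1.
Proof. by rewrite /clamp ge_max ler01 ge_min lexx orbT. Qed.

Let G n x y := unif [set z | evens n z < x /\ evens n (doubling z) < y].

Let mltset (f : R -> R) x : measurable_fun setT f -> measurable [set z | f z < x].
Proof.
move=> mf; rewrite -[X in measurable X]setTI.
by apply: (measurable_fun_ltr mf (measurable_cst x)) => //; exact: (@measurableT _ bool [set true]).
Qed.

Let G_measurable n x y :
  measurable [set z | evens n z < x /\ evens n (doubling z) < y].
Proof.
apply: measurableI; first exact: (@mltset _ x (measurable_evens n)).
apply: (@mltset (fun z => evens n (doubling z)) y).
apply: measurableT_comp (measurable_evens n) _; exact: measurable_doubling.
Qed.

(** Both leading digits are averaged out; each of the four cases scales the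
    arguments by two. *)
Let GS n x y : G n.+1 x y = (4^-1%:E *
  (G n (2 * x)%R (2 * y)%R + G n (2 * x)%R (2 * y - 1)%R +
   G n (2 * x - 1)%R (2 * y)%R + G n (2 * x - 1)%R (2 * y - 1)%R))%E.
Proof.
rewrite /G unif_half; last exact: G_measurable.
rewrite (unif_half (measurable_half 0 (G_measurable n.+1 x y))).
rewrite (unif_half (measurable_half 1 (G_measurable n.+1 x y))).
rewrite -ge0_muleDr ?adde_ge0// muleA -EFinM -addeA addeA.
have -> : (2^-1 * 2^-1 : R) = 4^-1 by lra.
have e01 (z : R) : 0 <= z < 1 -> 0 <= (z + 0) / 2 < 1 by lra.
have e11 (z : R) : 0 <= z < 1 -> 0 <= (z + 1) / 2 < 1 by lra.
rewrite !addeA; congr (_ * (_ + _ + _ + _))%E; apply: eq_unif => z z01 /=.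
- rewrite !doubling_half0 ?bit_half0 ?e01//; split=> -[]; split; lra.
- rewrite doubling_half0 ?e11// doubling_half1 ?bit_half0 ?bit_half1 ?e11//.
  by split=> -[]; split; lra.
- rewrite doubling_half1 ?e01// doubling_half0 ?bit_half0 ?bit_half1 ?e01//.
  by split=> -[]; split; lra.
- rewrite !doubling_half1 ?bit_half1 ?e11//; split=> -[]; split; lra.
Qed.

(** Truncation to [n] digits changes the numbers by at most [2 ^ -n], so the
    distribution function is squeezed between shifted products; the bounds
    obey the recursion [GS] because [clamp] does. *)
Let G_squeeze n x y :
  ((clamp (x - (2 ^+ n)^-1) * clamp (y - (2 ^+ n)^-1))%:E <= G n x y <=
   (clamp (x + (2 ^+ n)^-1) * clamp (y + (2 ^+ n)^-1))%:E)%E.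
Proof.
have fG m u v : G m u v \is a fin_num.
  by apply: fin_num_measure; exact: G_measurable.
elim: n x y => [|n IH] x y.
  rewrite expr0 invr1 /G/=; have [xy|xy] := boolP ((0 < x) && (0 < y)).
    rewrite (_ : [set _ | _] = setT) ?probability_setT; last first.
      by apply/seteqP; split => // z _ /=; apply/andP.
    move/andP : xy => [x0 y0].
    have -> : clamp (x + 1) = 1.
      by rewrite /clamp /Num.max /Num.min; repeat case: ifPn; rewrite -?leNgt; lra.
    have -> : clamp (y + 1) = 1.
      by rewrite /clamp /Num.max /Num.min; repeat case: ifPn; rewrite -?leNgt; lra.
    rewrite mulr1 lexx andbT lee_fin mulr_ile1 ?clamp_ge0 ?clamp_le1//.
  rewrite (_ : [set _ | _] = set0) ?measure0; last first.
    by rewrite -subset0 => z /= /andP; exact/negP.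
  rewrite !lee_fin (mulr_ge0 (clamp_ge0 _) (clamp_ge0 _)) andbT.
  move: xy; rewrite negb_and -!leNgt => /orP[x0|y0].
    rewrite (_ : clamp (x - 1) = 0) ?mul0r//.
    by rewrite /clamp /Num.max /Num.min; repeat case: ifPn; rewrite -?leNgt; lra.
  rewrite (_ : clamp (y - 1) = 0) ?mulr0//.
  by rewrite /clamp /Num.max /Num.min; repeat case: ifPn; rewrite -?leNgt; lra.
rewrite GS.
have := IH (2 * x) (2 * y); have := IH (2 * x) (2 * y - 1).
have := IH (2 * x - 1) (2 * y); have := IH (2 * x - 1) (2 * y - 1).
have Gr m u v : exists r, G m u v = r%:E.
  by exists (fine (G m u v)); rewrite fineK.
have [g1 ->] := Gr n (2 * x) (2 * y); have [g2 ->] := Gr n (2 * x) (2 * y - 1).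
have [g3 ->] := Gr n (2 * x - 1) (2 * y).
have [g4 ->] := Gr n (2 * x - 1) (2 * y - 1).
rewrite -!EFinD -EFinM !lee_fin.
set e := (2 ^+ n)^-1.
have e2 : (2 ^+ n.+1)^-1 = e / 2 by rewrite exprS invfM mulrC.
rewrite e2.
rewrite (clamp_half (x - _)) (clamp_half (y - _)).
rewrite (clamp_half (x + _)) (clamp_half (y + _)).
have E (z : R) : 2 * (z - e / 2) = 2 * z - e by lra.
have E' (z : R) : 2 * (z + e / 2) = 2 * z + e by lra.
have E1 (z : R) : 2 * z - 1 - e = 2 * z - e - 1 by lra.
have E1' (z : R) : 2 * z - 1 + e = 2 * z + e - 1 by lra.
rewrite !E !E' !E1 !E1'.
move=> /andP[? ?] /andP[? ?] /andP[? ?] /andP[? ?].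
by apply/andP; split; lra.
Qed.

Lemma clamp_lip x y : `|clamp x - clamp y| <= `|x - y|.
Proof.
rewrite /clamp /Num.max /Num.min; case: (lerP x y) => xy.
  by rewrite ler_norml; repeat case: ifPn; rewrite -?leNgt => *; lra.
by rewrite ler_norml; repeat case: ifPn; rewrite -?leNgt => *; lra.
Qed.

Lemma cvg_clamp (u : R^nat) x : u @ \oo --> x -> clamp (u n) @[n --> \oo] --> clamp x.
Proof.
move=> /cvgrPdist_le ux; apply/cvgrPdist_le => e /ux; apply: filterS => n.
exact/le_trans/clamp_lip.
Qed.

Let cvg_pow : (2 ^+ n)^-1 @[n --> \oo] --> (0 : R).
Proof.
rewrite (_ : (fun n => _) = (fun n => (2^-1) ^+ n)); last first.
  by apply/funext => n; rewrite exprVn.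
by apply: cvg_expr; rewrite ger0_norm ?invr_lt1 ?unitfE//; lra.
Qed.

Let mset (f : R -> R) (g : R -> R) x y : measurable_fun setT f ->
  measurable_fun setT g -> measurable [set z | f z < x /\ g z < y].
Proof. by move=> mf mg; apply: measurableI; exact: mltset. Qed.

(** The truncated parts have a nearly product distribution function by
    [G_squeeze], and [clamp] is continuous. *)
Lemma unif_parts x y :
  unif [set z | even_part z < x /\ odd_part z < y] = (clamp x * clamp y)%:E.
Proof.
have mE := @mset _ _ x y measurable_even_part measurable_odd_part.
rewrite -[LHS]fineK ?fin_num_measure//; congr EFin.
set l := fine _; apply/le_anti/andP; split.
  have c : clamp (x + (2 ^+ n)^-1) * clamp (y + (2 ^+ n)^-1) @[n --> \oo] -->
      clamp x * clamp y.
    apply: cvgM; apply: cvg_clamp; rewrite -[X in _ --> X]addr0;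
      by apply: cvgD => //; exact: cvg_cst.
  apply: (cvgr_to_ge c); apply: nearW => n.
  rewrite -lee_fin fineK ?fin_num_measure//.
  have /andP[_] := G_squeeze n x y; apply: le_trans; apply: le_measure.
  - by rewrite inE.
  - by rewrite inE; exact: G_measurable.
  move=> z /= [h1 h2]; split.
    by have := even_part_le n z; lra.
  by have := even_part_le n (doubling z); rewrite /odd_part in h2; lra.
have c : clamp (x - (2 ^+ n)^-1 - (2 ^+ n)^-1) * clamp (y - (2 ^+ n)^-1 - (2 ^+ n)^-1) @[n --> \oo] -->
    clamp x * clamp y.
  apply: cvgM; apply: cvg_clamp; rewrite -[X in _ --> X]subr0 -[X in _ --> X]subr0;
    by apply: cvgB => //; apply: cvgB => //; exact: cvg_cst.
apply: (cvgr_to_le c); apply: nearW => n.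
rewrite -lee_fin fineK ?fin_num_measure//.
have /andP[+ _] := G_squeeze n (x - (2 ^+ n)^-1) (y - (2 ^+ n)^-1).
move=> /le_trans; apply; apply: le_measure.
- by rewrite inE; exact: G_measurable.
- by rewrite inE.
move=> z /= [h1 h2]; split.
  by have := even_part_le n z; lra.
by have := even_part_le n (doubling z); rewrite /odd_part; lra.
Qed.

End digits.

Section image_measure.
Context {R : realType} {d1 d2 : measure_display}
  {T1 : measurableType d1} {T2 : measurableType d2}.

Definition image_measure (mu : {measure set T1 -> \bar R}) (f : T1 -> T2)
    (mf : measurable_fun setT f) : {measure set T2 -> \bar R}.
Proof.
unshelve refine (HB.pack_for (measure T2 R) (pushforward mu f)
  (Measure.on (pushforward mu f))).
exact: mf.
Defined.

Lemma image_measureE mu f mf A :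
  @image_measure mu f mf A = mu (f @^-1` A).
Proof. by []. Qed.

Lemma ge0_integral_image mu f (mf : measurable_fun setT f) (g : T2 -> \bar R) :
  measurable_fun setT g -> (forall x, 0 <= g x)%E ->
  (\int[image_measure mu mf]_x g x = \int[mu]_x g (f x))%E.
Proof. by move=> mg g0; rewrite ge0_integral_pushforward. Qed.

End image_measure.

Section uniform_product.
Context {R : realType}.
Local Notation U := (@unif R).
Local Notation alpha := (@even_part R).
Local Notation beta := (@odd_part R).

Lemma finite_measure_unique_rays (m1 m2 : {measure set R -> \bar R}) :
  (forall x : R, m1 `]-oo, x[%classic = m2 `]-oo, x[%classic) ->
  (forall x : R, m1 `]-oo, x[%classic < +oo)%E ->
  forall A, measurable A -> m1 A = m2 A.
Proof.
move=> m12 m1oo A mA.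
apply: (@measure_unique _ _ _ (@RGenInftyO.G R)
   (fun k : nat => `]-oo, (k%:R : R)[%classic)) => //.
- exact: RGenInftyO.measurableE.
- move=> _ _ [x ->] [y ->]; exists (Num.min x y).
  by apply/seteqP; split => z /=; rewrite !in_itv/= lt_min => /andP.
- by move=> k; exists k%:R.
- apply/seteqP; split => // x _; exists (Num.truncn x).+1 => //=.
  by rewrite in_itv/= truncnS_gt.
- by move=> _ [x ->].
Qed.

Let ray (x : R) : measurable [set z : R | z < x].
Proof.
rewrite (_ : [set z | _] = `]-oo, x[%classic); first exact: measurable_itv.
by apply/seteqP; split => z /=; rewrite in_itv.
Qed.

Let measA (A : set R) : measurable A -> measurable (alpha @^-1` A).
Proof.
by move=> mA; rewrite -[X in measurable X]setTI; exact: measurable_even_part.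
Qed.

Let measB (A : set R) : measurable A -> measurable (beta @^-1` A).
Proof.
by move=> mA; rewrite -[X in measurable X]setTI; exact: measurable_odd_part.
Qed.

Lemma unif_ray (x : R) : U `]-oo, x[%classic = (clamp x)%:E.
Proof.
rewrite /unif; case: (leP x 0) => x0.
  rewrite (_ : _ `&` _ = set0); last first.
    by rewrite -subset0 => z [] /=; rewrite !in_itv/=; lra.
  by rewrite measure0 /clamp min_l ?max_l//; lra.
case: (leP x 1) => x1.
  rewrite (_ : _ `&` _ = `[0, x[%classic); last first.
    apply/seteqP; split => z /=; rewrite !in_itv/=; first by case => ? ?; lra.
    by move=> ?; split; lra.
  rewrite lebesgue_measure_itv/= lte_fin x0 -EFinB subr0 /clamp min_l ?max_r//.
  exact: ltW.
rewrite (_ : _ `&` _ = `[0, 1[%classic); last first.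
  apply/seteqP; split => z /=; rewrite !in_itv/=; first by case => ? ?; lra.
  by move=> ?; split; lra.
rewrite lebesgue_measure_itv/= lte_fin ltr01 -EFinB subr0 /clamp min_r ?max_r//.
exact: ltW.
Qed.

(** Distribution functions determine finite measures, in one coordinate at a
    time. *)
Lemma unif_rect (A B : set R) : measurable A -> measurable B ->
  U (alpha @^-1` A `&` beta @^-1` B) = (U A * U B)%E.
Proof.
have fU (D : set R) : measurable D -> U D = (fine (U D))%:E.
  by move=> mD; rewrite fineK// fin_num_measure.
have half x B' : measurable B' ->
    U (alpha @^-1` `]-oo, x[%classic `&` beta @^-1` B') = ((clamp x)%:E * U B')%E.
  move=> mB'.
  have mx : measurable (alpha @^-1` `]-oo, x[%classic).
    by apply: measA; exact: measurable_itv.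
  pose m1 := image_measure (mrestr U mx) (@measurable_odd_part R).
  pose m2 := mscale (NngNum (clamp_ge0 x)) U.
  have -> : U (alpha @^-1` `]-oo, x[%classic `&` beta @^-1` B') = m1 B'.
    by rewrite /m1 image_measureE /mrestr setIC.
  have -> : ((clamp x)%:E * U B')%E = m2 B' by [].
  apply: finite_measure_unique_rays => // y.
    have -> : m1 `]-oo, y[%classic =
      U (beta @^-1` `]-oo, y[%classic `&` alpha @^-1` `]-oo, x[%classic) by [].
    transitivity ((clamp x)%:E * U `]-oo, y[%classic)%E; last by [].
    rewrite setIC unif_ray -EFinM -unif_parts.
    by congr U; apply/seteqP; split => z /=; rewrite !in_itv.
  apply: (@le_lt_trans _ _ (U setT)); last by rewrite probability_setT ltry.
  rewrite /m1 image_measureE /mrestr; apply: le_measure; rewrite ?inE//.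
  by apply: measurableI => //; exact: measB.
move=> mA mB.
have mB1 : measurable (beta @^-1` B) by exact: measB.
pose m1 := image_measure (mrestr U mB1) (@measurable_even_part R).
have k0 : 0 <= fine (U B) by exact/fine_ge0/measure_ge0.
pose m2 := mscale (NngNum k0) U.
have -> : U (alpha @^-1` A `&` beta @^-1` B) = m1 A by [].
have -> : (U A * U B)%E = m2 A by rewrite /m2 /mscale/= -fU// muleC.
apply: finite_measure_unique_rays => // y.
  change (U (alpha @^-1` `]-oo, y[%classic `&` beta @^-1` B) =
    ((fine (U B))%:E * U `]-oo, y[%classic)%E).
  by rewrite half// -fU// unif_ray muleC.
apply: (@le_lt_trans _ _ (U setT)); last by rewrite probability_setT ltry.
rewrite /m1 image_measureE /mrestr; apply: le_measure; rewrite ?inE//.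
by apply: measurableI => //; exact: measA.
Qed.

Let measurable_parts : measurable_fun setT (fun w => (alpha w, beta w)).
Proof.
apply/measurable_fun_pairP; split.
  exact: measurable_even_part.
exact: measurable_odd_part.
Qed.

(** Transfer of the integral to the product measure and Tonelli's theorem. *)
Lemma integral_parts (f g : R -> \bar R) :
  measurable_fun setT f -> measurable_fun setT g ->
  (forall x, 0 <= f x)%E -> (forall x, 0 <= g x)%E ->
  (\int[U]_w (f (alpha w) * g (beta w)) = (\int[U]_x f x) * \int[U]_x g x)%E.
Proof.
move=> mf mg f0 g0.
have mh : measurable_fun setT (fun z : R * R => f z.1 * g z.2)%E.
  apply: emeasurable_funM.
    exact: (measurableT_comp mf measurable_fst).
  exact: (measurableT_comp mg measurable_snd).
have h0 (z : R * R) : (0 <= f z.1 * g z.2)%E by exact: mule_ge0.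
transitivity (\int[U \x U]_z (f z.1 * g z.2))%E.
  rewrite -(ge0_integral_image U measurable_parts mh h0).
  apply: eq_measure_integral => D mD _.
  apply/esym/product_measure_unique => // A B mA mB.
  by rewrite -unif_rect.
rewrite fubini_tonelli1//=.
transitivity (\int[U]_x (f x * \int[U]_y g y))%E.
  by apply: eq_integral => x _; rewrite /fubini_F/= ge0_integralZl.
rewrite ge0_integralZr// integral_ge0//.
Qed.

Lemma measurable_iter_odd_part n : measurable_fun setT (iter n beta).
Proof.
elim: n => [|n IH]; first exact: measurable_id.
exact: (measurableT_comp (@measurable_odd_part R) IH).
Qed.

(** The numbers [even_part (iter i odd_part w)] are independent and uniform. *)
Lemma integral_prod_parts n (Psi : nat -> R -> \bar R) :
  (forall i, measurable_fun setT (Psi i)) -> (forall i x, 0 <= Psi i x)%E ->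
  (\int[U]_w (\prod_(i < n) Psi i (alpha (iter i beta w))) =
   \prod_(i < n) \int[U]_x Psi i x)%E.
Proof.
elim: n Psi => [|n IH] Psi mP P0.
  under eq_integral do rewrite big_ord0.
  by rewrite big_ord0 integral_cst// mul1e; exact: probability_setT.
under eq_integral do rewrite big_ord_recl.
rewrite big_ord_recl -(IH (fun i => Psi i.+1))//.
rewrite -integral_parts//.
- apply: eq_integral => w _; congr (_ * _)%E.
  by apply: eq_bigr => i _; rewrite /= -iterSr.
- have mprod k : measurable_fun setT (fun w => \prod_(i < k) Psi i.+1 (alpha (iter i beta w)))%E.
    elim: k => [|k IHk].
      by under eq_fun do rewrite big_ord0; exact: measurable_cst.
    under eq_fun do rewrite big_ord_recr/=.
    apply: emeasurable_funM => //.
    apply: measurableT_comp => //.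
    exact: measurableT_comp (@measurable_even_part R) (measurable_iter_odd_part _).
  exact: mprod.
- by move=> x; apply: prode_ge0.
Qed.

End uniform_product.

(** * Poisson counts *)

Section restricted_measures.
Context {R : realType} {d : measure_display} {T : measurableType d}.

Lemma ge0_integral_mrestr (mu : {measure set T -> \bar R}) (D : set T)
    (mD : measurable D) (f : T -> \bar R) :
  measurable_fun setT f -> (forall x, 0 <= f x)%E ->
  (\int[mrestr mu mD]_x f x = \int[mu]_(x in D) f x)%E.
Proof.
move=> mf f0; have mDc := measurableC mD.
pose m1 : {measure set T -> \bar R} := mrestr mu mD.
pose m2 : {measure set T -> \bar R} := mrestr mu mDc.
have m1Dc : m1 (~` D) = 0%E by rewrite /m1/= /mrestr setICl measure0.
have m2D : m2 D = 0%E by rewrite /m2/= /mrestr setICr measure0.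
have mfD : measurable_fun setT (f \_ D).
  by apply/(measurable_restrictT _ _).1 => //; exact: measurable_funTS.
have fD0 x : (0 <= (f \_ D) x)%E by rewrite patchE; case: ifP.
rewrite (integral_mkcond D).
transitivity (\int[measure_add m1 m2]_x (f \_ D) x)%E; last first.
  apply: eq_measure_integral => A mA _.
  have E : (m1 A + m2 A = mu A)%E.
    rewrite /m1 /m2/= /mrestr -measureU//.
    - by rewrite -setIUr setUv setIT.
    - exact: measurableI.
    - exact: measurableI.
    - by rewrite setIACA setICr setI0.
  by rewrite -E -measure_addE.
rewrite ge0_integral_measure_add// -!integral_mkcond.
rewrite [X in (_ + X)%E](ge0_negligible_integral mD mD _ _ m2D)//; last first.
  exact: measurable_funTS.
rewrite setDv integral_set0 adde0.
by rewrite (ge0_negligible_integral mDc measurableT mf _ m1Dc)// setTD setCK.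
Qed.

End restricted_measures.

Section unif_shift.
Context {R : realType}.

(** The image of the uniform law under a translation is Lebesgue measure on a
    unit interval. *)
Lemma integral_unif_shift (z : R) (f : R -> \bar R) : measurable_fun setT f ->
  (forall x, 0 <= f x)%E ->
  (\int[@unif R]_v f (z + v)%R =
   \int[lebesgue_measure]_(x in `[z, (z + 1)%R[) f x)%E.
Proof.
move=> mf f0.
have mz : measurable_fun setT (fun v : R => z + v) by exact: measurable_funD.
have mI : measurable (`[z, z + 1[%classic : set R) by exact: measurable_itv.
rewrite -(ge0_integral_image (@unif R) mz mf f0).
rewrite -(ge0_integral_mrestr (@lebesgue_measure R) mI mf f0).
have mid : measurable_fun [set: measurableTypeR R]
    (fun x : measurableTypeR R => x : R) by exact: measurable_id.
rewrite -[RHS](ge0_integral_image _ mid mf f0).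
apply: eq_measure_integral => A mA _.
change (unif ((fun v : R => z + v) @^-1` A) =
  lebesgue_measure (A `&` `[z, z + 1[%classic)).
have mAI : measurable (A `&` `[z, z + 1[%classic) by exact: measurableI.
have := lebesgue_measure_affine z ltr01 mAI.
rewrite invr1 mul1e => <-; rewrite unifE; congr lebesgue_measure.
apply/seteqP; split => x; rewrite /preimage/= !in_itv/= mul1r (addrC x z).
  by move=> [? ?]; split => //; lra.
by move=> [? ?]; split => //; lra.
Qed.

End unif_shift.

Section poisson_count.
Context {R : realType}.
Local Notation U := (@unif R).
Local Notation alpha := (@even_part R).
Local Notation beta := (@odd_part R).

Let cdf (k : nat) : R := \sum_(j < k) (expR (- 1) / j`!%:R).

Let pmf_ge0 j : 0 <= expR (- 1) / j`!%:R :> R.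
Proof. by rewrite divr_ge0 ?expR_ge0. Qed.

Let cdf_le k l : (k <= l)%N -> cdf k <= cdf l.
Proof.
move=> /subnKC <-; elim: (l - k)%N => [|n IH]; first by rewrite addn0.
by rewrite addnS (le_trans IH)// /cdf big_ord_recr/= lerDl.
Qed.

Let cdf_cvg : cdf @ \oo --> (1 : R).
Proof.
have -> : cdf = fun n => expR (- 1) * series (exp_coeff (1 : R)) n.
  apply/funext => n; rewrite /cdf /series/= big_mkord mulr_sumr.
  by apply: eq_bigr => j _; rewrite /exp_coeff/= expr1n mul1r.
rewrite [X in _ --> X](_ : 1 = expR (- 1) * expR 1); last first.
  by rewrite -expRD addNr expR0.
apply: cvgM; first exact: cvg_cst.
exact: is_cvg_series_exp_coeff.
Qed.

Let cdf_le1 k : cdf k <= 1.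
Proof.
apply: (cvgr_to_ge cdf_cvg); exists k => // n /= kn; exact: cdf_le.
Qed.

Let step k : set R := [set v | cdf k <= v < cdf k.+1].

Let step_uniq k l v : step k v -> step l v -> k = l.
Proof.
wlog kl : k l / (k <= l)%N.
  by move=> H h1 h2; case: (leqP k l) => [|/ltnW] ?; [|symmetry]; exact: H.
move=> /andP[_ h1] /andP[h2 _]; apply/eqP; rewrite eqn_leq kl/= leqNgt.
by apply/negP => /cdf_le h; move: (lt_le_trans h1 h); rewrite ltNge h2.
Qed.

Let step_ex v : 0 <= v < 1 -> exists k, step k v.
Proof.
move=> /andP[v0 v1]; have ex : exists k, v < cdf k.
  have /cvgrPdist_lt/(_ (1 - v))[|n _ /(_ n (leqnn n))] := cdf_cvg; first lra.
  rewrite /= ltr_norml => /andP[_ h]; exists n; lra.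
case: (ex_minnP ex) => -[|k] vk kmin.
  by move: vk; rewrite /cdf big_ord0 ltNge v0.
exists k; rewrite /step/= vk andbT leNgt; apply/negP => /kmin.
by rewrite ltnn.
Qed.

(** The quantile function of the Poisson distribution with mean one. *)
Definition poisson_count (v : R) : nat := xget 0%N [set k | step k v].

Let count_step k v : step k v -> poisson_count v = k.
Proof.
move=> kv; apply: (@step_uniq _ _ v) => //.
exact: (@xgetI _ 0%N [set k | step k v] k).
Qed.

Lemma measurable_poisson_count k : measurable [set v | poisson_count v = k].
Proof.
have mstep l : measurable (step l).
  rewrite (_ : step l = `[cdf l, cdf l.+1[%classic); first exact: measurable_itv.
  by apply/seteqP; split => x /=; rewrite in_itv.
rewrite (_ : [set v | _] = step k `|`
    (if k == 0%N then ~` \bigcup_l step l else set0)).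
  apply: measurableU => //; case: ifP => // _.
  by apply: measurableC; exact: bigcup_measurable.
apply/seteqP; split => [v /= vk|v [/count_step//|]].
  have [[l lv]|nex] := pselect (exists l, step l v).
    by left; rewrite -vk (count_step lv).
  right; have : poisson_count v = 0%N by apply: xgetPN => l lv; apply: nex; exists l.
  by rewrite vk => ->; rewrite eqxx => -[l _ lv]; apply: nex; exists l.
case: ifP => // /eqP -> h; apply: xgetPN => l lv; apply: h; exists l => //.
Qed.

Lemma unif_poisson_count k :
  U [set v | poisson_count v = k] = (expR (- 1) / k`!%:R)%:E.
Proof.
rewrite (@eq_unif _ _ (step k)); last first.
  move=> v v01; split => [/= vk|/count_step//].
  have [l lv] := step_ex v01.
  by rewrite -vk (count_step lv).
rewrite unifE (_ : _ `&` _ = `[cdf k, cdf k.+1[%classic); last first.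
  apply/seteqP; split => v; rewrite /step/= !in_itv/=; first by case.
  move=> /andP[h1 h2]; split; first by rewrite h1.
  have := cdf_le1 k.+1; have : 0 <= cdf k by apply: sumr_ge0.
  lra.
rewrite lebesgue_measure_itv/= lte_fin.
have E : cdf k.+1 = cdf k + expR (- 1) / k`!%:R by rewrite /cdf big_ord_recr.
have p0 : 0 < expR (- 1) / k`!%:R :> R.
  by rewrite divr_gt0 ?expR_gt0// ltr0n fact_gt0.
by rewrite E ltrDl p0 -EFinB addrAC subrr add0r.
Qed.

(** The product of [u] over a Poisson number of independent uniform points. *)
Definition window (u : R -> R) (w : R) : R :=
  \prod_(j < poisson_count (alpha w)) u (alpha (iter j beta (beta w))).

Let fixed (u : R -> R) k (w : R) : R := \prod_(j < k) u (alpha (iter j beta w)).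

Let m_iter n : measurable_fun setT (fun w => alpha (iter n beta w)).
Proof.
exact: measurableT_comp (@measurable_even_part R) (measurable_iter_odd_part n).
Qed.

Let m_fixed (u : R -> R) k : measurable_fun setT u -> measurable_fun setT (fixed u k).
Proof.
move=> mu; rewrite /fixed; apply: measurable_prod => i _.
exact: measurableT_comp mu (m_iter _).
Qed.

Let event k := [set w | poisson_count (alpha w) = k].

Let mevent k : measurable (event k).
Proof.
rewrite (_ : event k = alpha @^-1` [set v | poisson_count v = k])//.
rewrite -[X in measurable X]setTI; apply: measurable_even_part => //.
exact: measurable_poisson_count.
Qed.

Let event_cover : \bigcup_k event k = setT.
Proof. by apply/seteqP; split => // w _; exists (poisson_count (alpha w)). Qed.

(** The events on which the count is constant form a countable measurable
    partition. *)
Lemma measurable_by_count d' (T : measurableType d') (F : nat -> R -> T) :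
  (forall k, measurable_fun setT (F k)) ->
  measurable_fun setT (fun w => F (poisson_count (alpha w)) w).
Proof.
move=> mF; rewrite -event_cover; apply/measurable_fun_bigcup => // k.
apply: (@eq_measurable_fun _ _ _ _ _ (F k)) => [w /set_mem <-//|].
exact: measurable_funTS.
Qed.

Lemma measurable_window (u : R -> R) : measurable_fun setT u -> measurable_fun setT (window u).
Proof.
move=> mu; apply: (@measurable_by_count _ _ (fun k w => fixed u k (beta w))) => k.
exact: measurableT_comp (m_fixed k mu) (@measurable_odd_part R).
Qed.

Lemma window_ge0 (u : R -> R) w : (forall x, 0 <= u x) -> 0 <= window u w.
Proof. by move=> u0; apply: prodr_ge0. Qed.

Let int_fixed (u : R -> R) k (a : R) : measurable_fun setT u -> (forall x, 0 <= u x) ->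
  (\int[U]_v (u v)%:E = a%:E)%E -> (\int[U]_w (fixed u k w)%:E = (a ^+ k)%:E)%E.
Proof.
move=> mu u0 ua.
under eq_integral do rewrite /fixed -prodEFin.
rewrite (@integral_prod_parts R k (fun _ v => (u v)%:E)).
- under eq_bigr do rewrite ua.
  by rewrite prodEFin prodr_const card_ord.
- by move=> i; exact/measurable_EFinP.
- by move=> i x; rewrite lee_fin.
Qed.

(** Given the number [k] of points the product integrates to [a ^ k], and the
    Poisson weights sum these powers to an exponential. *)
Lemma integral_window (u : R -> R) (a : R) : measurable_fun setT u -> (forall x, 0 <= u x) ->
  (\int[U]_v (u v)%:E = a%:E)%E ->
  (\int[U]_w (window u w)%:E = (expR (a - 1))%:E)%E.
Proof.
move=> mu u0 ua.
have a0 : 0 <= a.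
  by rewrite -lee_fin -ua; apply: integral_ge0 => v _; rewrite lee_fin.
have tF : trivIset setT event.
  apply/trivIsetP => i j _ _ ij; rewrite -subset0 => w [/= h1 h2].
  by move/eqP : ij; apply; exact: (etrans (esym h1) h2).
have mW : measurable_fun setT (fun w => (window u w)%:E).
  by apply/measurable_EFinP; exact: measurable_window.
rewrite -[in LHS]event_cover ge0_integral_bigcup//; first last.
- by move=> w _; rewrite lee_fin window_ge0.
- by rewrite event_cover.
have E k : (\int[U]_(w in event k) (window u w)%:E =
    (expR (- 1) * exp_coeff a k)%:E)%E.
  rewrite integral_mkcond.
  pose f v : \bar R := (\1_[set v | poisson_count v = k] v)%:E.
  transitivity (\int[U]_w (f (alpha w) * (fixed u k (beta w))%:E))%E.
    apply: eq_integral => w _; rewrite patchE /f indicE.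
    have [h|h] := pselect (event k w).
      rewrite (mem_set h) mem_set// mul1e /window.
      by move: h; rewrite /event/= => ->.
    by rewrite (memNset h) memNset// mul0e.
  rewrite (@integral_parts _ f (fun w => (fixed u k w)%:E)).
  - rewrite (int_fixed k mu u0 ua) /f integral_indic//; last exact: measurable_poisson_count.
    rewrite setIT [X in (X * _)%E]unif_poisson_count -EFinM; congr EFin.
    by rewrite /exp_coeff/= mulrAC mulrA.
  - apply/measurable_EFinP; apply: measurable_indic; exact: measurable_poisson_count.
  - by apply/measurable_EFinP; exact: m_fixed.
  - by move=> v; rewrite /f lee_fin indicE.
  - by move=> v; rewrite lee_fin prodr_ge0.
under eq_eseriesr do rewrite E.
apply/cvg_lim => //.
have -> : (fun n => \sum_(0 <= k < n) (expR (- 1) * exp_coeff a k)%:E)%E =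
    (fun n => (expR (- 1) * series (exp_coeff a) n)%:E).
  by apply/funext => n; rewrite sumEFin -mulr_sumr.
apply/fine_cvgP; split; first exact: nearW.
rewrite addrC expRD; apply: cvgM; first exact: cvg_cst.
exact: is_cvg_series_exp_coeff.
Qed.

End poisson_count.

(** * The Poisson process on the line *)

Section lebesgue_bounded.
Context {R : realType}.

Lemma bounded_borel_integrable (B : set R) (g : R -> R) (M : R) :
  bounded_borel B -> measurable_fun B g -> (forall x, B x -> `|g x| <= M) ->
  lebesgue_measure.-integrable B (EFin \o g).
Proof.
move=> bB mg gM; apply: measurable_bounded_integrable => //.
- by case: bB.
- exact: lebesgue_bounded_borel_lty.
exists M; split; [exact: num_real|move=> N MN x Bx /=].
by rewrite (le_trans (gM x Bx))// ltW.
Qed.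

Lemma Rintegral_indic (A B : set R) : measurable A -> measurable B ->
  \int[lebesgue_measure]_(x in B) \1_A x = fine (lebesgue_measure (A `&` B)).
Proof. by move=> mA mB; rewrite /Rintegral integral_indic. Qed.

End lebesgue_bounded.

Section poisson_process.
Context {R : realType}.
Local Notation U := (@unif R).
Local Notation alpha := (@even_part R).
Local Notation beta := (@odd_part R).
Local Notation leb := (@lebesgue_measure R).

(** The left endpoints of the unit windows: an enumeration of the integers in
    which the first [2 L] windows fill the interval from [- L] to [L]. *)
Definition site (m : nat) : R :=
  if odd m then - (m./2.+1)%:R else (m./2)%:R.

Definition npoints (m : nat) (w : R) : nat :=
  poisson_count (alpha (alpha (iter m beta w))).

(** The points of window [m]: the uniform number [even_part (iter m odd_part
    w)] is split into one part for the count and one for the positions. *)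
Definition arrival (m j : nat) (w : R) : R :=
  site m + alpha (iter j beta (beta (alpha (iter m beta w)))).

(** The sum of [h] over the points of the first [M] windows. For [h] of
    bounded support it does not depend on large [M], by [point_sum_stable]. *)
Definition point_sum (h : R -> R) (M : nat) (w : R) : R :=
  \sum_(m < M) \sum_(j < npoints m w) h (arrival m j w).

Lemma even_part01 (w : R) : 0 <= alpha w <= 1.
Proof. by have := even_part_le 0 w; rewrite /= expr0 invr1 add0r. Qed.

Lemma site_even L : site L.*2 = L%:R.
Proof. by rewrite /site odd_double doubleK. Qed.

Lemma site_odd L : site L.*2.+1 = - (L.+1)%:R.
Proof. by rewrite /site /= odd_double/= uphalf_double. Qed.

Lemma arrival_itv m j w : site m <= arrival m j w <= site m + 1.
Proof.
by rewrite /arrival; have := even_part01 (iter j beta (beta (alpha (iter m beta w)))); lra.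
Qed.

Lemma arrival_outside L m j w : (L.*2 <= m)%N -> L%:R <= `|arrival m j w|.
Proof.
move=> Lm; have := arrival_itv m j w; rewrite -(odd_double_half m).
have Lh : (L <= m./2)%N by rewrite -(doubleK L); exact: half_leq.
have : (L%:R : R) <= (m./2)%:R by rewrite ler_nat.
have Lh0 : (0 : R) <= (m./2)%:R by [].
case: (odd m); rewrite ?add1n ?add0n ?site_odd ?site_even -?natr1 => h1 h2.
  by rewrite ler0_norm; lra.
by rewrite ger0_norm; lra.
Qed.

Lemma point_sum_stable (h : R -> R) L M w :
  (forall x, L%:R <= `|x| -> h x = 0) -> (L.*2 <= M)%N ->
  point_sum h M w = point_sum h L.*2 w.
Proof.
move=> h0 /subnKC <-; rewrite /point_sum big_split_ord/=.
rewrite [X in _ + X]big1 ?addr0// => m _; apply: big1 => j _.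
by rewrite h0// arrival_outside// leq_addr.
Qed.

Lemma point_sumD (h h' : R -> R) M w :
  point_sum (fun x => h x + h' x) M w = point_sum h M w + point_sum h' M w.
Proof.
rewrite /point_sum -big_split/=; apply: eq_bigr => m _.
by rewrite -big_split.
Qed.

Lemma point_sumZ (c : R) (h : R -> R) M w :
  point_sum (fun x => c * h x) M w = c * point_sum h M w.
Proof.
rewrite /point_sum mulr_sumr; apply: eq_bigr => m _.
by rewrite mulr_sumr.
Qed.

Lemma point_sum_sum (I : Type) (s : seq I) (h : I -> R -> R) M w :
  point_sum (fun x => \sum_(i <- s) h i x) M w = \sum_(i <- s) point_sum (h i) M w.
Proof.
elim: s => [|i s IH].
  rewrite big_nil /point_sum big1// => m _; rewrite big1// => j _.
  by rewrite big_nil.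
rewrite big_cons -IH -point_sumD; congr (point_sum _ M w).
by apply/funext => x; rewrite big_cons.
Qed.

Lemma point_sum_cvg (h_ : nat -> R -> R) (h : R -> R) M w :
  (forall x, h_ n x @[n --> \oo] --> h x) ->
  point_sum (h_ n) M w @[n --> \oo] --> point_sum h M w.
Proof.
have cvg_sum k (f_ : nat -> 'I_k -> R) (f : 'I_k -> R) :
    (forall i, f_ n i @[n --> \oo] --> f i) ->
    \sum_(i < k) f_ n i @[n --> \oo] --> \sum_(i < k) f i.
  elim: k f_ f => [|k IH] f_ f ff.
    by under eq_fun do rewrite big_ord0; rewrite big_ord0; exact: cvg_cst.
  under eq_fun do rewrite big_ord_recr/=; rewrite big_ord_recr/=.
  by apply: cvgD; [apply: IH => i; exact: ff|exact: ff].
move=> hh; rewrite /point_sum; apply: (cvg_sum _) => m.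
by apply: (cvg_sum _) => j; exact: hh.
Qed.

Lemma measurable_point_sum (h : R -> R) M : measurable_fun setT h ->
  measurable_fun setT (point_sum h M).
Proof.
move=> mh; apply: measurable_sum => m.
have m_iter n : measurable_fun setT (fun w => alpha (iter n beta w)).
  exact: measurableT_comp (@measurable_even_part R) (measurable_iter_odd_part n).
pose F k (x : R) := \sum_(j < k) h (site m + alpha (iter j beta (beta x))).
apply: (measurableT_comp (f := fun x => F (poisson_count (alpha x)) x) _ (m_iter m)).
apply: measurable_by_count => k; apply: measurable_sum => j.
apply: (measurableT_comp mh); apply: measurable_funD => //.
exact: measurableT_comp (m_iter j) (@measurable_odd_part R).
Qed.

(** The windows use independent uniform numbers, so the exponential of the sum
    integrates to the product of the integrals over the windows. *)
Lemma integral_expR_point_sum (h : R -> R) (a : nat -> R) M :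
  measurable_fun setT h ->
  (forall m, \int[leb]_(x in `[site m, (site m + 1)%R[) (expR (h x))%:E =
    (a m)%:E)%E ->
  (\int[U]_w (expR (point_sum h M w))%:E =
    (expR (\sum_(m < M) (a m - 1)))%:E)%E.
Proof.
move=> mh ha.
pose u m v := expR (h (site m + v)).
have mu m : measurable_fun setT (u m).
  apply: (measurableT_comp (f := expR)); first exact: measurable_expR.
  apply: (measurableT_comp mh).
  exact: measurable_funD.
have u0 m v : 0 <= u m v by exact: expR_ge0.
have ua m : (\int[U]_v (u m v)%:E = (a m)%:E)%E.
  rewrite -ha -(@integral_unif_shift R (site m) (fun x => (expR (h x))%:E))//.
  by apply/measurable_EFinP; apply: (measurableT_comp (f := expR)); first exact: measurable_expR.
transitivity (\int[U]_w (\prod_(m < M) (window (u m) (alpha (iter m beta w)))%:E))%E.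
  apply: eq_integral => w _; rewrite prodEFin; congr EFin.
  rewrite /point_sum expR_sum; apply: eq_bigr => m _.
  by rewrite expR_sum.
rewrite (@integral_prod_parts R M (fun m x => (window (u m) x)%:E)).
- under eq_bigr do rewrite (integral_window (mu _) (u0 _) (ua _)).
  by rewrite prodEFin -expR_sum.
- by move=> m; apply/measurable_EFinP; exact: measurable_window.
- by move=> m x; rewrite lee_fin window_ge0.
Qed.

Lemma Rintegral_windows (g : R -> R) (M : R) L : measurable_fun setT g ->
  (forall x, `|g x| <= M) ->
  \sum_(m < L.*2) \int[leb]_(x in `[site m, site m + 1[) g x =
  \int[leb]_(x in `[- L%:R, L%:R[) g x.
Proof.
move=> mg gM.
have int (b1 b2 : bool) (x y : R) :
    leb.-integrable [set` Interval (BSide b1 x) (BSide b2 y)] (EFin \o g).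
  apply: (@bounded_borel_integrable _ _ _ M) => //; first exact: bounded_borel_itv.
  exact: measurable_funTS.
have mi (b1 b2 : bool) (x y : R) :
    measurable ([set` Interval (BSide b1 x) (BSide b2 y)] : set R).
  exact: measurable_itv.
elim: L => [|L IH].
  by rewrite big_ord0 oppr0 set_itvco0 Rintegral_set0.
rewrite doubleS !big_ord_recr/= IH site_even site_odd.
have L0 : (0 : R) <= L%:R by [].
have E1 : `[- L%:R, L%:R + 1[%classic =
    `[- L%:R, L%:R[%classic `|` `[L%:R, L%:R + 1[%classic :> set R.
  apply/seteqP; split => x /=; rewrite !in_itv/=.
    by move=> ?; case: (ltP x L%:R) => ?; [left|right]; lra.
  by case; lra.
have E2 : `[- L.+1%:R, L.+1%:R[%classic =
    `[- L%:R, L%:R + 1[%classic `|` `[- L.+1%:R, - L.+1%:R + 1[%classic :> set R.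
  rewrite -natr1; apply/seteqP; split => x /=; rewrite !in_itv/=.
    by move=> ?; case: (leP (- L%:R) x) => ?; [left|right]; lra.
  by case; lra.
rewrite E2 Rintegral_setU//; first last.
- rewrite -natr1; apply/disj_setPS => x []/=; rewrite !in_itv/=; lra.
- by rewrite -E2; exact: int.
congr (_ + _); rewrite E1 Rintegral_setU//; first last.
- by apply/disj_setPS => x []/=; rewrite !in_itv/=; lra.
- by rewrite -E1; exact: int.
Qed.

(** Campbell's formula: the windows contribute independent factors given by
    [integral_window], whose exponents add up to an integral over the line. *)
Lemma exponential_functional (h : R -> R) (M : R) L : measurable_fun setT h ->
  (forall x, `|h x| <= M) ->
  (\int[U]_w (expR (point_sum h L.*2 w))%:E =
   (expR (\int[leb]_(x in `[- L%:R, L%:R[) (expR (h x) - 1)))%:E)%E.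
Proof.
move=> mh hM.
have me : measurable_fun setT (fun x => expR (h x)).
  by apply: (measurableT_comp (f := expR)); first exact: measurable_expR.
have eM x : `|expR (h x)| <= expR M.
  rewrite ger0_norm ?expR_ge0// ler_expR; have := hM x; rewrite ler_norml; lra.
have int (x y : R) : leb.-integrable `[x, y[ (EFin \o (fun x => expR (h x))).
  apply: (@bounded_borel_integrable _ _ _ (expR M)) => //.
    exact: bounded_borel_itv.
  exact: measurable_funTS.
rewrite (@integral_expR_point_sum h
  (fun m => \int[leb]_(x in `[site m, site m + 1[) expR (h x)))//; last first.
  move=> m; rewrite fineK//; apply: integrable_fin_num; first exact: measurable_itv.
  exact: int.
congr (expR _)%:E; rewrite -(@Rintegral_windows _ (expR M + 1)).
- apply: eq_bigr => m _; rewrite RintegralB//.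
  + congr (_ - _); rewrite Rintegral_cst//.
    rewrite mul1r.
    have E : fine (leb (`[site m, site m + 1[%classic : set R)) = 1.
      by rewrite lebesgue_measure_itv/= lte_fin ltrDl ltr01 -EFinB/=; lra.
    exact: (esym E).
  + apply: (@bounded_borel_integrable _ _ _ 1); first exact: bounded_borel_itv.
      exact: measurable_cst.
    by move=> x _; rewrite normr1.
- exact: measurable_funB.
- move=> x; rewrite (le_trans (ler_normB _ _))// normr1 lerD2r.
  exact: eM.
Qed.

End poisson_process.

(** * Probability generating functions *)

Section power_series.
Context {R : realType}.

(** Identity theorem: at its first nonzero coefficient the series would be
    bounded away from [0] for small [s]. *)
Lemma power_series_unique (b : R^nat) (A : R) :
  (forall n, \sum_(k < n) `|b k| <= A) ->
  (forall s, 0 < s <= 1 -> \sum_(k < n) b k * s ^+ k @[n --> \oo] --> 0) ->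
  forall k, b k = 0.
Proof.
move=> bA bs k; apply: contrapT => /eqP bk0.
have ex : exists k, b k != 0 by exists k.
case: (ex_minnP ex) => m bm mmin {k bk0 ex}.
have A0 : 0 <= A by have := bA 0%N; rewrite big_ord0.
have bm0 : 0 < `|b m| by rewrite normr_gt0.
(* For this [s] the terms after the first nonzero one add up to at most half
   of it. *)
pose s := Num.min 1 (`|b m| / (2 * (A + 1))).
have s0 : 0 < s by rewrite lt_min ltr01 divr_gt0//; lra.
have s1 : s <= 1 by rewrite ge_min lexx.
have sA : s * A <= `|b m| / 2.
  have : s <= `|b m| / (2 * (A + 1)) by rewrite ge_min lexx orbT.
  rewrite ler_pdivlMr; last lra; nra.
have low n : (m < n)%N -> s ^+ m * (`|b m| / 2) <= `|\sum_(k < n) b k * s ^+ k|.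
  move=> mn; rewrite -(big_mkord xpredT (fun k => b k * s ^+ k)).
  rewrite (big_cat_nat (leq0n m) (ltnW mn))/= big_nat_cond big1 ?add0r; last first.
    move=> k /andP[/andP[_ km] _]; apply/eqP; rewrite mulf_eq0; apply/orP; left.
    by apply: contraLR km => /mmin; rewrite -leqNgt.
  rewrite big_ltn//=.
  have rest : `|\sum_(m.+1 <= k < n) b k * s ^+ k| <= s ^+ m * (s * A).
    rewrite (le_trans (ler_norm_sum _ _ _))//.
    apply: (@le_trans _ _ (\sum_(m.+1 <= k < n) `|b k| * s ^+ m.+1)).
      rewrite !big_nat; apply: ler_sum => k /andP[mk _].
      rewrite normrM ler_wpM2l// (ger0_norm (exprn_ge0 _ (ltW s0))).
      by apply: ler_wiXn2l => //; exact: ltW.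
    rewrite -mulr_suml exprSr mulrC -mulrA (ler_wpM2l (exprn_ge0 _ (ltW s0)))//.
    apply: (ler_wpM2l (ltW s0)); apply: le_trans (bA n).
    rewrite -(big_mkord xpredT (fun k => `|b k|)).
    rewrite (big_cat_nat (leq0n m.+1) mn)/= lerDr.
    by apply: sumr_ge0.
  have sm : 0 < s ^+ m by exact: exprn_gt0.
  have E : `|b m * s ^+ m| = s ^+ m * `|b m|.
    by rewrite normrM mulrC (ger0_norm (ltW sm)).
  have := ler_normB (b m * s ^+ m + \sum_(m.+1 <= k < n) b k * s ^+ k)
    (\sum_(m.+1 <= k < n) b k * s ^+ k).
  rewrite addrK E; nra.
have s01 : 0 < s <= 1 by rewrite s0.
have /cvgrPdist_lt/(_ (s ^+ m * (`|b m| / 2))) := bs s s01.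
have e0 : 0 < s ^+ m * (`|b m| / 2) by rewrite mulr_gt0 ?exprn_gt0// divr_gt0.
move=> /(_ e0)[n _ /(_ (maxn n m.+1) (leq_maxl _ _))] /=.
rewrite sub0r normrN ltNge => /negP; apply; apply: low.
exact: leq_maxr.
Qed.

End power_series.

Section generating_functions.
Context {R : realType} {d : measure_display} {T : measurableType d}
  (P : probability T R).
Implicit Types (N : T -> nat) (r : T -> R).

Let dom N := forall A : set nat, measurable (N @^-1` A).

Let m_comp N (g : nat -> R) : dom N -> measurable_fun setT (fun w => g (N w)).
Proof.
by move=> mN _ B mB; rewrite setTI; exact: (mN (g @^-1` B)).
Qed.

Let bnd r (g : T -> R) : (forall w, `|r w| <= 1) -> (forall w, `|g w| <= 1) ->
  forall w, `|r w * g w| <= 1.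
Proof. by move=> r1 g1 w; rewrite normrM mulr_ile1. Qed.

Let ind1 (A : set nat) k : `|\1_A k : R| <= 1.
Proof. by rewrite indicE; case: (_ \in _); rewrite ?normr1 ?normr0. Qed.

(** Dominated convergence for the partial sums over the values of [N]. *)
Lemma expectation_series r N (g : nat -> R) :
  measurable_fun setT r -> (forall w, `|r w| <= 1) -> dom N ->
  (forall k, `|g k| <= 1) ->
  \sum_(k < n) g k * \int[P]_w (r w * \1_[set (k : nat)] (N w)) @[n --> \oo] -->
  \int[P]_w (r w * g (N w)).
Proof.
move=> mr r1 mN g1.
have mi k : measurable_fun setT (fun w => r w * \1_[set k] (N w) : R).
  by apply: measurable_funM => //; exact: m_comp.
have int k : P.-integrable setT (EFin \o (fun w => g k * (r w * \1_[set k] (N w)))).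
  apply: (@bounded_integrable _ _ _ _ _ 1); first exact: measurable_funM.
  move=> w; rewrite normrM mulr_ile1//.
  by apply: (bnd (g := fun w => \1_[set k] (N w)) r1) => w'; exact: ind1.
pose f n w := \sum_(k < n) g k * (r w * \1_[set (k : nat)] (N w)).
have fE n w : f n w = if (N w < n)%N then r w * g (N w) else 0.
  rewrite /f; case: ifP => Nn.
    rewrite (bigD1 (Ordinal Nn))//= indicE mem_set//= mulr1 mulrC big1 ?addr0//.
    move=> i iN; rewrite indicE memNset ?mulr0// => /= h.
    by move: iN; rewrite -(inj_eq val_inj)/= h eqxx.
  rewrite big1// => i _; rewrite indicE memNset ?mulr0// => /= h.
  by move: Nn; rewrite h ltn_ord.
have -> : (fun n => \sum_(k < n) g k * \int[P]_w (r w * \1_[set (k : nat)] (N w))) =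
    (fun n => \int[P]_w f n w).
  apply/funext => n; rewrite Rintegral_sum_seq; last by move=> i; exact: int.
  apply: eq_bigr => k _; rewrite RintegralZl//.
  apply: (@bounded_integrable _ _ _ _ _ 1) => //.
  by apply: (bnd (g := fun w => \1_[set (k : nat)] (N w)) r1) => w; exact: ind1.
apply: (@bounded_Rintegral_cvg _ _ _ _ _ _ 1).
- move=> n; apply: measurable_sum => k; apply: measurable_funM => //.
- by apply: measurable_funM => //; exact: m_comp.
- move=> n w; rewrite fE; case: ifP => _; last by rewrite normr0.
  by rewrite normrM mulr_ile1.
- apply: aeW => w; apply: cvg_near_cst; exists (N w).+1 => // n /= Nn.
  by rewrite fE Nn.
Qed.

(** A law on the natural numbers is determined by its generating function on
    the unit interval; [r] and [r'] allow for signed densities. *)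
Lemma generating_unique r r' N N' :
  measurable_fun setT r -> measurable_fun setT r' ->
  (forall w, `|r w| <= 1) -> (forall w, `|r' w| <= 1) -> dom N -> dom N' ->
  (forall s, 0 < s <= 1 ->
     \int[P]_w (r w * s ^+ N w) = \int[P]_w (r' w * s ^+ N' w)) ->
  forall A : set nat,
    \int[P]_w (r w * \1_A (N w)) = \int[P]_w (r' w * \1_A (N' w)).
Proof.
move=> mr mr' r1 r1' mN mN' Hs A.
pose a (q : T -> R) (M : T -> nat) (k : nat) := \int[P]_w (q w * \1_[set k] (M w) : R).
have aA (q : T -> R) M : measurable_fun setT q -> (forall w, `|q w| <= 1) -> dom M ->
    forall n, \sum_(k < n) `|a q M k| <= 1.
  move=> mq q1 mM n.
  have mi k : measurable_fun setT (fun w => \1_[set k] (M w) : R) by exact: m_comp.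
  have inti k : P.-integrable setT (EFin \o (fun w => \1_[set k] (M w) : R)).
    by apply: (@bounded_integrable _ _ _ _ _ 1) => // w; exact: ind1.
  have intq k : P.-integrable setT (EFin \o (fun w => q w * \1_[set k] (M w) : R)).
    apply: (@bounded_integrable _ _ _ _ _ 1); first exact: measurable_funM.
    by apply: (bnd (g := fun w => \1_[set k] (M w)) q1) => w; exact: ind1.
  apply: (@le_trans _ _ (\sum_(k < n) \int[P]_w (\1_[set (k : nat)] (M w) : R))).
    apply: ler_sum => k _; rewrite (le_trans (le_normr_Rintegral _ (intq k)))//.
    apply: le_Rintegral => //; first exact: integrable_norm.
    move=> w _; have i0 : (0 : R) <= \1_[set (k : nat)] (M w) by rewrite indicE.
    by rewrite normrM (ger0_norm i0) ler_piMl.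
  rewrite -(Rintegral_sum_seq (index_enum 'I_n)); last by move=> i.
  rewrite -[X in _ <= X](Rintegral_prob_cst P); apply: le_Rintegral => //.
  - have -> : (EFin \o (fun w => \sum_(i < n) (\1_[set (i : nat)] (M w) : R))) =
      (fun w => \sum_(i <- index_enum 'I_n) (EFin \o (fun w => \1_[set (i : nat)] (M w) : R)) w)%E.
      by apply/funext => w /=; rewrite sumEFin.
    exact: integrable_sum.
  - by apply: (@bounded_integrable _ _ _ _ _ 1) => // w; rewrite normr1.
  - move=> w _; have [Mn|Mn] := ltnP (M w) n.
      rewrite (bigD1 (Ordinal Mn))//= big1 ?addr0 ?indicE ?lern1 ?leq_b1// => i iM.
      rewrite indicE memNset// => /= h.
      by move: iM; rewrite -(inj_eq val_inj)/= h eqxx.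
    rewrite big1// => i _; rewrite indicE memNset// => /= h.
    by move: Mn; rewrite h leqNgt ltn_ord.
pose b k := a r N k - a r' N' k.
have b0 : forall k, b k = 0.
  apply: (@power_series_unique _ b 2).
    move=> n; apply: (@le_trans _ _ (\sum_(k < n) (`|a r N k| + `|a r' N' k|))).
      by apply: ler_sum => k _; exact: ler_normB.
    rewrite big_split/=; have := aA _ _ mr r1 mN n.
    by have := aA _ _ mr' r1' mN' n; lra.
  move=> s s01; have g1 k : `|s ^+ k| <= 1.
    rewrite ger0_norm ?exprn_ge0//; last lra.
    by apply: exprn_ile1; lra.
  have h1 := expectation_series mr r1 mN g1.
  have h2 := expectation_series mr' r1' mN' g1.
  rewrite -Hs// in h2.
  have h3 := cvgB h1 h2; rewrite subrr in h3.
  have E n : \sum_(k < n) b k * s ^+ k =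
      \sum_(k < n) s ^+ k * a r N k - \sum_(k < n) s ^+ k * a r' N' k.
    rewrite -sumrB; apply: eq_bigr => k _.
    by rewrite [in LHS]mulrC /b mulrBr.
  by under eq_fun do rewrite E; exact: h3.
have h1 := expectation_series mr r1 mN (ind1 A).
have h2 := expectation_series mr' r1' mN' (ind1 A).
apply: cvg_uniq h1 _; rewrite (_ : (fun n => _) = (fun n =>
  \sum_(k < n) \1_A (k : nat) * \int[P]_w (r' w * \1_[set (k : nat)] (N' w)))) //.
apply/funext => n; apply: eq_bigr => k _; congr (_ * _).
by have /eqP := b0 k; rewrite /b subr_eq0 => /eqP.
Qed.

(** Natural-valued variables whose joint generating function factors are
    independent: the powers are replaced by indicators one at a time. *)
Lemma generating_independent n (N : 'I_n -> T -> nat) : (forall i, dom (N i)) ->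
  (forall s : 'I_n -> R, (forall i, 0 < s i <= 1) ->
     \int[P]_w (\prod_(i < n) s i ^+ N i w) =
     \prod_(i < n) \int[P]_w (s i ^+ N i w)) ->
  forall A : 'I_n -> set nat,
    \int[P]_w (\prod_(i < n) \1_(A i) (N i w)) =
    \prod_(i < n) \int[P]_w (\1_(A i) (N i w) : R).
Proof.
move=> mN Hs A.
pose mix (k : nat) (s : 'I_n -> R) (i : 'I_n) (l : nat) : R :=
  if (i < k)%N then \1_(A i) l else s i ^+ l.
have mix1 k s i l : (forall i, 0 < s i <= 1) -> `|mix k s i l| <= 1.
  move=> s01; rewrite /mix; case: ifP => _; first exact: ind1.
  have := s01 i => si; rewrite ger0_norm ?exprn_ge0//; last lra.
  by apply: exprn_ile1; lra.
suff H k : (k <= n)%N -> forall s : 'I_n -> R, (forall i, 0 < s i <= 1) ->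
    \int[P]_w (\prod_(i < n) mix k s i (N i w)) =
    \prod_(i < n) \int[P]_w mix k s i (N i w).
  have := H n (leqnn n) (fun=> 1) (fun=> ltac:(by rewrite ltr01 lexx)).
  under eq_Rintegral do under eq_bigr do rewrite /mix ltn_ord.
  by under [in RHS]eq_bigr do under eq_Rintegral do rewrite /mix ltn_ord.
elim: k => [_ s s01|k IH kn s s01]; first exact: Hs.
pose j : 'I_n := Ordinal kn.
pose r w := \prod_(i < n | i != j) mix k s i (N i w).
pose c := \prod_(i < n | i != j) \int[P]_w mix k s i (N i w).
have mr : measurable_fun setT r.
  rewrite /r; under eq_fun do rewrite big_mkcond/=.
  apply: measurable_prod => i _; case: (i != j) => //.
  exact: (m_comp (mix k s i) (mN i)).
have r1 w : `|r w| <= 1.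
  rewrite /r normr_prod; apply: prodr_ile1 => i _.
  by rewrite normr_ge0 mix1.
have c1 : `|c| <= 1.
  rewrite /c normr_prod; apply: prodr_ile1 => i _; rewrite normr_ge0/=.
  have mm := m_comp (mix k s i) (mN i).
  have im := bounded_integrable P mm (fun w => mix1 k s i (N i w) s01).
  rewrite (le_trans (le_normr_Rintegral measurableT im))//.
  rewrite -[X in _ <= X](Rintegral_prob_cst P); apply: le_Rintegral => //.
  - exact: integrable_norm.
  - by apply: (@bounded_integrable _ _ _ _ _ 1) => // w; rewrite normr1.
  - by move=> w _; exact: mix1.
have key (B : set nat) : \int[P]_w (r w * \1_B (N j w)) =
    \int[P]_w (c * \1_B (N j w)).
  apply: (@generating_unique r (fun=> c)) => // t t01.
  pose s' i := if i == j then t else s i.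
  have s'01 i : 0 < s' i <= 1 by rewrite /s'; case: ifP.
  have := IH (ltnW kn) s' s'01.
  have E i l : i != j -> mix k s' i l = mix k s i l.
    by move=> ij; rewrite /mix /s' (negbTE ij).
  have Ej l : mix k s' j l = t ^+ l by rewrite /mix ltnn /s' eqxx.
  rewrite [RHS](bigD1 j)//= mulrC => h.
  transitivity (\int[P]_w \prod_(i < n) mix k s' i (N i w)).
    apply: eq_Rintegral => w _; rewrite (bigD1 j)//= Ej mulrC; congr (_ * _).
    by apply: eq_bigr => i ij; rewrite E.
  rewrite h RintegralZl//; last first.
    apply: (@bounded_integrable _ _ _ _ _ 1); first exact: (m_comp (fun l => t ^+ l)).
    move=> w; rewrite ger0_norm ?exprn_ge0//; last lra.
    by apply: exprn_ile1; lra.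
  congr (_ * _); last by apply: eq_Rintegral => w _; rewrite Ej.
  by apply: eq_bigr => i ij; apply: eq_Rintegral => w _; rewrite E.
have mixj i : i != j -> mix k.+1 s i = mix k s i.
  move=> ij; apply/funext => v; rewrite /mix ltnS leq_eqVlt.
  by have -> : (i == k :> nat) = false by apply/negbTE.
have mixjj l : mix k.+1 s j l = \1_(A j) l by rewrite /mix ltnSn.
rewrite [RHS](bigD1 j)//=.
transitivity (\int[P]_w (r w * \1_(A j) (N j w))).
  apply: eq_Rintegral => w _; rewrite (bigD1 j)//= mulrC mixjj; congr (_ * _).
  by apply: eq_bigr => i ij; rewrite mixj.
rewrite key RintegralZl//; last first.
  by apply: (@bounded_integrable _ _ _ _ _ 1) => [|w]; [exact: m_comp|exact: ind1].
rewrite mulrC; congr (_ * _).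
  by apply: eq_Rintegral => w _; rewrite mixjj.
by apply: eq_bigr => i ij; apply: eq_Rintegral => w _; rewrite mixj.
Qed.

End generating_functions.

(** * Counts of points *)

Section poisson_counts.
Context {R : realType}.
Local Notation U := (@unif R).
Local Notation leb := (@lebesgue_measure R).

Definition count_upto (B : set R) (L : nat) (w : R) : nat :=
  \sum_(m < L.*2) \sum_(j < npoints m w) (arrival m j w \in B).

Lemma count_uptoE B L w : point_sum \1_B L.*2 w = (count_upto B L w)%:R.
Proof.
rewrite /point_sum /count_upto natr_sum; apply: eq_bigr => m _.
by rewrite natr_sum; apply: eq_bigr => j _; rewrite indicE.
Qed.

Lemma count_upto_stable B (L M : nat) w : (forall x, B x -> `|x| < L%:R) ->
  (L <= M)%N -> count_upto B M w = count_upto B L w.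
Proof.
move=> BL LM; apply/eqP; rewrite -(eqr_nat R) -!count_uptoE.
apply/eqP; apply: point_sum_stable; last by rewrite leq_double.
move=> x Lx; rewrite indicE memNset// => /BL; lra.
Qed.

Lemma bounded_borel_nat (B : set R) : bounded_borel B ->
  exists L : nat, forall x, B x -> `|x| < L%:R.
Proof.
move=> [_ /bounded_setE[M HM]]; exists (Num.truncn M).+1 => x /HM.
by move=> /le_lt_trans; apply; exact: truncnS_gt.
Qed.

(** A default value is needed for sets that are not bounded, on which the
    count of points may be infinite. *)
Definition radius (B : set R) : nat :=
  xget 0%N [set L : nat | forall x, B x -> `|x| < L%:R].

(** Counting up to [radius B] gives a natural number for every set; on bounded
    Borel sets any larger bound gives the same number, by [pointsE]. *)
Definition points (B : set R) (w : R) : nat :=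
  if `[< bounded_borel B >] then count_upto B (radius B) w else 0%N.

Lemma pointsE B (L : nat) w : bounded_borel B ->
  (forall x, B x -> `|x| < L%:R) -> points B w = count_upto B L w.
Proof.
move=> bB BL; rewrite /points asboolT//.
have [L' HL'] := bounded_borel_nat bB.
have rB : forall x, B x -> `|x| < (radius B)%:R.
  exact: (@xgetI _ 0%N [set L : nat | forall x, B x -> `|x| < L%:R] L' HL').
rewrite -(@count_upto_stable B _ (maxn (radius B) L) _ rB) ?leq_maxl//.
by rewrite (@count_upto_stable B _ (maxn (radius B) L) _ BL) ?leq_maxr.
Qed.

Lemma points_sumE B (L : nat) w : bounded_borel B ->
  (forall x, B x -> `|x| < L%:R) -> (points B w)%:R = point_sum \1_B L.*2 w.
Proof. by move=> bB BL; rewrite count_uptoE (@pointsE _ L). Qed.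

Lemma measurable_points B (A : set nat) : measurable (points B @^-1` A).
Proof.
have [bB|nB] := pselect (bounded_borel B); last first.
  rewrite (_ : points B = cst 0%N); last first.
    by apply/funext => w; rewrite /points asboolF.
  by rewrite preimage_cst; case: ifP.
have [L BL] := bounded_borel_nat bB.
rewrite (_ : points B @^-1` A =
    (point_sum \1_B L.*2) @^-1` [set n%:R | n in A]); last first.
  apply/seteqP; split => w /=; rewrite -(points_sumE _ bB BL).
    by move=> Aw; exists (points B w).
  by move=> [n An /eqP]; rewrite eqr_nat => /eqP <-.
rewrite -[X in measurable X]setTI; apply: measurable_point_sum => //.
  by apply: measurable_indic; case: bB.
by apply: countable_measurable => //; exact: card_le_trans (card_image_le _ _) (countableP _).
Qed.

(** The exponential functional of the combination of indicators with
    coefficients [ln (s i)]. *)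
Lemma points_generating n (B : 'I_n -> set R) (s : 'I_n -> R) :
  (forall i, bounded_borel (B i)) -> trivIset setT B ->
  (forall i, 0 < s i <= 1) ->
  \int[U]_w (\prod_(i < n) s i ^+ points (B i) w) =
  \prod_(i < n) expR ((s i - 1) * fine (leb (B i))).
Proof.
move=> bB tB s01.
have [r Hr] : exists r : 'I_n -> nat, forall i x, B i x -> `|x| < (r i)%:R.
  have := @choice _ _ (fun i (L : nat) => forall x, B i x -> `|x| < L%:R)
    (fun i => bounded_borel_nat (bB i)).
  by move=> [r Hr]; exists r.
pose L := \max_(i < n) r i.
have BL i x : B i x -> `|x| < L%:R.
  by move=> /Hr /lt_le_trans; apply; rewrite ler_nat (leq_bigmax i).
have mB i : measurable (B i) by case: (bB i).
pose h x := \sum_(i <- index_enum 'I_n) ln (s i) * \1_(B i) x.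
have mh : measurable_fun setT h.
  by apply: measurable_sum => i; apply: measurable_funM => //; exact: measurable_indic.
have hM x : `|h x| <= \sum_(i <- index_enum 'I_n) `|ln (s i)|.
  rewrite (le_trans (ler_norm_sum _ _ _))//; apply: ler_sum => i _.
  by rewrite normrM indicE; case: (_ \in _); rewrite ?normr1 ?normr0 ?mulr1 ?mulr0.
have E w : \prod_(i < n) s i ^+ points (B i) w = expR (point_sum h L.*2 w).
  rewrite /h point_sum_sum expR_sum; apply: eq_bigr => i _.
  rewrite point_sumZ -(points_sumE _ (bB i) (BL i)) mulrC expRM_natl lnK//.
  by rewrite posrE; case/andP: (s01 i).
have indB x i : B i x -> forall j, j != i -> \1_(B j) x = 0 :> R.
  move=> Bi j ij; rewrite indicE memNset// => Bj.
  move/trivIsetP : tB => /(_ i j Logic.I Logic.I); rewrite eq_sym ij => /(_ isT).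
  by move=> /seteqP[/(_ x) + _]; apply.
have eh x : expR (h x) - 1 = \sum_(i <- index_enum 'I_n) (s i - 1) * \1_(B i) x.
  have [[i Bi]|nB] := pselect (exists i, B i x).
    rewrite /h (bigD1 i)//= big1 ?addr0; last first.
      by move=> j ij; rewrite (indB _ _ Bi)// mulr0.
    rewrite (bigD1 i)//= big1 ?addr0; last first.
      by move=> j ij; rewrite (indB _ _ Bi)// mulr0.
    rewrite indicE mem_set// !mulr1 lnK//.
    by rewrite posrE; case/andP: (s01 i).
  have z i : \1_(B i) x = 0 :> R.
    by rewrite indicE memNset// => Bi; apply: nB; exists i.
  rewrite /h !big1 ?expR0 ?subrr// => i _; by rewrite z mulr0.
rewrite /Rintegral; under eq_integral do rewrite E.
rewrite (exponential_functional L mh hM)/= -expR_sum; congr expR.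
have bI : bounded_borel (`[- L%:R, L%:R[%classic : set R) by exact: bounded_borel_itv.
have int1 i : leb.-integrable `[- L%:R, L%:R[ (EFin \o \1_(B i)).
  apply: (@bounded_borel_integrable _ _ _ 1) => //.
  by move=> x _; rewrite indicE; case: (_ \in _); rewrite ?normr1 ?normr0.
under eq_Rintegral do rewrite eh.
have int2 i : leb.-integrable `[- L%:R, L%:R[ (EFin \o (fun x => (s i - 1) * \1_(B i) x)).
  by have := integrableZl _ (s i - 1) (int1 i); apply; exact: measurable_itv.
have sumI (t : seq 'I_n) : \int[leb]_(x in `[- L%:R, L%:R[)
    (\sum_(i <- t) (s i - 1) * \1_(B i) x) =
    \sum_(i <- t) (s i - 1) * fine (leb (B i)).
  elim: t => [|i t IH].
    by under eq_Rintegral do rewrite big_nil; rewrite big_nil Rintegral_cst// mul0r.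
  under eq_Rintegral do rewrite big_cons.
  rewrite big_cons RintegralD//=; last first.
    rewrite (_ : _ \o _ = (fun x => \sum_(i <- t) (EFin \o (fun x => ((s i - 1) * \1_(B i) x)%R)) x)%E).
      exact: integrable_sum.
    by apply/funext => x /=; rewrite sumEFin.
  rewrite IH RintegralZl// Rintegral_indic//.
  congr (_ * fine (leb _) + _); rewrite setIidl// => x /BL.
  by rewrite /= in_itv/= ltr_norml => /andP[? ?]; rewrite ltW//=.
exact: sumI.
Qed.

Lemma points_generating1 (B : set R) (s : R) : bounded_borel B -> 0 < s <= 1 ->
  \int[U]_w (s ^+ points B w) = expR ((s - 1) * fine (leb B)).
Proof.
move=> bB s01; have := @points_generating 1 (fun=> B) (fun=> s) (fun=> bB) _ (fun=> s01).
under eq_Rintegral do rewrite big_ord1.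
rewrite big_ord1; apply; apply/trivIsetP => i j _ _.
by rewrite (ord1 i) (ord1 j) eqxx.
Qed.

(** The generating function of the counts factors, and this characterizes
    independence. *)
Lemma points_independent n (B : 'I_n -> set R) (A : 'I_n -> set nat) :
  (forall i, bounded_borel (B i)) -> trivIset setT B ->
  U (\bigcap_(i in [set: 'I_n]) (points (B i) @^-1` A i)) =
  (\prod_(i < n) U (points (B i) @^-1` A i))%E.
Proof.
move=> bB tB.
have mP i : measurable (points (B i) @^-1` A i) by exact: measurable_points.
have fP i : U (points (B i) @^-1` A i) = (\int[U]_w (\1_(A i) (points (B i) w) : R))%:E.
  rewrite fineK; last first.
    apply: integrable_fin_num => //; apply: (@bounded_integrable _ _ _ _ _ 1).
      exact: measurable_indic (mP i).
    by move=> w; rewrite indicE; case: (_ \in _); rewrite ?normr1 ?normr0.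
  by rewrite -[X in U X]setIT -integral_indic.
under eq_bigr do rewrite fP.
rewrite prodEFin -(@generating_independent _ _ _ U n (fun i => points (B i))).
- rewrite /Rintegral fineK; last first.
    apply: integrable_fin_num => //; apply: (@bounded_integrable _ _ _ _ _ 1).
      by apply: measurable_prod => i _; exact: measurable_indic (mP i).
    move=> w; rewrite normr_prod; apply: prodr_ile1 => i _.
    by rewrite normr_ge0/= indicE; case: (_ \in _); rewrite ?normr1 ?normr0.
  rewrite -[X in U X]setIT -integral_indic//; last first.
    by apply: fin_bigcap_measurable => [|i _]; [exact: finite_finset|].
  apply: eq_integral => w _; congr EFin.
  rewrite indicE; have [h|h] := pselect ((\bigcap_(i in [set: 'I_n]) (points (B i) @^-1` A i)) w).
    by rewrite (mem_set h) big1// => i _; rewrite indicE mem_set//; exact: h.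
  rewrite (memNset h).
  have /existsNP[i /not_implyP[_ hi]] := h.
  by rewrite (bigD1 i)//= indicE memNset// mul0r.
- by move=> i A'; exact: measurable_points.
- move=> s s01; rewrite points_generating//; apply: eq_bigr => i _.
  by rewrite points_generating1.
Qed.

(** The generating function depends on the set through its measure only. *)
Lemma points_law (B B' : set R) (A : set nat) : bounded_borel B ->
  bounded_borel B' -> leb B = leb B' ->
  U (points B @^-1` A) = U (points B' @^-1` A).
Proof.
move=> bB bB' BB'.
have fP D : U (points D @^-1` A) = (\int[U]_w (1 * \1_A (points D w) : R))%:E.
  have mP : measurable (points D @^-1` A) by exact: measurable_points.
  rewrite fineK; last first.
    apply: integrable_fin_num => //; apply: (@bounded_integrable _ _ _ _ _ 1).
      by apply: measurable_funM => //; exact: measurable_indic mP.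
    by move=> w; rewrite mul1r indicE; case: (_ \in _); rewrite ?normr1 ?normr0.
  under eq_integral do rewrite mul1r.
  by rewrite -[X in U X]setIT -integral_indic.
rewrite !fP; congr EFin.
apply: (@generating_unique _ _ _ U (fun=> 1) (fun=> 1)) => //.
- by move=> w; rewrite normr1.
- by move=> w; rewrite normr1.
- exact: measurable_points.
- exact: measurable_points.
move=> s s01; under eq_Rintegral do rewrite mul1r.
by under [RHS]eq_Rintegral do rewrite mul1r; rewrite !points_generating1// BB'.
Qed.

(** Comparison of an indicator with [1 - 2 ^ - n] in the generating function
    at one half, and [1 - exp (- x) <= x]. *)
Lemma points_gt0_le (B : set R) : bounded_borel B ->
  (U [set w | (0 < points B w)%N] <= leb B)%E.
Proof.
move=> bB; have mP : measurable [set w | (0 < points B w)%N].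
  exact: (measurable_points B [set n | (0 < n)%N]).
have fin := lebesgue_bounded_borel_fin bB.
have fU : U [set w | (0 < points B w)%N] \is a fin_num by exact: fin_num_measure.
have s01 : 0 < (2^-1 : R) <= 1 by lra.
have h := points_generating1 bB s01.
have m1 : measurable_fun setT (fun w => 2^-1 ^+ points B w : R).
  by move=> _ A _; rewrite setTI; exact: (measurable_points B [set n | A (2^-1 ^+ n)]).
have b1 w : `|2^-1 ^+ points B w : R| <= 1.
  by rewrite ger0_norm ?exprn_ge0// exprn_ile1//; lra.
have i1 : U.-integrable setT (EFin \o (fun w => 2^-1 ^+ points B w : R)).
  exact: bounded_integrable m1 b1.
have i2 : U.-integrable setT (EFin \o (fun _ : R => 1 : R)).
  by apply: (@bounded_integrable _ _ _ _ _ 1) => // w; rewrite normr1.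
have i3 : U.-integrable setT (EFin \o (\1_[set w | (0 < points B w)%N] : R -> R)).
  exact: integrable_indic.
have i4 := integrableZl measurableT 2^-1 i3.
have i5 := integrableB measurableT i2 i1.
have : \int[U]_w (2^-1 * \1_[set w | (0 < points B w)%N] w) <=
    \int[U]_w (1 - 2^-1 ^+ points B w).
  apply: le_Rintegral => // w _; rewrite indicE.
  case: (ltnP 0 (points B w)) => [|]; last first.
    rewrite leqn0 => /eqP h0; rewrite memNset/= ?h0// mulr0 expr0 subrr//.
  move=> N0; rewrite mem_set// mulr1.
  have : 2^-1 ^+ points B w <= 2^-1 :> R.
    by rewrite -[X in _ <= X]expr1; apply: ler_wiXn2l => //; lra.
  by move: (2^-1 ^+ points B w : R) => p; lra.
rewrite RintegralZl// RintegralB// Rintegral_prob_cst h.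
have -> : \int[U]_w (\1_[set w | (0 < points B w)%N] w : R) =
    fine (U [set w | (0 < points B w)%N]).
  by rewrite /Rintegral integral_indic// setIT.
have := expR_ge1Dx ((2^-1 - 1) * fine (leb B)).
rewrite -(fineK fU) -(fineK fin) lee_fin; lra.
Qed.

End poisson_counts.

(** * Integrals of simple functions *)

Section simple_functions.
Context {R : realType}.
Local Notation leb := (@lebesgue_measure R).
Import HBSimple.

(** Integrals of functions of a simple function are finite sums over its level
    sets, the same sums that define stochastic integrals of simple functions. *)
Lemma Rintegral_simple (h : {sfun R >-> R}) (k : R -> R) B : bounded_borel B ->
  \int[leb]_(x in B) k (h x) =
  \sum_(r <- finmap.enum_fset (fset_set (range h)))
     k r * fine (leb (B `&` h @^-1` [set r])).
Proof.
move=> bB; set s := finmap.enum_fset _.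
have us : uniq s by exact: finmap.fset_uniq.
have mh r : measurable (h @^-1` [set r]) by exact: measurable_funPTI.
have kE x : k (h x) = \sum_(r <- s) k r * \1_(h @^-1` [set r]) x.
  have hs : h x \in s by have := in_fset_set (fimfunP h) (h x); rewrite [RHS]mem_set//; exists x.
  rewrite (bigD1_seq _ hs us)//= indicE mem_set// mulr1 big1 ?addr0// => r rx.
  by rewrite indicE memNset ?mulr0// => /= hx; move: rx; rewrite hx eqxx.
under eq_Rintegral do rewrite kE.
have int1 r : leb.-integrable B (EFin \o (fun x => \1_(h @^-1` [set r]) x : R)).
  apply: (@bounded_borel_integrable _ _ _ 1) => //.
    exact: measurable_indic (mh r).
  by move=> x _; rewrite indicE; case: (x \in h @^-1` _); rewrite ?normr1 ?normr0.
have mB : measurable (B : set (measurableTypeR R)) by case: bB.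
have int2 r : leb.-integrable B (EFin \o (fun x => k r * \1_(h @^-1` [set r]) x)).
  by have := integrableZl mB (k r) (int1 r); apply.
elim: s {us kE} => [|r q IH].
  by under eq_Rintegral do rewrite big_nil; rewrite big_nil Rintegral_cst// mul0r.
under eq_Rintegral do rewrite big_cons.
rewrite big_cons RintegralD//=; last first.
  rewrite (_ : _ \o _ = (fun x => \sum_(r <- q) (EFin \o (fun x => (k r * \1_(h @^-1` [set r]) x)%R)) x)%E).
    exact: integrable_sum.
  by apply/funext => x /=; rewrite sumEFin.
by rewrite IH RintegralZl// Rintegral_indic// setIC.
Qed.

End simple_functions.

(** * The average of one minus the cosine *)

Section sine_bounds.
Context {R : realType}.
Implicit Types (x z : R).

(** Integrating an inequality once; iterating it gives the Taylor bounds. *)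
Lemma ge0_of_derive (g g' : R -> R) : g 0 = 0 ->
  (forall x, is_derive x (1 : R) g (g' x)) ->
  (forall x, 0 <= x -> 0 <= g' x) -> forall x, 0 <= x -> 0 <= g x.
Proof.
move=> g0 dg g'0 x x0; rewrite -g0.
apply: (@ger0_derive1_ndecr R g 0 x) => //.
- move=> y; rewrite in_itv/= => /andP[y0 _].
  by rewrite derive1E; case: (dg y) => _ ->; apply: g'0; exact: ltW.
- apply: continuous_subspaceT => y; apply: differentiable_continuous.
  by apply/derivable1_diffP; case: (dg y).
Qed.

Lemma sin_le x : 0 <= x -> 0 <= x - sin x.
Proof.
apply: (@ge0_of_derive (fun x => x - sin x) (fun x => 1 - cos x)).
- by rewrite sin0 subrr.
- by move=> y _; rewrite subr_ge0 cos_le1.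
Qed.

Lemma cos_ge x : 0 <= x -> 0 <= cos x - 1 + x ^+ 2 / 2.
Proof.
apply: (@ge0_of_derive (fun x => cos x - 1 + x ^+ 2 / 2) (fun x => x - sin x)).
- by rewrite cos0 expr0n /= mul0r; lra.
- by move=> y; apply: is_derive_eq; rewrite /GRing.scale/=; field.
- exact: sin_le.
Qed.

Lemma sin_ge x : 0 <= x -> 0 <= sin x - x + x ^+ 3 / 6.
Proof.
apply: (@ge0_of_derive (fun x => sin x - x + x ^+ 3 / 6)
  (fun x => cos x - 1 + x ^+ 2 / 2)).
- by rewrite sin0 expr0n /= mul0r; lra.
- by move=> y; apply: is_derive_eq; rewrite /GRing.scale/=; field.
- exact: cos_ge.
Qed.

Lemma cos_le x : 0 <= x -> 0 <= 1 - x ^+ 2 / 2 + x ^+ 4 / 24 - cos x.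
Proof.
apply: (@ge0_of_derive (fun x => 1 - x ^+ 2 / 2 + x ^+ 4 / 24 - cos x)
  (fun x => sin x - x + x ^+ 3 / 6)).
- by rewrite cos0 !expr0n /= !mul0r; lra.
- by move=> y; apply: is_derive_eq; rewrite /GRing.scale/=; field.
- exact: sin_ge.
Qed.

Lemma sin_le5 x : 0 <= x -> 0 <= x - x ^+ 3 / 6 + x ^+ 5 / 120 - sin x.
Proof.
apply: (@ge0_of_derive (fun x => x - x ^+ 3 / 6 + x ^+ 5 / 120 - sin x)
  (fun x => 1 - x ^+ 2 / 2 + x ^+ 4 / 24 - cos x)).
- by rewrite sin0 !expr0n /= !mul0r; lra.
- by move=> y; apply: is_derive_eq; rewrite /GRing.scale/=; field.
- exact: cos_le.
Qed.

(** The Taylor bound of degree five covers the arguments up to two; beyond,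
    the modulus of the sine is at most one. *)
Lemma sinc_le x : 0 < x -> sin x / x <= 1 - Num.min (x ^+ 2) 1 / 10.
Proof.
move=> x0; rewrite ler_pdivrMr//; have [x2|x2] := leP x 2.
  have h : Num.min (x ^+ 2) 1 <= x ^+ 2 by rewrite ge_min lexx.
  have := sin_le5 (ltW x0).
  have : x ^+ 5 <= 4 * x ^+ 3.
    rewrite (_ : x ^+ 5 = x ^+ 2 * x ^+ 3); last by rewrite -exprD.
    by rewrite ler_pM2r ?exprn_gt0// expr2; nra.
  have : Num.min (x ^+ 2) 1 * x <= x ^+ 3 by rewrite (exprSr x 2) ler_pM2r.
  have : 0 < x ^+ 3 by rewrite exprn_gt0.
  by rewrite mulrBl mul1r; lra.
have : Num.min (x ^+ 2) 1 <= 1 by rewrite ge_min lexx orbT.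
have := sin_le1 x; nra.
Qed.

(** The average of [1 - cos] is [1 - sin z / z]. *)
Lemma avg_1_cos z :
  ((Num.min (z ^+ 2) 1 / 10)%:E <=
   \int[lebesgue_measure]_(u in `[0%R, 1%R]) (1 - cos (z * u))%:E)%E.
Proof.
have m1 y : Num.min (y ^+ 2) 1 <= 1 :> R by rewrite ge_min lexx orbT.
wlog z0 : z / 0 <= z.
  move=> H; have [|z0] := leP 0 z; first exact: H.
  have := H (- z); rewrite sqrrN; under eq_integral do rewrite mulNr cosN.
  by apply; lra.
move: z0; rewrite le_eqVlt => /predU1P[<-|z0].
  rewrite expr0n /= min_l// mul0r; apply: integral_ge0 => u _.
  by rewrite lee_fin subr_ge0 cos_le1.
have dF u : is_derive u (1 : R) (fun u => u - sin (z * u) / z) (1 - cos (z * u)).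
  apply: is_derive_eq; rewrite /GRing.scale/=; field.
  by rewrite gt_eqF.
rewrite (@continuous_FTC2 _ _ (fun u => u - sin (z * u) / z)) //=.
- rewrite mulr1 mulr0 sin0 mul0r subr0 -EFinB lee_fin subr0.
  by have := sinc_le z0; lra.
- apply: continuous_subspaceT => u; apply: cvgB; first exact: cvg_cst.
  apply: continuous_comp; last exact: continuous_cos.
  by apply: cvgM; [exact: cvg_cst|exact: cvg_id].
- have cF : continuous (fun u => u - sin (z * u) / z : R).
    move=> u; apply: differentiable_continuous.
    by apply/derivable1_diffP; case: (dF u).
  split.
  + by move=> u _; case: (dF u).
  + exact/cvg_at_right_filter/cF.
  + exact/cvg_at_left_filter/cF.
- by move=> u _; rewrite derive1E; case: (dF u).
Qed.

End sine_bounds.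

(** * The squared modulus of a characteristic function *)

Lemma cvg_sqr {R : realType} {I : Type} (F : set_system I) {FF : Filter F}
    (u : I -> R) (l : R) :
  u i @[i --> F] --> l -> u i ^+ 2 @[i --> F] --> l ^+ 2.
Proof.
by move=> ul; under eq_fun do rewrite expr2; rewrite expr2; exact: cvgM.
Qed.

Section squared_modulus.
Context {R : realType} {d : measure_display} {T : measurableType d}
  (P : probability T R).
Implicit Types (Y Z : T -> R).

(** The squared modulus of the characteristic function of [Y] at one;
    arguments [t] are introduced as [t * Y]. It is real, it is blind to
    deterministic shifts of [Y] and it is multiplicative on independent sums,
    which is all that is needed of Fourier analysis. *)
Definition phi2 Y : R :=
  (\int[P]_w cos (Y w)) ^+ 2 + (\int[P]_w sin (Y w)) ^+ 2.

Lemma measurable_cos Y : measurable_fun setT Y ->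
  measurable_fun setT (fun w => cos (Y w)).
Proof.
move=> mY; apply: (measurableT_comp (f := cos)) => //.
by apply: continuous_measurable_fun; exact: continuous_cos.
Qed.

Lemma measurable_sin Y : measurable_fun setT Y ->
  measurable_fun setT (fun w => sin (Y w)).
Proof.
move=> mY; apply: (measurableT_comp (f := sin)) => //.
by apply: continuous_measurable_fun; exact: continuous_sin.
Qed.

Lemma cos_norm_le1 (x : R) : `|cos x| <= 1.
Proof. by rewrite ler_norml cos_geN1 cos_le1. Qed.

Lemma sin_norm_le1 (x : R) : `|sin x| <= 1.
Proof. by rewrite ler_norml sin_geN1 sin_le1. Qed.

Lemma integrable_cos Y : measurable_fun setT Y ->
  P.-integrable setT (EFin \o (fun w => cos (Y w))).
Proof.
move=> mY; apply: (@bounded_integrable _ _ _ _ _ 1); first exact: measurable_cos.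
by move=> w; exact: cos_norm_le1.
Qed.

Lemma integrable_sin Y : measurable_fun setT Y ->
  P.-integrable setT (EFin \o (fun w => sin (Y w))).
Proof.
move=> mY; apply: (@bounded_integrable _ _ _ _ _ 1); first exact: measurable_sin.
by move=> w; exact: sin_norm_le1.
Qed.

Lemma phi2_ge0 Y : 0 <= phi2 Y.
Proof. by rewrite addr_ge0 ?sqr_ge0. Qed.

(** The squared modulus of the mean vector is its mean inner product with unit
    vectors, at most half the sum of the squared moduli. *)
Lemma phi2_le1 Y : measurable_fun setT Y -> phi2 Y <= 1.
Proof.
move=> mY; rewrite /phi2; set c := \int[P]_w _; set s := \int[P]_w sin _.
have ic := integrable_cos mY; have is_ := integrable_sin mY.
have E : c ^+ 2 + s ^+ 2 = \int[P]_w (c * cos (Y w) + s * sin (Y w)).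
  rewrite RintegralD//; last first.
  - by have := integrableZl measurableT s is_.
  - by have := integrableZl measurableT c ic.
  by rewrite !RintegralZl// !expr2.
have : \int[P]_w (c * cos (Y w) + s * sin (Y w)) <= \int[P]_w ((c ^+ 2 + s ^+ 2 + 1) / 2).
  apply: le_Rintegral => //.
  - have := integrableD measurableT (integrableZl measurableT c ic) (integrableZl measurableT s is_).
    by [].
  - by apply: (@bounded_integrable _ _ _ _ _ `|(c ^+ 2 + s ^+ 2 + 1) / 2|) => // w; exact: lexx.
  - move=> w _; have := cos2Dsin2 (Y w).
    have := sqr_ge0 (c - cos (Y w)); have := sqr_ge0 (s - sin (Y w)).
    rewrite !expr2; nra.
by rewrite Rintegral_prob_cst -E; lra.
Qed.

Lemma phi2_ae_eq Y Z : measurable_fun setT Y -> measurable_fun setT Z ->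
  {ae P, forall w, Y w = Z w} -> phi2 Y = phi2 Z.
Proof.
move=> mY mZ YZ.
have h (g : R -> R) : measurable_fun setT (fun w => g (Y w)) ->
    measurable_fun setT (fun w => g (Z w)) ->
    \int[P]_w g (Y w) = \int[P]_w g (Z w).
  move=> m1 m2; rewrite /Rintegral; congr fine; apply: ae_eq_integral => //.
  - exact/measurable_EFinP.
  - exact/measurable_EFinP.
  - by move: YZ; apply: filterS => w E _; rewrite E.
by rewrite /phi2 (h cos) ?(h sin)//; [exact: measurable_sin|exact: measurable_sin|exact: measurable_cos|exact: measurable_cos].
Qed.

Lemma phi2_cvg (Y_ : nat -> T -> R) Y : (forall n, measurable_fun setT (Y_ n)) ->
  measurable_fun setT Y -> {ae P, forall w, Y_ n w @[n --> \oo] --> Y w} ->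
  phi2 (Y_ n) @[n --> \oo] --> phi2 Y.
Proof.
move=> mY_ mY cY.
have h1 : \int[P]_w cos (Y_ n w) @[n --> \oo] --> \int[P]_w cos (Y w).
  apply: (@bounded_Rintegral_cvg _ _ _ _ _ _ 1).
  - by move=> n; exact: measurable_cos.
  - exact: measurable_cos.
  - by move=> n w; exact: cos_norm_le1.
  - move: cY; apply: filterS => w h; by apply: continuous_cvg => //; exact: continuous_cos.
have h2 : \int[P]_w sin (Y_ n w) @[n --> \oo] --> \int[P]_w sin (Y w).
  apply: (@bounded_Rintegral_cvg _ _ _ _ _ _ 1).
  - by move=> n; exact: measurable_sin.
  - exact: measurable_sin.
  - by move=> n w; exact: sin_norm_le1.
  - move: cY; apply: filterS => w h; by apply: continuous_cvg => //; exact: continuous_sin.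
by apply: cvgD; [exact: (cvg_sqr h1)|exact: (cvg_sqr h2)].
Qed.

Lemma phi2_shift Y (c : R) : measurable_fun setT Y ->
  phi2 (fun w => Y w - c) = phi2 Y.
Proof.
move=> mY; have ic := integrable_cos mY; have is_ := integrable_sin mY.
have ic' := integrableZl measurableT (cos c) ic.
have is' := integrableZl measurableT (sin c) is_.
have ic'' := integrableZl measurableT (sin c) ic.
have is'' := integrableZl measurableT (cos c) is_.
rewrite /phi2; have -> : \int[P]_w cos (Y w - c) =
    cos c * \int[P]_w cos (Y w) + sin c * \int[P]_w sin (Y w).
  rewrite -!RintegralZl// -RintegralD//; apply: eq_Rintegral => w _.
  by rewrite cosB; ring.
have -> : \int[P]_w sin (Y w - c) =
    cos c * \int[P]_w sin (Y w) - sin c * \int[P]_w cos (Y w).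
  rewrite -!RintegralZl// -RintegralB//; apply: eq_Rintegral => w _.
  by rewrite sinB; ring.
set x := \int[P]_w _; set y := \int[P]_w _.
transitivity ((cos c ^+ 2 + sin c ^+ 2) * (x ^+ 2 + y ^+ 2)); first ring.
by rewrite cos2Dsin2 mul1r.
Qed.

Lemma lip_cos (x y : R) : `|cos x - cos y| <= `|x - y|.
Proof.
wlog xy : x y / y <= x.
  move=> H; have [|/ltW] := leP y x; first exact: H.
  by rewrite (distrC (cos x)) (distrC x); exact: H.
have [c _ ->] := @MVT_segment R cos (fun x => - sin x) y x xy
  (fun z _ => is_derive_cos z) (continuous_subspaceT (@continuous_cos R)).
by rewrite normrM ler_piMl// normrN sin_norm_le1.
Qed.

Lemma lip_sin (x y : R) : `|sin x - sin y| <= `|x - y|.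
Proof.
wlog xy : x y / y <= x.
  move=> H; have [|/ltW] := leP y x; first exact: H.
  by rewrite (distrC (sin x)) (distrC x); exact: H.
have [c _ ->] := @MVT_segment R sin cos y x xy
  (fun z _ => is_derive_sin z) (continuous_subspaceT (@continuous_sin R)).
by rewrite normrM ler_piMl// cos_norm_le1.
Qed.

(** Bounded Lipschitz test functions detect convergence in probability. *)
Lemma Rintegral_lip_cvg_prob (g : R -> R) {I : Type} (F : set_system I)
    {FF : Filter F} (Y : I -> T -> R) Z :
  (forall x y, `|g x - g y| <= `|x - y|) -> (forall x, `|g x| <= 1) ->
  (forall Y, measurable_fun setT Y -> measurable_fun setT (fun w => g (Y w))) ->
  (forall i, measurable_fun setT (Y i)) -> measurable_fun setT Z ->
  (forall e : R, 0 < e -> P [set w | (e <= `|Y i w - Z w|)%R] @[i --> F] --> 0%E) ->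
  \int[P]_w g (Y i w) @[i --> F] --> \int[P]_w g (Z w).
Proof.
move=> gl g1 mg mY mZ cY; apply/cvgrPdist_le => e e0.
have e2 : 0 < e / 2 by rewrite divr_gt0.
have e4 : 0 < e / 4 by rewrite divr_gt0.
have mS i : measurable [set w | e / 2 <= `|Y i w - Z w|] by exact: measurable_ge_dist.
have /(cvg_probability0 P mS)/(_ _ e4) := cY _ e2.
apply: filterS => i hi.
have int (V : T -> R) : measurable_fun setT V -> P.-integrable setT (EFin \o (fun w => g (V w))).
  by move=> mV; apply: (@bounded_integrable _ _ _ _ _ 1) => //; exact: mg.
have ind : P.-integrable setT (EFin \o (fun w => \1_[set w | e / 2 <= `|Y i w - Z w|] w : R)).
  exact: integrable_indic.
have cint (c : R) : P.-integrable setT (EFin \o (fun _ : T => c)).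
  by apply: (@bounded_integrable _ _ _ _ _ `|c|) => // w; exact: lexx.
have ind2 := integrableZl measurableT 2 ind.
have diff := integrableB measurableT (int _ mZ) (int _ (mY i)).
rewrite -RintegralB//; last 2 first.
- exact: int.
- exact: int.
rewrite (le_trans (le_normr_Rintegral measurableT diff))//.
apply: (@le_trans _ _ (\int[P]_w (e / 2 + 2 * \1_[set w | e / 2 <= `|Y i w - Z w|] w))).
  apply: le_Rintegral => //; first exact: integrable_norm diff.
    exact: integrableD (cint (e / 2)) ind2.
  move=> w _; rewrite indicE; case: (leP (e / 2) `|Y i w - Z w|) => h.
    rewrite mem_set//= mulr1; have := ler_normB (g (Z w)) (g (Y i w)).
    by have := g1 (Z w); have := g1 (Y i w); lra.
  rewrite memNset/= ?mulr0 ?addr0; last by apply/negP; rewrite -ltNge.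
  by have := gl (Z w) (Y i w); rewrite [X in _ <= X]distrC; lra.
rewrite RintegralD// Rintegral_prob_cst RintegralZl//.
have -> : \int[P]_w (\1_[set w | e / 2 <= `|Y i w - Z w|] w : R) =
    fine (P [set w | e / 2 <= `|Y i w - Z w|]).
  by rewrite /Rintegral integral_indic// setIT.
have : fine (P [set w | e / 2 <= `|Y i w - Z w|]) <= e / 4.
  by rewrite -lee_fin fineK// fin_num_measure.
lra.
Qed.

Lemma phi2_cvg_prob {I : Type} (F : set_system I) {FF : Filter F}
    (Y : I -> T -> R) Z :
  (forall i, measurable_fun setT (Y i)) -> measurable_fun setT Z ->
  (forall e : R, 0 < e -> P [set w | (e <= `|Y i w - Z w|)%R] @[i --> F] --> 0%E) ->
  phi2 (Y i) @[i --> F] --> phi2 Z.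
Proof.
move=> mY mZ h.
have h1 : \int[P]_w cos (Y i w) @[i --> F] --> \int[P]_w cos (Z w).
  by apply: (Rintegral_lip_cvg_prob lip_cos cos_norm_le1 measurable_cos mY mZ h).
have h2 : \int[P]_w sin (Y i w) @[i --> F] --> \int[P]_w sin (Z w).
  by apply: (Rintegral_lip_cvg_prob lip_sin sin_norm_le1 measurable_sin mY mZ h).
have h3 := cvg_sqr h1.
have h4 := cvg_sqr h2.
by apply: cvgD; [exact: h3|exact: h4].
Qed.

End squared_modulus.

Section squared_modulus_sum.
Context {R : realType} {dO dV : measure_display}
  {Omega : measurableType dO} {V : measurableType dV} (P : probability Omega R).

(** The modulus of characteristic functions is multiplicative on sums of
    independent variables; the addition formulas are applied to one variable
    at a time, the others being carried along as factors [G i]. *)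
Lemma phi2_sum n (Y : 'I_n -> {RV P >-> V}) (f : 'I_n -> V -> R) :
  independent_RVs Y -> (forall i, measurable_fun setT (f i)) ->
  phi2 P (fun w => \sum_(i < n) f i (Y i w)) =
  \prod_(i < n) phi2 P (fun w => f i (Y i w)).
Proof.
move=> indY mf.
pose S k w := \sum_(i < n | (i < k)%N) f i (Y i w).
have mfY i : measurable_fun setT (fun w => f i (Y i w)) by exact: measurableT_comp.
pose ok (G : 'I_n -> V -> R) := (forall i, measurable_fun setT (G i)) /\
  (forall i v, `|G i v| <= 1).
have H k : (k <= n)%N -> exists c s : R,
    c ^+ 2 + s ^+ 2 = \prod_(i < n | (i < k)%N) phi2 P (fun w => f i (Y i w)) /\
    forall G, ok G ->
    \int[P]_w (cos (S k w) * \prod_(i < n | (k <= i)%N) G i (Y i w)) =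
      c * \prod_(i < n | (k <= i)%N) \int[P]_w G i (Y i w) /\
    \int[P]_w (sin (S k w) * \prod_(i < n | (k <= i)%N) G i (Y i w)) =
      s * \prod_(i < n | (k <= i)%N) \int[P]_w G i (Y i w).
  elim: k => [_|k IH kn].
    exists 1, 0; split; first by rewrite expr1n expr0n addr0 big_pred0.
    move=> G [mG G1]; split.
      rewrite mul1r -(independent_prod indY mG G1); apply: eq_Rintegral => w _.
      by rewrite /S big_pred0 ?cos0 ?mul1r.
    rewrite mul0r -[RHS](Rintegral_prob_cst P); apply: eq_Rintegral => w _.
    by rewrite /S big_pred0 ?sin0 ?mul0r.
  have [c [s [cs HG]]] := IH (ltnW kn).
  pose j : 'I_n := Ordinal kn.
  pose cj := \int[P]_w cos (f j (Y j w)).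
  pose sj := \int[P]_w sin (f j (Y j w)).
  exists (c * cj - s * sj), (s * cj + c * sj); split.
    rewrite (bigD1 j)/= ?ltnSn// [RHS]mulrC.
    rewrite [X in _ = X * _](_ : _ = c ^+ 2 + s ^+ 2); last first.
      rewrite cs; apply: eq_bigl => i; rewrite ltnS leq_eqVlt -(inj_eq val_inj)/=.
      by case: ltngtP.
    by rewrite /phi2 -/cj -/sj; ring.
  have SS w : S k.+1 w = S k w + f j (Y j w).
    rewrite /S (bigD1 j)/= ?ltnSn// addrC; congr (_ + _).
    apply: eq_bigl => i; rewrite ltnS leq_eqVlt -(inj_eq val_inj)/=.
    by case: ltngtP.
  move=> G okG.
  pose Gc (g : R -> R) i := if i == j then g \o f j else G i.
  have okc (g : R -> R) : measurable_fun setT g -> (forall x, `|g x| <= 1) -> ok (Gc g).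
    move=> mg g1; split=> i; rewrite /Gc; case: eqP => // _.
    - exact: measurableT_comp.
    - exact: okG.1.
    - by move=> v; exact: g1.
    - exact: okG.2.
  have mcos : measurable_fun setT (@cos R).
    by apply: continuous_measurable_fun; exact: continuous_cos.
  have msin : measurable_fun setT (@sin R).
    by apply: continuous_measurable_fun; exact: continuous_sin.
  have okcos := okc cos mcos (@cos_norm_le1 R).
  have oksin := okc sin msin (@sin_norm_le1 R).
  have PE g w : \prod_(i < n | (k <= i)%N) Gc g i (Y i w) =
      g (f j (Y j w)) * \prod_(i < n | (k < i)%N) G i (Y i w).
    rewrite (bigD1 j)//= /Gc eqxx/=; congr (_ * _).
    rewrite (eq_bigl (fun i : 'I_n => (k < i)%N)); last first.
      by move=> i; rewrite ltn_neqAle -(inj_eq val_inj)/= eq_sym andbC.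
    by apply: eq_bigr => i ki; rewrite ifF//; apply/eqP => h; move: ki; rewrite h ltnn.
  have PI g : \prod_(i < n | (k <= i)%N) \int[P]_w Gc g i (Y i w) =
      \int[P]_w g (f j (Y j w)) * \prod_(i < n | (k < i)%N) \int[P]_w G i (Y i w).
    rewrite (bigD1 j)//= /Gc eqxx/=; congr (_ * _).
    rewrite (eq_bigl (fun i : 'I_n => (k < i)%N)); last first.
      by move=> i; rewrite ltn_neqAle -(inj_eq val_inj)/= eq_sym andbC.
    by apply: eq_bigr => i ki; rewrite ifF//; apply/eqP => h; move: ki; rewrite h ltnn.
  have mS : measurable_fun setT (S k).
    rewrite /S; under eq_fun do rewrite big_mkcond/=.
    by apply: measurable_sum => i; case: (i < k)%N.
  have int (g h : R -> R) : measurable_fun setT g -> measurable_fun setT h ->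
      (forall x, `|g x| <= 1) -> (forall x, `|h x| <= 1) ->
      P.-integrable setT (EFin \o (fun w =>
        g (S k w) * (h (f j (Y j w)) * \prod_(i < n | (k < i)%N) G i (Y i w)))).
    move=> mg mh g1 h1; apply: (@bounded_integrable _ _ _ _ _ 1).
      apply: measurable_funM; first exact: measurableT_comp.
      apply: measurable_funM; first exact: (measurableT_comp mh).
      under eq_fun do rewrite big_mkcond/=.
      apply: measurable_prod => i _; case: (k < i)%N => //.
      by apply: measurableT_comp => //; exact: okG.1.
    move=> w; rewrite !normrM mulr_ile1// mulr_ile1// ?normr_prod.
    by apply: prodr_ile1 => i _; rewrite normr_ge0 okG.2.
  have cos1 := @cos_norm_le1 R; have sin1 := @sin_norm_le1 R.
  have [c1 s1] := HG _ okcos; have [c2 s2] := HG _ oksin.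
  rewrite PI -/cj in c1 s1; rewrite PI -/sj in c2 s2.
  split.
    transitivity (c * (cj * \prod_(i < n | (k < i)%N) \int[P]_w G i (Y i w)) -
      s * (sj * \prod_(i < n | (k < i)%N) \int[P]_w G i (Y i w))); last ring.
    rewrite -c1 -s2; under [X in _ = X - _]eq_Rintegral do rewrite PE.
    under [X in _ = _ - X]eq_Rintegral do rewrite PE.
    rewrite -RintegralB//; [|exact: int|exact: int].
    apply: eq_Rintegral => w _; rewrite SS cosD; ring.
  transitivity (s * (cj * \prod_(i < n | (k < i)%N) \int[P]_w G i (Y i w)) +
    c * (sj * \prod_(i < n | (k < i)%N) \int[P]_w G i (Y i w))); last ring.
  rewrite -c2 -s1; under [X in _ = X + _]eq_Rintegral do rewrite PE.
  under [X in _ = _ + X]eq_Rintegral do rewrite PE.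
  rewrite -RintegralD//; [|exact: int|exact: int].
  apply: eq_Rintegral => w _; rewrite SS sinD; ring.
have [c [s [cs HG]]] := H n (leqnn n).
have [mone one1] : ok (fun _ _ => 1) by split => // i v; rewrite normr1.
have [] := HG _ (conj mone one1).
have e1 (F : 'I_n -> R) : \prod_(i < n | (n <= i)%N) F i = 1.
  by rewrite big_pred0// => i; rewrite leqNgt ltn_ord.
have SE w : S n w = \sum_(i < n) f i (Y i w).
  by rewrite /S; apply: eq_bigl => i; rewrite ltn_ord.
under eq_Rintegral do rewrite e1 mulr1 SE.
move=> hc.
under eq_Rintegral do rewrite e1 mulr1 SE.
move=> hs; rewrite e1 mulr1 in hc; rewrite e1 mulr1 in hs.
rewrite [LHS]/phi2 hc hs cs; apply: eq_bigl => i; by rewrite ltn_ord.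
Qed.

End squared_modulus_sum.

(** * Random vectors and their coordinates *)

Section row_vectors.
Context {R : realType} {d : nat}.
Local Notation V := 'rV[R]_d.

Lemma measurable_coord (l : 'I_d) : measurable_fun setT (fun v : V => v 0 l).
Proof.
apply: (measurability _ (RGenOpens.measurableE R)) => _ [_ [x [y ->]] <-].
rewrite setTI; apply: sub_sigma_algebra.
apply: open_comp; last exact: interval_open.
by move=> v _; exact: coord_continuous.
Qed.

Lemma norm_coord_le (v : V) (l : 'I_d) : `|v 0 l| <= `|v|.
Proof.
rewrite /Num.norm/= mx_normrE.
exact: (le_bigmax _ (fun ij : 'I_1 * 'I_d => `|v ij.1 ij.2|) (0, l)).
Qed.

Lemma norm_lt_coord (v : V) (e : R) : 0 < e ->
  (forall l, `|v 0 l| < e) -> `|v| < e.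
Proof.
move=> e0 h; rewrite /Num.norm/= mx_normrE; apply: bigmax_lt => // -[i l] _ /=.
by rewrite (ord1 i).
Qed.

Lemma norm_le_coord (v : V) (e : R) : 0 <= e ->
  (forall l, `|v 0 l| <= e) -> `|v| <= e.
Proof.
move=> e0 h; rewrite /Num.norm/= mx_normrE; apply: bigmax_le => // -[i l] _ /=.
by rewrite (ord1 i).
Qed.

(** Open sets of vectors are countable unions of rational boxes. *)
Lemma measurable_rV {dO} {T : measurableType dO} (h : T -> V) :
  (forall l, measurable_fun setT (fun w => h w 0 l)) -> measurable_fun setT h.
Proof.
move=> mh; apply: (measurability (@open V)) => // _ [U oU <-]; rewrite setTI.
pose box (c : {ffun 'I_d -> rat} * nat) : set V :=
  [set v | forall l, `|v 0 l - ratr (c.1 l)| < c.2.+1%:R^-1].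
have mbox c : measurable (h @^-1` box c).
  rewrite (_ : h @^-1` box c = \bigcap_(l in [set: 'I_d])
      [set w | `|h w 0 l - ratr (c.1 l)| < c.2.+1%:R^-1]); last first.
    by apply/seteqP; split => w /= H; [move=> l _; exact: H|move=> l; exact: (H l Logic.I)].
  apply: fin_bigcap_measurable => // l _.
  rewrite -[X in measurable X]setTI; apply: measurable_fun_ltr => //.
  apply: measurableT_comp => //; apply: measurable_funB => //; exact: mh.
rewrite (_ : h @^-1` U = \bigcup_c (if `[< box c `<=` U >] then h @^-1` box c else set0)).
  apply: countable_bigcupT_measurable => // c; case: asboolP => // _.
apply/seteqP; split => [w Uw|w [c _]]; last by case: asboolP => // cU hw; exact: cU.
have /nbhs_ballP[e/= e0 eU] : nbhs (h w) U by exact: open_nbhs_nbhs.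
pose n := Num.truncn (e / 2)^-1.
have e20 : 0 < e / 2 by rewrite divr_gt0.
have ne : n.+1%:R^-1 < e / 2 by rewrite invf_plt ?posrE//; exact: truncnS_gt.
have n0 : 0 < n.+1%:R^-1 :> R by rewrite invr_gt0.
have q l : exists q : rat, `|h w 0 l - ratr q| < n.+1%:R^-1.
  have ab (x y : R) : 0 < y -> x - y < x + y by lra.
  have [q] := rat_in_itvoo (ab (h w 0 l) _ n0).
  rewrite in_itv/= => /andP[q1 q2]; exists q; rewrite ltr_norml.
  by move: q1 q2; set x := h w 0 l; set y := n.+1%:R^-1; set z := ratr q; lra.
pose c : {ffun 'I_d -> rat} := [ffun l => sval (cid (q l))].
exists (c, n) => //; case: asboolP => [_ /= l|[]].
  by rewrite ffunE; case: cid.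
move=> v /= vc; apply: eU; rewrite -ball_normE/=.
apply: norm_lt_coord => // l; have := vc l; rewrite ffunE; case: cid => /= r hr h2.
rewrite !mxE (_ : h w 0 l - v 0 l = (h w 0 l - ratr r) - (v 0 l - ratr r)); last first.
  by rewrite opprB addrA subrK.
apply: (le_lt_trans (ler_normB _ _)); move: hr h2 ne.
by rewrite /=; set x := n.+1%:R^-1; lra.
Qed.

End row_vectors.

Section coordinates_in_probability.
Context {R : realType} {d : nat} {dO : measure_display} {T : measurableType dO}
  (P : probability T R).

Lemma measurable_RV_coord (Y : {RV P >-> 'rV[R]_d}) l :
  measurable_fun setT (fun w => Y w 0 l).
Proof. exact: (measurableT_comp (@measurable_coord R d l)). Qed.

Lemma measurable_ge_norm (Y : T -> 'rV[R]_d) (e : R) : 0 < e ->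
  (forall l, measurable_fun setT (fun w => Y w 0 l)) ->
  measurable [set w | e <= `|Y w|].
Proof.
move=> e0 mY; rewrite (_ : [set w | _] = \bigcup_(l in [set: 'I_d]) [set w | e <= `|Y w 0 l|]).
  apply: fin_bigcup_measurable => // l _; rewrite -[X in measurable X]setTI.
  by apply: measurable_fun_ler => //; exact: measurableT_comp.
apply/seteqP; split => [w /= h|w [l _] /= h]; last exact: le_trans (norm_coord_le _ l).
apply: contrapT => nex; move: h; apply/negP; rewrite -ltNge; apply: norm_lt_coord => // l.
by rewrite ltNge; apply/negP => h; apply: nex; exists l.
Qed.

(** A coordinate is bounded by the norm. *)
Lemma cvg_in_probability_coord {I : Type} (F : set_system I) {FF : Filter F}
    (Y : I -> T -> 'rV[R]_d) (Z : T -> 'rV[R]_d) l :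
  (forall i l, measurable_fun setT (fun w => Y i w 0 l)) ->
  (forall l, measurable_fun setT (fun w => Z w 0 l)) ->
  cvg_in_probability P F Y Z ->
  forall e : R, 0 < e ->
    P [set w | (e <= `|Y i w 0 l - Z w 0 l|)%R] @[i --> F] --> 0%E.
Proof.
move=> mY mZ h e e0.
have mV i : measurable [set w | e <= `|Y i w - Z w|].
  apply: measurable_ge_norm => // k; under eq_fun do rewrite !mxE.
  exact: measurable_funB.
have mc i : measurable [set w | e <= `|Y i w 0 l - Z w 0 l|].
  exact: measurable_ge_dist.
apply/(cvg_probability0 P mc) => r r0.
have /(cvg_probability0 P mV)/(_ _ r0) := h _ e0.
apply: filterS => i; apply: le_trans; apply: le_measure; rewrite ?inE//.
move=> w /= /le_trans; apply; have := norm_coord_le (Y i w - Z w) l.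
by rewrite !mxE.
Qed.

End coordinates_in_probability.

(** * Homogeneous random measures with real values *)

Section homogeneous_measure.
Context {R : realType} {dO : measure_display} {Omega : measurableType dO}
  (P : probability Omega R).
Local Notation leb := (@lebesgue_measure R).
Variable Y : set R -> Omega -> R.
Hypothesis mY : forall B, measurable_fun setT (Y B).
Hypothesis Y_sigma_additive : forall B : (set R)^nat,
  (forall n, bounded_borel (B n)) -> trivIset setT B ->
  bounded_set (\bigcup_n B n) ->
  {ae P, forall w, \sum_(i < n) Y (B i) w @[n --> \oo] --> Y (\bigcup_n B n) w}.
Hypothesis Y_independent : forall n (B : 'I_n -> set R) (c : 'I_n -> R),
  (forall i, bounded_borel (B i)) -> trivIset setT B ->
  phi2 P (fun w => \sum_(i < n) c i * Y (B i) w) =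
  \prod_(i < n) phi2 P (fun w => c i * Y (B i) w).
Hypothesis Y_shift : forall B (s t : R), bounded_borel B ->
  phi2 P (fun w => t * Y [set x + s | x in B] w) = phi2 P (fun w => t * Y B w).

(** The function [B |-> - ln (psi t B)] is additive and shift invariant. *)
Definition psi (t : R) (B : set R) : R := phi2 P (fun w => t * Y B w).

Let mtY t B : measurable_fun setT (fun w => t * Y B w).
Proof. exact: measurable_funM. Qed.

Let bb0 : bounded_borel (set0 : set R).
Proof. by split; [exact: measurable0|apply/bounded_setE; exists 0]. Qed.

Lemma Y_set0 : {ae P, forall w, Y set0 w = 0}.
Proof.
have t0 : trivIset setT (fun _ : nat => (set0 : set R)).
  by apply/trivIsetP => i j _ _ _; rewrite setI0.
have := @Y_sigma_additive (fun=> set0) (fun=> bb0) t0.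
rewrite bigcup0// => /(_ (proj2 bb0)); apply: filterS => w h.
have h2 : \sum_(i < n.+1) Y set0 w @[n --> \oo] --> Y set0 w.
  by rewrite (cvg_shiftS (fun n => \sum_(i < n) Y set0 w)).
have h3 : \sum_(i < n.+1) Y set0 w - \sum_(i < n) Y set0 w @[n --> \oo] --> Y set0 w - Y set0 w.
  exact: cvgB.
rewrite subrr in h3.
have E n : \sum_(i < n.+1) Y set0 w - \sum_(i < n) Y set0 w = Y set0 w.
  by rewrite big_ord_recr/= addrAC subrr add0r.
have h4 : Y set0 w @[_ --> \oo] --> 0 by move: h3; under eq_fun do rewrite E.
exact: (cvg_uniq (cvg_cst _) h4).
Qed.

Lemma Y_setU A B : bounded_borel A -> bounded_borel B -> A `&` B = set0 ->
  {ae P, forall w, Y (A `|` B) w = Y A w + Y B w}.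
Proof.
move=> bA bB AB0.
have bAB : bounded_set (A `|` B).
  have [_ /bounded_setE[M HM]] := bA; have [_ /bounded_setE[N HN]] := bB.
  apply/bounded_setE; exists (Num.max M N) => x [/HM|/HN] h;
  by rewrite le_max h ?orbT.
have b2 n : bounded_borel (bigcup2 A B n) by case: n => [|[|n]].
have := Y_sigma_additive b2; rewrite bigcup2E -trivIset_bigcup2.
move=> /(_ AB0 bAB); have := Y_set0; apply: filterS2 => w Y0 h.
apply: cvg_uniq h _.
rewrite -(cvg_shiftn 2)/=; apply: cvg_near_cst; near=> n.
by rewrite addn2 !big_ord_recl/= big1 ?addr0.
Unshelve. all: by end_near. Qed.

Lemma psi_set0 t : psi t set0 = 1.
Proof.
rewrite /psi (@phi2_ae_eq _ _ _ P _ (fun=> 0))//; last first.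
  by have := Y_set0; apply: filterS => w ->; rewrite mulr0.
by rewrite /phi2 cos0 sin0 !Rintegral_prob_cst expr1n expr0n addr0.
Qed.

(** Almost sure convergence of the partial sums and the product formula for
    independent sums. *)
Lemma psi_bigcup t (B : (set R)^nat) : (forall n, bounded_borel (B n)) ->
  trivIset setT B -> bounded_set (\bigcup_n B n) ->
  \prod_(i < n) psi t (B i) @[n --> \oo] --> psi t (\bigcup_n B n).
Proof.
move=> bB tB bU.
have := @phi2_cvg _ _ _ P (fun n w => \sum_(i < n) t * Y (B i) w)
  (fun w => t * Y (\bigcup_n B n) w).
rewrite (_ : (fun n => phi2 P _) = (fun n => \prod_(i < n) psi t (B i))); last first.
  apply/funext => n; rewrite (@Y_independent n (fun i => B i) (fun=> t))//.
  by apply/trivIsetP => i j _ _ ij; move/trivIsetP : tB; exact.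
apply=> //.
  by move=> n; apply: measurable_sum => i; exact: mtY.
have := Y_sigma_additive bB tB bU; apply: filterS => w h.
by under eq_fun do rewrite -mulr_sumr; apply: cvgM => //; exact: cvg_cst.
Qed.

Lemma psi_setU t A B : bounded_borel A -> bounded_borel B -> A `&` B = set0 ->
  psi t (A `|` B) = psi t A * psi t B.
Proof.
move=> bA bB AB0.
have b2 (i : 'I_2) : bounded_borel (bigcup2 A B i) by case: i => -[|[|n]].
have := @Y_independent 2 (fun i => bigcup2 A B i) (fun=> t) b2.
rewrite !big_ord_recl !big_ord0 mulr1 /= => <-.
  rewrite /psi; apply: phi2_ae_eq => //.
    by apply: measurable_fun_bool || (under eq_fun do rewrite !big_ord_recl big_ord0/=; apply: measurable_funD => //; apply: measurable_funD).
  have := Y_setU bA bB AB0; apply: filterS => w ->.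
  by rewrite !big_ord_recl big_ord0/= addr0 mulrDr.
apply/trivIsetP => i j _ _ ij; move: AB0; rewrite trivIset_bigcup2.
by move/trivIsetP; exact.
Qed.

Let ge01 t B : 0 <= psi t B. Proof. exact: phi2_ge0. Qed.

Lemma psi_le1 t B : psi t B <= 1.
Proof. by apply: phi2_le1. Qed.

Let itv_cat t (x y z : R) : x <= y -> y <= z ->
  psi t `]x, z]%classic = psi t `]x, y]%classic * psi t `]y, z]%classic.
Proof.
move=> xy yz; rewrite -psi_setU; [|exact: bounded_borel_itv|exact: bounded_borel_itv|].
  congr psi; apply/seteqP; split => u /=; rewrite !in_itv/=.
    by move=> ?; case: (leP u y) => ?; [left|right]; lra.
  by case; lra.
by rewrite -subset0 => u [] /=; rewrite !in_itv/=; lra.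
Qed.

Let itv_shift t (x y s : R) :
  psi t `]x + s, y + s]%classic = psi t `]x, y]%classic.
Proof.
rewrite /psi -[RHS](Y_shift s t (bounded_borel_itv x y false false)); congr (phi2 P _).
apply/funext => w; congr (_ * Y _ w); rewrite shift_preimage.
by apply/seteqP; split => u /=; rewrite !in_itv/=; lra.
Qed.

Let itv_pow t (h : R) k : 0 <= h ->
  psi t `]0, k%:R * h]%classic = psi t `]0, h]%classic ^+ k.
Proof.
move=> h0; elim: k => [|k IH].
  by rewrite mul0r expr0 set_itvoc0 psi_set0.
rewrite exprSr -IH -(itv_shift t 0 h (k%:R * h)) add0r -itv_cat ?mulr_ge0//.
  by congr (psi t _); rewrite -natr1 mulrDl mul1r addrC.
by rewrite lerDr.
Qed.

(** No characteristic function of an infinitely divisible law vanishes: the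
    value on short intervals tends to one. *)
Lemma psi_unit_gt0 t : 0 < psi t `]0, 1]%classic.
Proof.
pose a n : R := n.+1%:R^-1.
have a0 n : 0 < a n by rewrite invr_gt0.
have da n m : (n <= m)%N -> a m <= a n.
  by move=> nm; rewrite lef_pV2 ?posrE// ler_nat.
pose B n : set R := `]a n.+1, a n]%classic.
have bB n : bounded_borel (B n) by exact: bounded_borel_itv.
have tB : trivIset setT B.
  have dB i j : (i < j)%N -> B i `&` B j = set0.
    move=> ij; rewrite -subset0 => z []; rewrite /B/= !in_itv/= => /andP[h _].
    by move=> /andP[_ /(lt_le_trans h)]; rewrite ltNge da.
  apply/trivIsetP => i j _ _; rewrite neq_ltn => /orP[|] ij.
    exact: dB.
  by rewrite setIC; exact: dB.
have UB : \bigcup_n B n = `]0, 1]%classic.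
  apply/seteqP; split=> [z [n _]|z]; rewrite /B/= !in_itv/=.
    have a1 : a 0%N = 1 by rewrite /a invr1.
    by have := a0 n.+1; have := da 0%N n (leq0n n); rewrite a1; lra.
  move=> /andP[z0 z1].
  have ex : exists n, a n < z.
    exists (Num.truncn z^-1); rewrite /a invf_plt ?posrE//.
    exact: truncnS_gt.
  case: (ex_minnP ex) => -[|n] yn nmin.
    by move: yn; rewrite /a invr1 ltNge z1.
  exists n => //; rewrite /B/= in_itv/= yn/= leNgt; apply/negP => /nmin.
  by rewrite ltnn.
have bU : bounded_set (\bigcup_n B n).
  by rewrite UB; case: (@bounded_borel_itv R 0 1 false false).
have fin : {ae P, forall w, forall n,
    Y `]0, 1]%classic w = Y `]0, a n]%classic w + \sum_(i < n) Y (B i) w}.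
  apply: ae_foralln => n; elim: n => [|n].
    by apply: aeW => w; rewrite big_ord0 addr0 /a invr1.
  have : {ae P, forall w, Y (`]0, a n.+1]%classic `|` B n) w =
      Y `]0, a n.+1]%classic w + Y (B n) w}.
    apply: Y_setU; [exact: bounded_borel_itv|exact: bB|].
    rewrite -subset0 => u [] /=; rewrite /B/= !in_itv/=.
    by have := da n n.+1 (leqnSn n); move=> h /andP[_ h1] /andP[h2 _]; have := lt_le_trans h2 h1; rewrite ltxx.
  apply: filterS2 => w h1 h2; rewrite h2 big_ord_recr/= [in RHS]addrA.
  rewrite addrAC -h1; congr (Y _ w + _); apply/seteqP; split => u /=; rewrite /B/= !in_itv/=.
    by move=> ?; case: (leP u (a n.+1)) => ?; [left|right]; lra.
  by have := da n n.+1 (leqnSn n); have := a0 n.+1; case; lra.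
have tail : {ae P, forall w, t * Y `]0, a n]%classic w @[n --> \oo] --> t * 0}.
  have := Y_sigma_additive bB tB bU; rewrite UB; move: fin.
  apply: filterS2 => w h1 h2; apply: cvgM; first exact: cvg_cst.
  rewrite -[X in _ --> X](subrr (Y `]0, 1]%classic w)).
  have E n : Y `]0, a n]%classic w = Y `]0, 1]%classic w - \sum_(i < n) Y (B i) w.
    by rewrite (h1 n) addrK.
  rewrite (_ : (fun n => Y _ w) = (fun n => Y `]0, 1]%classic w - \sum_(i < n) Y (B i) w)); last first.
    by apply/funext => n; exact: E.
  by apply: cvgB => //; exact: cvg_cst.
have c1 : psi t `]0, a n]%classic @[n --> \oo] --> phi2 P (fun=> t * 0).
  by apply: phi2_cvg => //; exact: tail.
have one : phi2 P (fun=> t * 0) = 1.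
  by rewrite /phi2 mulr0 cos0 sin0 !Rintegral_prob_cst expr1n expr0n addr0.
rewrite one in c1.
have /cvgrPdist_lt/(_ _ ltr01)[n _ /(_ n (leqnn n))] := c1.
rewrite /= => hn.
have pn : 0 < psi t `]0, a n]%classic by move: hn; rewrite ltr_norml; lra.
have -> : (1 : R) = n.+1%:R * a n by rewrite /a divff.
by rewrite itv_pow ?exprn_gt0// ltW.
Qed.

(** A bounded set lies in finitely many unit intervals, and [psi] is
    multiplicative. *)
Lemma psi_gt0 t B : bounded_borel B -> 0 < psi t B.
Proof.
move=> bB; have [M M0 BM] := bounded_borelP bB.
pose n := (Num.truncn M).+1.
have Mn : M < n%:R by exact: truncnS_gt.
have BI : B `<=` `](- n%:R), n%:R]%classic.
  by move=> x /BM; rewrite /= !in_itv/=; lra.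
have bI : bounded_borel (`](- n%:R), n%:R]%classic : set R) by exact: bounded_borel_itv.
have pI : 0 < psi t `](- n%:R), n%:R]%classic.
  rewrite -(itv_shift t (- n%:R) n%:R n%:R) addNr.
  have -> : n%:R + n%:R = (n + n)%:R * 1 :> R by rewrite mulr1 natrD.
  by rewrite itv_pow ?exprn_gt0 ?psi_unit_gt0.
have bD : bounded_borel (`](- n%:R), n%:R]%classic `\` B).
  apply: (bounded_borelS _ _ bI) => //.
  by apply: measurableD; [case: bI|case: bB].
move: pI; rewrite -(setDUK BI) psi_setU//; last by rewrite setDE setICA setICr setI0.
move=> h; have := ge01 t B; rewrite le_eqVlt => /orP[/eqP B0|//].
by move: h; rewrite -B0 mul0r ltxx.
Qed.

(** Additivity and shift invariance of [- ln psi] leave Lebesgue measure as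
    the only possibility. *)
Lemma psi_exp t B : bounded_borel B ->
  psi t B = expR (fine (leb B) * ln (psi t `]0, 1]%classic)).
Proof.
move=> bB; pose F (B : set R) := - ln (psi t B).
have FE : F B = F `]0, 1]%classic * fine (leb B).
  apply: additive_shift_invariantE => //.
    move=> D bD tD bU.
    have bU' : bounded_borel (\bigcup_n D n).
      by split => //; apply: bigcup_measurable => n _; case: (bD n).
    have SE n : \sum_(i < n) F (D i) = - ln (\prod_(i < n) psi t (D i)).
      elim: n => [|n IH]; first by rewrite !big_ord0 ln1 oppr0.
      rewrite !big_ord_recr/= IH lnM ?posrE ?psi_gt0//; first by rewrite opprD.
      by apply: prodr_gt0 => i _; exact: psi_gt0.
    under eq_fun do rewrite SE.
    apply: (@cvgN _ R^o); apply: continuous_cvg; last exact: psi_bigcup.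
    by have := continuous_ln (psi_gt0 t bU').
  by move=> D s bD; rewrite /F /psi Y_shift.
rewrite -[LHS]lnK ?posrE ?psi_gt0//; congr expR.
by move: FE; rewrite /F; lra.
Qed.

(** Twice the real part of the Levy exponent is [- ln (psi t `]0, 1])]; this
    is a lower bound of it with values between [0] and [1]. *)
Definition kappa (t : R) : R := 1 - psi t `]0, 1]%classic.

Lemma kappa01 t : 0 <= kappa t <= 1.
Proof.
by have := psi_le1 t `]0, 1]%classic; have := ge01 t `]0, 1]%classic; rewrite /kappa; lra.
Qed.

Lemma psi_le_exp t B : bounded_borel B ->
  psi t B <= expR (- (fine (leb B) * kappa t)).
Proof.
move=> bB; rewrite psi_exp// ler_expR -mulrN ler_wpM2l ?fine_ge0//.
have := @le_ln1Dx R (- kappa t); rewrite /kappa opprB addrCA subrr addr0; apply.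
by have := psi_unit_gt0 t; lra.
Qed.

Lemma kappa_cvg (u : R^nat) t : u @ \oo --> t -> kappa (u n) @[n --> \oo] --> kappa t.
Proof.
move=> ut; apply: cvgB; first exact: cvg_cst.
by apply: phi2_cvg => //; apply: aeW => w; apply: cvgM => //; exact: cvg_cst.
Qed.

Lemma measurable_kappa : measurable_fun setT kappa.
Proof.
apply: continuous_measurable_fun => t; apply/(@cvg_nbhsP _ R^o) => u ut.
exact: kappa_cvg.
Qed.

Import HBSimple.

(** The level sets are disjoint, hence carry independent variables, and
    [psi_le_exp] applies to each of them. *)
Lemma simple_integral_le (h : {sfun R >-> R}) t B : bounded_borel B ->
  phi2 P (fun w => t * \sum_(r \in range h) r * Y (B `&` h @^-1` [set r]) w) <=
  expR (- \int[leb]_(x in B) kappa (t * h x)).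
Proof.
move=> bB; pose s := finmap.enum_fset (fset_set (range h)).
pose D (i : 'I_(size s)) := B `&` h @^-1` [set s`_i].
have mh r : measurable (h @^-1` [set r]) by exact: measurable_funPTI.
have bD i : bounded_borel (D i).
  apply: (bounded_borelS _ _ bB).
    by apply: measurableI; [case: bB|exact: mh].
  by move=> x [].
have us : uniq s by exact: finmap.fset_uniq.
have tD : trivIset setT D.
  apply/trivIsetP => i j _ _ ij; rewrite -subset0 => x [[_ /= h1] [_ /= h2]].
  move: ij => /eqP; apply; apply/val_inj/eqP.
  by rewrite -(nth_uniq 0 _ _ us)//= -h1 -h2.
have E w : t * \sum_(r \in range h) r * Y (B `&` h @^-1` [set r]) w =
    \sum_(i < size s) (t * s`_i) * Y (D i) w.
  rewrite fsbig_finite//= -/s (big_nth 0) big_mkord mulr_sumr.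
  by apply: eq_bigr => i _; rewrite mulrA.
have -> : (fun w => t * \sum_(r \in range h) r * Y (B `&` h @^-1` [set r]) w) =
    (fun w => \sum_(i < size s) (t * s`_i) * Y (D i) w).
  by apply/funext => w; rewrite E.
rewrite Y_independent//.
apply: (@le_trans _ _ (\prod_(i < size s) expR (- (fine (leb (D i)) * kappa (t * s`_i))))).
  by apply: ler_prod => i _; rewrite ge01 psi_le_exp.
rewrite -expR_sum ler_expR sumrN lerN2.
rewrite (Rintegral_simple h (fun r => kappa (t * r)) bB) -/s (big_nth 0) big_mkord.
by rewrite le_eqVlt; apply/orP; left; apply/eqP; apply: eq_bigr => i _; rewrite mulrC.
Qed.

End homogeneous_measure.

(** * Coordinates of a random measure *)

Section real_dominated_convergence.
Context {R : realType} {d : measure_display} {T : measurableType d}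
  (mu : {measure set T -> \bar R}).

Lemma Rintegral_dominated_cvg (D : set T) (f_ : nat -> T -> R) (f g : T -> R) :
  measurable D -> (forall n, measurable_fun D (f_ n)) -> measurable_fun D f ->
  {ae mu, forall x, D x -> f_ n x @[n --> \oo] --> f x} ->
  mu.-integrable D (EFin \o g) -> (forall n x, D x -> `|f_ n x| <= g x) ->
  \int[mu]_(x in D) f_ n x @[n --> \oo] --> \int[mu]_(x in D) f x.
Proof.
move=> mD mf_ mf fc ig fg.
have [] := @dominated_convergence _ _ _ mu D mD
  (fun n x => (f_ n x)%:E) (EFin \o f) (EFin \o g).
- by move=> n; exact/measurable_EFinP.
- exact/measurable_EFinP.
- move: fc; apply: filterS => x fx Dx.
  by apply/fine_cvgP; split; [exact: nearW|exact: fx].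
- exact: ig.
- by apply: aeW => x n Dx /=; rewrite lee_fin fg.
move=> intf _ h.
have : (\int[mu]_(x in D) f x)%:E = (\int[mu]_(x in D) (EFin \o f) x)%E.
  by rewrite fineK//; exact: integrable_fin_num.
by move=> E; move: h; rewrite -E => /fine_cvg.
Qed.

End real_dominated_convergence.

Section random_measure_coordinate.
Context {R : realType} {d : nat} {dO : measure_display}
  {Omega : measurableType dO} {P : probability Omega R}.
Context {mu : probability 'rV[R]_d R} {X : set R -> {RV P >-> 'rV[R]_d}}.
Hypothesis rmX : is_random_measure mu X.
Variable l : 'I_d.

Lemma phi2_distribution (Y : {RV P >-> 'rV[R]_d}) (h : 'rV[R]_d -> R) :
  measurable_fun setT h ->
  phi2 P (fun w => h (Y w)) = phi2 (distribution P Y) h.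
Proof.
move=> mh; have mhY : measurable_fun setT (fun w => h (Y w)) by exact: measurableT_comp.
rewrite /phi2 /Rintegral; congr (fine _ ^+ 2 + fine _ ^+ 2); apply/esym.
- apply: (integral_distribution (f := fun v => (cos (h v))%:E)).
  + by apply/measurable_EFinP; exact: measurable_cos.
  + exact: integrable_cos.
- apply: (integral_distribution (f := fun v => (sin (h v))%:E)).
  + by apply/measurable_EFinP; exact: measurable_sin.
  + exact: integrable_sin.
Qed.

Lemma phi2_eq_measure (m1 m2 : probability 'rV[R]_d R) (h : 'rV[R]_d -> R) :
  (forall A, measurable A -> m1 A = m2 A) -> phi2 m1 h = phi2 m2 h.
Proof.
by move=> E; rewrite /phi2 /Rintegral; congr (fine _ ^+ 2 + fine _ ^+ 2);
  apply: eq_measure_integral => A mA _; exact: E.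
Qed.

Lemma coord_sigma_additive (B : (set R)^nat) :
  (forall n, bounded_borel (B n)) -> trivIset setT B ->
  bounded_set (\bigcup_n B n) ->
  {ae P, forall w, \sum_(i < n) X (B i) w 0 l @[n --> \oo] -->
    X (\bigcup_n B n) w 0 l}.
Proof.
have [sadd _ _ _ _] := rmX.
move=> bB tB bU; have := sadd B bB tB bU; apply: filterS => w h.
have E n : \sum_(i < n) X (B i) w 0 l = (\sum_(i < n) X (B i) w) 0 l.
  by rewrite summxE.
under eq_fun do rewrite E.
exact: (cvg_comp _ _ h (@coord_continuous R 1 d 0 l (X (\bigcup_n B n) w))).
Qed.

Lemma coord_independent n (B : 'I_n -> set R) (c : 'I_n -> R) :
  (forall i, bounded_borel (B i)) -> trivIset setT B ->
  phi2 P (fun w => \sum_(i < n) c i * X (B i) w 0 l) =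
  \prod_(i < n) phi2 P (fun w => c i * X (B i) w 0 l).
Proof.
have [_ ind _ _ _] := rmX.
move=> bB tB; apply: (phi2_sum (f := fun i (v : 'rV[R]_d) => c i * v 0 l)).
  exact: ind.
by move=> i; apply: measurable_funM => //; exact: measurable_coord.
Qed.

Lemma coord_shift (B : set R) (s t : R) : bounded_borel B ->
  phi2 P (fun w => t * X [set x + s | x in B] w 0 l) =
  phi2 P (fun w => t * X B w 0 l).
Proof.
have [_ _ _ sh _] := rmX.
move=> bB; have mh : measurable_fun setT (fun v : 'rV[R]_d => t * v 0 l).
  by apply: measurable_funM => //; exact: measurable_coord.
rewrite !(phi2_distribution _ mh); apply: phi2_eq_measure => A mA.
exact: sh.
Qed.

End random_measure_coordinate.

Section real_simple_integral.
Context {R : realType} {d : nat} {dO : measure_display}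
  {Omega : measurableType dO} {P : probability Omega R}.
Import HBSimple.

Lemma simple_integral_coord (X : set R -> {RV P >-> 'rV[R]_d})
    (h : {sfun R >-> R}) B w l :
  simple_integral X h B w 0 l =
  \sum_(r \in range h) r * X (B `&` h @^-1` [set r]) w 0 l.
Proof.
rewrite /simple_integral !fsbig_finite//= summxE.
by apply: eq_bigr => r _; rewrite !mxE.
Qed.

Lemma measurable_simple_integral_coord (X : set R -> {RV P >-> 'rV[R]_d})
    (h : {sfun R >-> R}) B l :
  measurable_fun setT (fun w => simple_integral X h B w 0 l).
Proof.
under eq_fun do rewrite simple_integral_coord fsbig_finite//=.
by apply: measurable_sum => r; apply: measurable_funM => //; exact: measurable_RV_coord.
Qed.

End real_simple_integral.

(** * Symmetrization *)

Section symmetrization.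
Context {R : realType} {d : measure_display} {T : measurableType d}
  (P : probability T R).
Variable Y : T -> R.
Hypothesis mY : measurable_fun setT Y.
Local Open Scope ereal_scope.

Let D (z : T * T) : R := (Y z.1 - Y z.2)%R.

Let mD : measurable_fun setT D.
Proof.
apply: measurable_funB.
  exact: (measurableT_comp mY measurable_fst).
exact: (measurableT_comp mY measurable_snd).
Qed.

Let m1cos : measurable_fun setT (fun x : R => (1 - cos x)%R).
Proof.
apply: measurable_funB => //; apply: continuous_measurable_fun.
exact: continuous_cos.
Qed.

Let cos_ge0 (x : R) : 0 <= (1 - cos x)%:E.
Proof. by rewrite lee_fin subr_ge0 cos_le1. Qed.

(** Symmetrization: the squared modulus of the characteristic function of [Y]
    is the characteristic function of the difference of two independent
    copies. *)
Lemma one_minus_phi2 (u : R) :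
  (1 - phi2 P (fun w => (u * Y w)%R))%:E =
  \int[P \x P]_z (1 - cos (u * (Y z.1 - Y z.2)))%:E.
Proof.
have muY : measurable_fun setT (fun w => (u * Y w)%R) by exact: measurable_funM.
have ic := integrable_cos P muY; have is_ := integrable_sin P muY.
rewrite (fubini_tonelli1 (fun z => (1 - cos (u * (Y z.1 - Y z.2)))%:E)); first last.
- by move=> z; exact: cos_ge0.
- apply/measurable_EFinP.
  apply: (measurableT_comp m1cos (measurable_funM (measurable_cst u) mD)).
pose c := (\int[P]_w cos (u * Y w))%R; pose s := (\int[P]_w sin (u * Y w))%R.
have E x : fubini_F P (fun z => (1 - cos (u * (Y z.1 - Y z.2)))%:E) x =
    (1 - (c * cos (u * Y x) + s * sin (u * Y x)))%:E.
  rewrite /fubini_F/=.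
  transitivity (\int[P]_y ((1 - (cos (u * Y x) * cos (u * Y y) +
     sin (u * Y x) * sin (u * Y y)))%R)%:E).
    by apply: eq_integral => y _; congr EFin; rewrite mulrBr cosB.
  have i1 := integrableZl measurableT (cos (u * Y x)) ic.
  have i2 := integrableZl measurableT (sin (u * Y x)) is_.
  have i3 := integrableD measurableT i1 i2.
  have i0 : P.-integrable setT (EFin \o (fun _ : T => 1%R : R)).
    by apply: (@bounded_integrable _ _ _ _ _ 1%R) => // w; rewrite normr1.
  have i4 := integrableB measurableT i0 i3.
  rewrite -[LHS]fineK; last exact: (integrable_fin_num measurableT i4).
  congr EFin.
  transitivity (\int[P]_y (1 - (cos (u * Y x) * cos (u * Y y) +
     sin (u * Y x) * sin (u * Y y))))%R; first by [].
  rewrite RintegralB// Rintegral_prob_cst; congr (1 - _)%R.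
  rewrite RintegralD// !RintegralZl//.
  by rewrite -/c -/s mulrC [X in (_ + X)%R]mulrC.
under eq_integral do rewrite E.
have i1 := integrableZl measurableT c ic.
have i2 := integrableZl measurableT s is_.
have i3 := integrableD measurableT i1 i2.
have i0 : P.-integrable setT (EFin \o (fun _ : T => 1%R : R)).
  by apply: (@bounded_integrable _ _ _ _ _ 1%R) => // w; rewrite normr1.
have i4 := integrableB measurableT i0 i3.
rewrite -[RHS]fineK; last exact: (integrable_fin_num measurableT i4).
congr EFin.
transitivity (\int[P]_y (1 - (c * cos (u * Y y) + s * sin (u * Y y))))%R; last by [].
rewrite RintegralB// Rintegral_prob_cst; congr (1 - _)%R.
by rewrite RintegralD// !RintegralZl// -/c -/s /phi2 !expr2.
Qed.

(** A measure of nondegeneracy that makes sense without moments. *)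
Definition sym_mass : \bar R := \int[P \x P]_z (Num.min ((Y z.1 - Y z.2) ^+ 2) 1)%:E.

Let mmin : measurable_fun setT (fun z => Num.min (D z ^+ 2) 1)%R.
Proof. by apply: measurable_minr => //; exact: measurable_funX. Qed.

Let min_ge0 (x : R) : (0 <= Num.min (x ^+ 2) 1)%R.
Proof. by rewrite le_min sqr_ge0 ler01. Qed.

(** For a single argument [1 - phi2] may vanish although [Y] is random; its
    average over an interval of arguments may not. *)
Lemma avg_one_minus_phi2 (r : R) :
  (Num.min (r ^+ 2) 1 / 10)%:E * sym_mass <=
  \int[@unif R]_v (1 - phi2 P (fun w => (r * v * Y w)%R))%:E.
Proof.
have mE : measurable_fun setT (fun z => (Num.min (D z ^+ 2) 1)%:E).
  exact/measurable_EFinP.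
under eq_integral do rewrite one_minus_phi2.
pose F (x : R * (T * T)) : \bar R := (1 - cos (r * x.1 * D x.2))%:E.
have mF : measurable_fun setT F.
  apply/measurable_EFinP; apply: (measurableT_comp m1cos).
  apply: measurable_funM; first by apply: measurable_funM => //; exact: measurable_fst.
  exact: (measurableT_comp mD measurable_snd).
pose PP : probability (T * T)%type R := (P \x P)%E.
rewrite (_ : \int[_]_v _ = \int[@unif R]_v \int[PP]_z F (v, z)); last by [].
rewrite (@fubini_tonelli _ _ _ _ _ (@unif R) PP F mF); last first.
  by move=> x; exact: cos_ge0.
rewrite /sym_mass -ge0_integralZl//; last 2 first.
- by move=> z _; rewrite lee_fin.
- by rewrite lee_fin divr_ge0.
apply: ge0_le_integral => //.
- by move=> z _; rewrite -EFinM lee_fin mulr_ge0 ?divr_ge0.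
- by apply: measurable_funeM.
- have F0 : forall x, 0 <= F x by move=> x; exact: cos_ge0.
  exact: (measurable_fun_fubini_tonelli_G (m1 := @unif R) F mF F0).
move=> z _; rewrite /F/= -EFinM.
apply: (@le_trans _ _ (Num.min ((r * D z) ^+ 2) 1 / 10)%:E).
  rewrite lee_fin mulrAC ler_pM2r ?invr_gt0// exprMn le_min.
  apply/andP; split; first by apply: ler_pM => //; rewrite ge_min lexx.
  by apply: mulr_ile1 => //; rewrite ge_min lexx orbT.
apply: (le_trans (avg_1_cos _)).
have m2 : measurable_fun setT (fun v : R => (1 - cos (r * D z * v))%:E).
  by apply/measurable_EFinP; apply: (measurableT_comp m1cos); exact: measurable_funM.
rewrite -integral_itv_bndo_bndc; last exact: measurable_funS m2.
have := integral_unif_shift 0 m2 (fun v => cos_ge0 _); rewrite add0r => <-.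
rewrite le_eqVlt; apply/orP; left; apply/eqP.
by apply: eq_integral => v _; rewrite add0r mulrAC.
Qed.

(** A variable that agrees with an independent copy is constant, by Fubini's
    theorem. *)
Lemma sym_mass0_cst : sym_mass = 0 -> exists c : R, {ae P, forall w, Y w = c}.
Proof.
move=> m0.
have mE : measurable_fun setT (fun z => (Num.min (D z ^+ 2) 1)%:E).
  exact/measurable_EFinP.
have := m0; rewrite /sym_mass (fubini_tonelli1 (fun z => (Num.min (D z ^+ 2) 1)%:E))//; last first.
  by move=> z; rewrite lee_fin.
pose F := fubini_F P (fun z => (Num.min (D z ^+ 2) 1)%:E) => F0.
have mF : measurable_fun setT F.
  by apply: measurable_fun_fubini_tonelli_F => // z; rewrite lee_fin.
have FE : {ae P, forall x, setT x -> F x = 0}.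
  apply/(ae_eq_integral_abs P measurableT mF).
  rewrite -F0; apply: eq_integral => x _; rewrite gee0_abs//.
  by apply: integral_ge0 => y _; rewrite lee_fin.
have [x Fx] : exists x, F x = 0.
  apply: contrapT => nex; have [N [mN N0 HN]] := FE.
  have NT : N = setT.
    by apply/seteqP; split => // x _; apply: HN => /(_ Logic.I) h; apply: nex; exists x.
  have := @probability_setT _ _ _ P; rewrite -NT N0 => /eqP.
  by rewrite eq_sym onee_eq0.
exists (Y x).
have mG : measurable_fun setT (fun y => (Num.min (D (x, y) ^+ 2) 1)%:E).
  apply/measurable_EFinP; apply: measurable_minr => //.
  by apply: measurable_funX; apply: (measurable_funB (measurable_cst (Y x))).
have : {ae P, forall y, setT y -> (Num.min (D (x, y) ^+ 2) 1)%:E = 0 :> \bar R}.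
  apply/(ae_eq_integral_abs P measurableT mG).
  rewrite -Fx; apply: eq_integral => y _; rewrite gee0_abs//.
  by rewrite lee_fin.
apply: filterS => y /(_ Logic.I) [] /eqP; rewrite /D/=.
rewrite /Num.min; case: ifPn => _; last by rewrite oner_eq0.
by rewrite sqrf_eq0 subr_eq0 => /eqP.
Qed.

End symmetrization.

(** * Essential convergence and degeneracy *)

Section scaled_convergence.
Context {R : realType} {d : measure_display} {T : measurableType d}
  (P : probability T R).

Lemma cvg_probability_scale {I : Type} (F : set_system I) {FF : Filter F}
    (Y : I -> T -> R) (Z : T -> R) (t : R) :
  (forall i, measurable_fun setT (Y i)) -> measurable_fun setT Z ->
  (forall e : R, 0 < e -> P [set w | (e <= `|Y i w - Z w|)%R] @[i --> F] --> 0%E) ->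
  (forall e : R, 0 < e ->
     P [set w | (e <= `|t * Y i w - t * Z w|)%R] @[i --> F] --> 0%E).
Proof.
move=> mY mZ h e e0.
have mS s i : measurable [set w | s <= `|Y i w - Z w|] by exact: measurable_ge_dist.
have mT i : measurable [set w | e <= `|t * Y i w - t * Z w|].
  by apply: measurable_ge_dist; exact: measurable_funM.
have t0 : 0 < `|t| + 1 by rewrite ltr_wpDl.
have et : 0 < e / (`|t| + 1) by rewrite divr_gt0.
apply/(cvg_probability0 P mT) => r r0.
have /(cvg_probability0 P (mS _))/(_ _ r0) := h _ et.
apply: filterS => i; apply: le_trans; apply: le_measure; rewrite ?inE//.
move=> w /=; rewrite -mulrBr normrM ler_pdivrMr// => /le_trans; apply.
by rewrite mulrC ler_wpM2l// lerDl.
Qed.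

End scaled_convergence.

Section essential_convergence.
Context {R : realType} {d : nat} {dO : measure_display}
  {Omega : measurableType dO} {P : probability Omega R}.
Context {mu : probability 'rV[R]_d R} {X : set R -> {RV P >-> 'rV[R]_d}}.
Hypothesis rmX : is_random_measure mu X.
Variable l : 'I_d.
Variables (a b : \bar R) (f : R -> R).
Local Notation D := [set s : R | (a < s%:E < b)%E].
Hypothesis ab : (a < b)%E.
Hypothesis mf : measurable_fun D f.
Local Notation leb := (@lebesgue_measure R).

Let Y (B : set R) w := X B w 0 l.
Let K := kappa P Y.

Let mY B : measurable_fun setT (Y B).
Proof. exact: measurable_RV_coord. Qed.

Let K01 t : 0 <= K t <= 1. Proof. exact: kappa01. Qed.

Let mK : measurable_fun setT K. Proof. exact: measurable_kappa. Qed.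

Import HBSimple.

Let bI p q : bounded_borel (`]p, q]%classic : set R).
Proof. exact: bounded_borel_itv. Qed.

Let mKf t p q : (a < p%:E)%E -> (q%:E < b)%E ->
  measurable_fun `]p, q]%classic (fun x => K (t * f x)).
Proof.
move=> ap qb; apply: (measurableT_comp mK); apply: measurable_funM => //.
exact: (measurable_funS (measurable_open a b) (itvoc_sub_open ap qb)).
Qed.

(** The bound of [simple_integral_le] passes to the limit on both sides. *)
Lemma phi2_integral_le (p q t : R) (J : {RV P >-> 'rV[R]_d}) :
  (a < p%:E)%E -> (q%:E < b)%E -> is_stochastic_integral a b X f `]p, q]%classic J ->
  phi2 P (fun w => t * J w 0 l) <= expR (- \int[leb]_(x in `]p, q]) K (t * f x)).
Proof.
move=> ap qb [fn [fnf _] cJ].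
have mS n : measurable_fun setT (fun w => simple_integral X (fn n) `]p, q]%classic w 0 l).
  exact: measurable_simple_integral_coord.
have c1 : phi2 P (fun w => t * simple_integral X (fn n) `]p, q]%classic w 0 l) @[n --> \oo] -->
    phi2 P (fun w => t * J w 0 l).
  apply: phi2_cvg_prob.
  - by move=> n; exact: measurable_funM.
  - by apply: measurable_funM => //; exact: measurable_RV_coord.
  apply: cvg_probability_scale => //; first exact: measurable_RV_coord.
  apply: cvg_in_probability_coord => //.
  - by move=> n k; exact: measurable_simple_integral_coord.
  - by move=> k; exact: measurable_RV_coord.
have c2 : expR (- \int[leb]_(x in `]p, q]) K (t * fn n x)) @[n --> \oo] -->
    expR (- \int[leb]_(x in `]p, q]) K (t * f x)).
  apply: continuous_cvg; first exact: continuous_expR.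
  apply: (@cvgN _ R^o).
  apply: (@Rintegral_dominated_cvg _ _ _ leb `]p, q]%classic _ _ (cst 1)).
  - by case: (bI p q).
  - by move=> n; apply: measurable_funTS; apply: (measurableT_comp mK); apply: measurable_funM; [exact: measurable_cst|exact: (measurable_funP (fn n))].
  - exact: mKf.
  - move: fnf; apply: (@filterS _ _ (ae_filter_ringOfSetsType leb)) => x fx px.
    have h : t * fn n x @[n --> \oo] --> t * f x.
      by apply: cvgM; [exact: cvg_cst|exact: fx (itvoc_sub_open ap qb px)].
    exact: (kappa_cvg mY h).
  - apply: (@bounded_borel_integrable _ _ _ 1) => //.
    by move=> x _; rewrite normr1.
  - by move=> n x _; have /andP[h0 h1] := K01 (t * fn n x); rewrite ger0_norm.
have hN n : phi2 P (fun w => t * simple_integral X (fn n) `]p, q]%classic w 0 l) <=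
    expR (- \int[leb]_(x in `]p, q]) K (t * fn n x)).
  have := simple_integral_le mY (coord_sigma_additive rmX l)
    (coord_independent rmX l) (coord_shift rmX l) (fn n) t (bI p q).
  apply: le_trans; rewrite le_eqVlt; apply/orP; left; apply/eqP; congr (phi2 P _).
  by apply/funext => w; rewrite simple_integral_coord.
by apply: (ler_cvg_to c1 c2); exact: nearW.
Qed.

Variables (g : R -> R -> 'rV[R]_d) (J : R -> R -> {RV P >-> 'rV[R]_d})
  (Z : {RV P >-> 'rV[R]_d}).
Hypothesis JX : forall p q, (a < p%:E)%E -> p < q -> (q%:E < b)%E ->
  is_stochastic_integral a b X f [set` `]p, q]] (J p q).
Hypothesis JZ : cvg_in_probability P (filter_prod (downto a) (upto b))
  (fun pq w => J pq.1 pq.2 w - g pq.1 pq.2) Z.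

Let KE t p q : (a < p%:E)%E -> (q%:E < b)%E ->
  (\int[leb]_(x in `]p, q]) K (t * f x))%:E =
  (\int[leb]_(x in `]p, q]) (K (t * f x))%:E)%E.
Proof.
move=> ap qb.
have iK : leb.-integrable `]p, q]%classic (EFin \o (fun x => K (t * f x))).
  apply: (@bounded_borel_integrable _ _ _ 1) => //; first exact: mKf.
  by move=> x _; have /andP[h0 h1] := K01 (t * f x); rewrite ger0_norm.
have mI : measurable (`]p, q]%classic : set (measurableTypeR R)) by exact: measurable_itv.
by rewrite fineK//; exact: (integrable_fin_num mI iK).
Qed.

(** The centring [g] does not change the modulus, so that the modulus of the
    characteristic function of the limit, close to one near the origin, bounds
    the accumulated [kappa] from above. *)
Lemma kappa_integral_bound : exists2 delta : R, 0 < delta &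
  forall t, `|t| <= delta ->
  (\int[leb]_(x in D) (K (t * f x))%:E <= (ln 4)%:E)%E.
Proof.
have mZ : measurable_fun setT (fun w => Z w 0 l) by exact: measurable_RV_coord.
have c0 : phi2 P (fun w => t * Z w 0 l) @[t --> (0 : R)] --> (1 : R).
  apply/(@cvg_nbhsP _ R^o) => u u0.
  have <- : phi2 P (fun w => 0 * Z w 0 l) = 1.
    rewrite (_ : (fun w => _) = fun=> 0); last by apply/funext => w; rewrite mul0r.
    by rewrite /phi2 cos0 sin0 !Rintegral_prob_cst expr1n expr0n addr0.
  apply: phi2_cvg => //.
  - by move=> n; exact: measurable_funM.
  - exact: measurable_funM.
  - by apply: aeW => w; apply: cvgM => //; exact: cvg_cst.
have h2 : 0 < 2^-1 :> R by rewrite invr_gt0.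
have /cvgrPdist_lt/(_ _ h2)/nbhs_ballP[e/= e0 he] := c0.
exists (e / 2); first by rewrite divr_gt0.
move=> t te.
have phit : 2^-1 < phi2 P (fun w => t * Z w 0 l).
  have /he : ball (0 : R) e t by rewrite -ball_normE/= sub0r normrN; lra.
  by rewrite /= ltr_norml; lra.
have ln4 : 0 <= ln 4 :> R by rewrite ln_ge0//; lra.
apply: open_integral_le => //.
- apply/measurable_EFinP; apply: (measurableT_comp mK).
  by apply: measurable_funM.
- by move=> x _; rewrite lee_fin; case/andP: (K01 (t * f x)).
move=> p q ap pq qb.
have PF := ends_proper a b.
have c1 : phi2 P (fun w => t * (J x.1 x.2 w - g x.1 x.2) 0 l)
    @[x --> filter_prod (downto a) (upto b)] --> phi2 P (fun w => t * Z w 0 l).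
  have mJ x : measurable_fun setT (fun w => (J x.1 x.2 w - g x.1 x.2) 0 l).
    under eq_fun do rewrite !mxE.
    by apply: measurable_funB => //; exact: measurable_RV_coord.
  apply: phi2_cvg_prob.
  - by move=> x; exact: measurable_funM.
  - by apply: measurable_funM.
  apply: cvg_probability_scale => //.
  apply: (cvg_in_probability_coord (Y := fun x w => J x.1 x.2 w - g x.1 x.2)) => //.
  - move=> x k; under eq_fun do rewrite !mxE.
    by apply: measurable_funB => //; exact: measurable_RV_coord.
  - by move=> k; exact: measurable_RV_coord.
(* The limit exceeds one half, so nearby integrals have modulus above one
   quarter, whence the constant [ln 4]. *)
have h4 : 0 < 4^-1 :> R by rewrite invr_gt0.
have /cvgrPdist_lt/(_ _ h4) near1 := c1.
have near2 := ends_near ap qb.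
have [[x y] /= [h1 [ax xp yb qy]]] := filter_ex (filterI near1 near2).
have xy : x < y by rewrite (le_lt_trans xp)// (lt_le_trans pq).
have Jg : phi2 P (fun w => t * (J x y w - g x y) 0 l) = phi2 P (fun w => t * J x y w 0 l).
  rewrite -(@phi2_shift _ _ _ P (fun w => t * J x y w 0 l) (t * g x y 0 l)).
    by congr (phi2 P _); apply/funext => w; rewrite !mxE mulrBr.
  by apply: measurable_funM => //; exact: measurable_RV_coord.
have := phi2_integral_le t ax yb (JX ax xy yb).
rewrite -Jg => hle.
have q4 : 4^-1 < expR (- \int[leb]_(x in `]x, y]) K (t * f x)).
  by apply: lt_le_trans hle; move: h1 phit; rewrite ltr_norml; lra.
apply: (@le_trans _ _ (\int[leb]_(x in `]x, y]) (K (t * f x))%:E)%E).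
  apply: ge0_subset_integral => //.
  - by apply/measurable_EFinP; exact: mKf.
  - by move=> z _; rewrite lee_fin; case/andP: (K01 (t * f z)).
  - move=> z /=; rewrite !in_itv/= => /andP[z1 z2].
    by rewrite (le_lt_trans xp z1) (le_trans z2 qy).
rewrite -KE// lee_fin.
have -> : ln 4 = - ln 4^-1 :> R by rewrite lnV ?opprK// posrE.
rewrite lerNr -ler_expR lnK ?posrE//.
exact: ltW.
Qed.

(** Averaging the bound of [kappa_integral_bound] over an interval of
    arguments bounds the integral of [min (f ^ 2, 1)] times [sym_mass]. *)
Lemma coord_cst_or_integrable :
  (exists c : R, {ae P, forall w, X `]0, 1]%classic w 0 l = c}) \/
  (\int[leb]_(s in D) (Num.min (f s ^+ 2) 1)%:E < +oo)%E.
Proof.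
pose m := sym_mass P (Y `]0, 1]%classic).
have m0 : (0 <= m)%E by apply: integral_ge0 => z _; rewrite lee_fin le_min sqr_ge0 ler01.
have [meq|mne] := eqVneq m 0%E.
  by left; exact: (sym_mass0_cst (mY `]0, 1]%classic) meq).
right; rewrite ltey; apply/eqP => foo.
have [delta d0 hd] := kappa_integral_bound.
have mD : measurable (D : set (measurableTypeR R)) by exact: measurable_open.
pose h := f \_ D.
have mh : measurable_fun setT h by apply/(measurable_restrictT _ mD).
have K0 : K 0 = 0.
  rewrite /K /kappa /psi (_ : (fun w => 0 * _) = fun=> 0); last by apply/funext => w; rewrite mul0r.
  by rewrite /phi2 cos0 sin0 !Rintegral_prob_cst expr1n expr0n addr0 subrr.
pose F (z : R * measurableTypeR R) : \bar R := (K (delta * h z.2 * z.1))%:E.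
have F0 z : (0 <= F z)%E by rewrite lee_fin; case/andP: (K01 (delta * h z.2 * z.1)).
have mF : measurable_fun setT F.
  apply/measurable_EFinP; apply: (measurableT_comp mK); apply: measurable_funM => //.
  by apply: measurable_funM => //; apply: (measurableT_comp mh); exact: measurable_snd.
have Fub : (\int[@unif R]_v \int[leb]_x F (v, x) = \int[leb]_x \int[@unif R]_v F (v, x))%E.
  by rewrite (@fubini_tonelli _ _ _ _ _ (@unif R) leb F mF F0).
have inner v : (\int[leb]_x F (v, x) = \int[leb]_(x in D) (K (delta * v * f x))%:E)%E.
  rewrite [RHS]integral_mkcond; apply: eq_integral => x _.
  rewrite /F /h /= !patchE; case: ifP => _; first by rewrite mulrAC.
  by rewrite mulr0 mul0r K0.
have upper : (\int[@unif R]_v \int[leb]_x F (v, x) <= (ln 4)%:E)%E.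
  have mG : measurable_fun setT (fun v : R => \int[leb]_x F (v, x))%E.
    exact: (measurable_fun_fubini_tonelli_F (m2 := leb) F mF F0).
  have G0 v : (0 <= \int[leb]_x F (v, x))%E by apply: integral_ge0.
  have := integral_unif_shift 0 mG G0; under eq_integral do rewrite add0r.
  rewrite add0r => ->.
  have mI : measurable (`[0, 1[%classic : set (measurableTypeR R)) by exact: measurable_itv.
  apply: (@le_trans _ _ (\int[leb]_(x in `[0%R, 1%R[) (ln 4)%:E)%E).
    apply: ge0_le_integral => //.
    - exact: measurable_funTS.
    move=> v; rewrite inner /= in_itv/= => /andP[v0 v1]; apply: hd.
    by rewrite ger0_norm ?mulr_ge0 ?(ltW d0)// ler_piMr// ltW.
  rewrite integral_cst//; rewrite [X in (_ * X)%E](_ : _ = 1%E) ?mule1//.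
  transitivity (leb `[0%R, 1%R[%classic); first by [].
  by rewrite lebesgue_measure_itv/= lte_fin ltr01 sube0.
pose c : R := Num.min (delta ^+ 2) 1 / 10.
have c0 : 0 < c by rewrite divr_gt0// lt_min exprn_gt0//= ltr01.
have min0 (x : R) : 0 <= Num.min (x ^+ 2) 1 by rewrite le_min sqr_ge0 ler01.
have cm0 : (0 < c%:E * m)%E by rewrite mule_gt0// lt_neqAle eq_sym mne.
have mmin : measurable_fun D (fun x => (Num.min (f x ^+ 2) 1)%:E).
  by apply/measurable_EFinP; apply: measurable_minr => //; exact: measurable_funX.
have lower : (\int[leb]_(x in D) ((c%:E * m) * (Num.min (f x ^+ 2) 1)%:E) <=
    \int[leb]_x \int[@unif R]_v F (v, x))%E.
  rewrite integral_mkcond; apply: ge0_le_integral => //.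
  - by move=> x _; rewrite patchE; case: ifP => // _; rewrite mule_ge0 ?lee_fin// ltW.
  - by apply/(measurable_restrictT _ mD); exact: measurable_funeM.
  - exact: (measurable_fun_fubini_tonelli_G (m1 := @unif R) F mF F0).
  move=> x _; rewrite patchE; case: ifPn => xD; last by apply: integral_ge0.
  have := avg_one_minus_phi2 P (mY `]0, 1]%classic) (delta * f x).
  rewrite -/m => hav.
  apply: (@le_trans _ _ ((Num.min ((delta * f x) ^+ 2) 1 / 10)%:E * m)%E).
    rewrite muleAC -EFinM; apply: lee_wpmul2r => //; rewrite lee_fin /c mulrAC.
    rewrite ler_pM2r ?invr_gt0// exprMn le_min; apply/andP; split.
      by apply: ler_pM => //; rewrite ge_min lexx.
    by apply: mulr_ile1 => //; rewrite ge_min lexx orbT.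
  apply: (le_trans hav); rewrite le_eqVlt; apply/orP; left; apply/eqP.
  by apply: eq_integral => v _; rewrite /F /h /= patchE xD.
rewrite -Fub in lower; have := le_trans lower upper => bnd.
have : (+oo <= (ln 4)%:E :> \bar R)%E.
  rewrite ge0_integralZl// in bnd; first by rewrite foo gt0_muley in bnd.
  - by move=> x _; rewrite lee_fin.
  - exact: ltW.
by rewrite leye_eq.
Qed.

End essential_convergence.

(** * Degenerate laws *)

Section almost_sure.
Context {R : realType} {d : measure_display} {T : measurableType d}
  (P : probability T R).

Lemma ae_probability1 (A : set T) : measurable A -> {ae P, forall w, A w} ->
  P A = 1%E.
Proof.
move=> mA nA; have : P (~` A) = 0%E by apply: measure_negligible => //; exact: measurableC.
rewrite probability_setC// => /eqP; rewrite sube_eq ?fin_num_measure//.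
by rewrite add0e => /eqP <-.
Qed.

Lemma ae_exists (A : set T) : {ae P, forall w, A w} -> exists w, A w.
Proof.
move=> [N [mN N0 HN]]; apply: contrapT => nex.
have NT : N = setT by apply/seteqP; split => // w _; apply: HN => Aw; apply: nex; exists w.
have : P setT = 1%E by exact: probability_setT.
by rewrite -NT N0 => /eqP; rewrite eq_sym onee_eq0.
Qed.

Lemma distribution_cst {d' : nat} (Y : {RV P >-> 'rV[R]_d'}) (v : 'rV[R]_d') :
  {ae P, forall w, Y w = v} ->
  forall A, measurable A -> distribution P Y A = \d_v A.
Proof.
move=> Yv A mA; have mYA : measurable (Y @^-1` A) by rewrite -[X in measurable X]setTI; exact: measurable_funP.
rewrite diracE; case: (boolP (v \in A)) => vA.
  apply: (ae_probability1 mYA); move: Yv; apply: filterS => w /= ->; exact: set_mem.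
have mC : measurable (~` (Y @^-1` A)) by exact: measurableC.
have : P (~` (Y @^-1` A)) = 1%E.
  apply: (ae_probability1 mC); move: Yv; apply: filterS => w /= ->.
  by move=> Av; move: vA; rewrite mem_set.
rewrite probability_setC// => /eqP; rewrite sube_eq ?fin_num_measure// => /eqP h.
rewrite /distribution /pushforward; move: h; case: (P _) (fin_num_measure P _ mYA) => // r _.
by rewrite -EFinD => -[] /eqP; rewrite -subr_eq0 opprD addNKr oppr_eq0 => /eqP ->.
Qed.

End almost_sure.

Section domain_of_delta.
Context {R : realType} {d : nat}.
Variables (a b : \bar R) (f : R -> R).
Local Notation D := [set s : R | (a < s%:E < b)%E].
Hypothesis ab : (a < b)%E.
Hypothesis mf : measurable_fun D f.
Local Notation leb := (@lebesgue_measure R).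

(** Each coordinate of the unit value is constant by
    [coord_cst_or_integrable]. *)
Lemma essential_domain_sub_delta :
  (\int[leb]_(s in D) (Num.min (f s ^+ 2) 1)%:E = +oo)%E ->
  essential_domain d a b f `<=` delta_distributions d.
Proof.
move=> foo mu [] _ [] dO [] Omega [] P [] X [] rmX _ [] g [] J [] Z [] hJ hZ.
have cst l : exists c : R, {ae P, forall w, X `]0, 1]%classic w 0 l = c}.
  by have [//|] := coord_cst_or_integrable rmX l ab mf hJ hZ; rewrite foo.
have [c hc] := @choice _ _ (fun l c => {ae P, forall w, X `]0, 1]%classic w 0 l = c}) cst.
pose v : 'rV[R]_d := \row_l c l.
exists v => A mA; have [_ _ _ _ h] := rmX.
rewrite -(h 0 A mA) add0r; apply: distribution_cst => //.
have : {ae P, forall w, forall l, X `]0, 1]%classic w 0 l = c l} by exact: filter_forall.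
apply: filterS => w hw.
by apply/rowP => l; rewrite mxE hw.
Qed.

(** When the unit value is constant all symmetrized values vanish, so that
    every value is a constant; the constants form an additive shift-invariant
    set function. *)
Lemma degenerate_coord {dO : measure_display} {Omega : measurableType dO}
    {P : probability Omega R} {mu : probability 'rV[R]_d R}
    {X : set R -> {RV P >-> 'rV[R]_d}} (v : 'rV[R]_d) (l : 'I_d) :
  is_random_measure mu X -> (forall A, measurable A -> mu A = \d_v A) ->
  forall B, bounded_borel B ->
  {ae P, forall w, X B w 0 l = v 0 l * fine (leb B)}.
Proof.
move=> rmX muv.
pose Y (B : set R) w := X B w 0 l.
have mY B : measurable_fun setT (Y B) by exact: measurable_RV_coord.
have mX (B : set R) (A : set 'rV[R]_d) : measurable A -> measurable (X B @^-1` A).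
  by move=> mA; rewrite -[X in measurable X]setTI; exact: measurable_funP.
have mpt (c : R) : measurable [set u : 'rV[R]_d | u 0 l = c].
  have := @measurable_coord R d l measurableT [set c] (measurable_set1 c).
  by rewrite setTI.
have Y1 : {ae P, forall w, Y `]0, 1]%classic w = v 0 l}.
  have [_ _ _ _ /(_ 0 _ (mpt (v 0 l)))] := rmX.
  rewrite add0r muv// diracE mem_set// => h.
  exists (~` (X `]0, 1]%classic @^-1` [set u : 'rV[R]_d | u 0 l = v 0 l])); split.
  - by apply: measurableC; apply: mX.
  - rewrite probability_setC; last exact: mX.
    by rewrite [X in (1 - X)%E](_ : _ = 1%E) ?subee.
  - by move=> w /=.
have psi1 t : psi P Y t `]0, 1]%classic = 1.
  rewrite /psi (@phi2_ae_eq _ _ _ P _ (fun=> t * v 0 l)).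
  - by rewrite /phi2 !Rintegral_prob_cst cos2Dsin2.
  - exact: measurable_funM.
  - exact: measurable_cst.
  - by move: Y1; apply: filterS => w ->.
have psiB t B : bounded_borel B -> psi P Y t B = 1.
  move=> bB; have := psi_exp mY (coord_sigma_additive rmX l)
    (coord_independent rmX l) (coord_shift rmX l) t bB.
  by rewrite psi1 ln1 mulr0 expR0.
have cstB B : bounded_borel B -> exists c : R, {ae P, forall w, Y B w = c}.
  move=> bB; apply: (sym_mass0_cst (mY B)).
  have := avg_one_minus_phi2 P (mY B) 1.
  rewrite (eq_integral (fun=> 0%E)) ?integral0; last first.
    by move=> u _; rewrite mul1r; have := psiB u B bB; rewrite /psi => ->; rewrite subrr.
  move=> h; apply/eqP; rewrite eq_le; apply/andP; split; last first.
    by apply: integral_ge0 => z _; rewrite lee_fin le_min sqr_ge0 ler01.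
  move: h; rewrite expr1n minxx.
  by rewrite pmule_rle0// lte_fin divr_gt0.
have [F hF] : exists F : set R -> R, forall B, bounded_borel B ->
    {ae P, forall w, Y B w = F B}.
  have /choice[F hF] : forall B : set R, exists c : R, bounded_borel B ->
      {ae P, forall w, Y B w = c}.
    move=> B; have [bB|nB] := pselect (bounded_borel B).
      by have [c hc] := cstB B bB; exists c.
    by exists 0.
  by exists F.
have FE B : bounded_borel B -> F B = F `]0, 1]%classic * fine (leb B).
  move=> bB; apply: additive_shift_invariantE => //.
    move=> S bS tS bU.
    have bU' : bounded_borel (\bigcup_n S n).
      by split => //; apply: bigcup_measurable => n _; case: (bS n).
    have a1 := coord_sigma_additive rmX l bS tS bU.
    have a2 := hF _ bU'.
    have a3 : {ae P, forall w, forall n, Y (S n) w = F (S n)}.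
      by apply: ae_foralln => n; exact: hF.
    have [w [[w1 w2] w3]] := ae_exists (filterI (filterI a1 a2) a3).
    move: w1; rewrite -[X in _ --> X -> _]/(Y (\bigcup_n S n) w) w2.
    have E n : \sum_(i < n) X (S i) w 0 l = \sum_(i < n) F (S i).
      by apply: eq_bigr => i _; exact: w3.
    by under eq_fun do rewrite E.
  move=> S t bS; have [_ _ _ sh _] := rmX.
  have bSt := bounded_borel_shift t bS.
  have h1 : P (X S @^-1` [set u : 'rV[R]_d | u 0 l = F S]) = 1%E.
    by apply: ae_probability1; [exact: mX|exact: hF].
  have h2 : P (X [set s + t | s in S] @^-1` [set u : 'rV[R]_d | u 0 l = F S]) = 1%E.
    by rewrite -h1; exact: (sh S t bS _ (mpt _)).
  have h3 : {ae P, forall w, Y [set s + t | s in S] w = F S}.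
    exists (~` (X [set s + t | s in S] @^-1` [set u : 'rV[R]_d | u 0 l = F S])); split.
    - by apply: measurableC; apply: mX.
    - rewrite probability_setC; last exact: mX.
      by rewrite h2 subee.
    - by move=> w /=.
  have [w [w1 w2]] := ae_exists (filterI h3 (hF _ bSt)).
  by rewrite -w1 -w2.
move=> B bB; have := hF B bB; apply: filterS => w; rewrite /Y => ->.
have bI : bounded_borel (`]0, 1]%classic : set R) by exact: bounded_borel_itv.
have [u [u1 u2]] := ae_exists (filterI Y1 (hF _ bI)).
by rewrite FE// -u1 u2.
Qed.

End domain_of_delta.

(** * Local integrability *)

Section simple_approximation.
Context {R : realType} {d : measure_display} {T : measurableType d}.
Import HBSimple HBNNSimple.

(** Increasing approximations of the positive and of the negative part stay
    below these parts, which keeps their difference dominated by the limit. *)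
Lemma simple_approximation (D : set T) (f : T -> R) :
  measurable D -> measurable_fun D f ->
  exists g : {sfun T >-> R}^nat,
    (forall x, D x -> g n x @[n --> \oo] --> f x) /\
    (forall n x, D x -> `|g n x| <= `|f x|).
Proof.
move=> mD mf.
have mp : measurable_fun D (EFin \o f^\+) by apply/measurable_EFinP; exact: measurable_funrpos.
have mn : measurable_fun D (EFin \o f^\-) by apply/measurable_EFinP; exact: measurable_funrneg.
pose u := nnsfun_approx mD mp; pose v := nnsfun_approx mD mn.
have cvg_le (h : T -> R) (mh : measurable_fun D (EFin \o h)) x : (forall y, 0 <= h y) -> D x ->
    nnsfun_approx mD mh n x @[n --> \oo] --> h x /\
    forall n, 0 <= nnsfun_approx mD mh n x <= h x.
  move=> h0 Dx; have c := @cvg_nnsfun_approx _ _ _ _ mD _ mh (fun y _ => h0 y) x Dx.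
  have {}c : nnsfun_approx mD mh n x @[n --> \oo] --> h x by apply: (fine_cvg c).
  split => // n; rewrite fun_ge0/=.
  have nd : nondecreasing_seq (fun n => nnsfun_approx mD mh n x).
    by move=> m k mk; exact/lefP/nd_nnsfun_approx.
  by have := nondecreasing_cvgn_le nd (cvgP _ c) n; rewrite (cvg_lim _ c).
exists (fun n => u n \+ cst (-1) \* v n).
have pos0 y : 0 <= f^\+ y by exact: funrpos_ge0.
have neg0 y : 0 <= f^\- y by exact: funrneg_ge0.
have E n x : (u n \+ cst (-1) \* v n) x = u n x - v n x by rewrite /= mulN1r.
split => [x Dx|n x Dx].
  have [cu _] := cvg_le _ mp x pos0 Dx; have [cv _] := cvg_le _ mn x neg0 Dx.
  have EE : (fun n => (u n \+ cst (-1) \* v n) x) = (fun n => u n x - v n x) by apply/funext => n; exact: E.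
  rewrite [X in X @ _ --> _](_ : _ = (fun n => u n x - v n x))//.
  rewrite (_ : f x = f^\+ x - f^\- x); first exact: cvgB.
  by have := congr1 (fun h => h x) (funrposBneg f) => /= <-.
rewrite [X in `|X| <= _](_ : _ = u n x - v n x); last exact: E.
have [_ /(_ n) hu] := cvg_le _ mp x pos0 Dx; have [_ /(_ n) hv] := cvg_le _ mn x neg0 Dx.
have -> : `|f x| = f^\+ x + f^\- x by have := congr1 (fun h => h x) (funrposDneg f).
by rewrite ler_norml; move: hu hv; rewrite -/u -/v; lra.
Qed.

End simple_approximation.

Section random_variable.
Context {R : realType} {dO dV : measure_display} {Omega : measurableType dO}
  {V : measurableType dV} (P : probability Omega R).

Definition mkRV (h : Omega -> V) (mh : measurable_fun setT h) : {RV P >-> V} :=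
  HB.pack_for {mfun Omega >-> V} h (isMeasurableFun.Build _ _ _ _ h mh).

Definition cstRV (v : V) : {RV P >-> V} := mkRV (measurable_cst v).

Lemma cstRVE v w : cstRV v w = v.
Proof. by []. Qed.

End random_variable.

Section deterministic_limits.
Context {R : realType} {d : measure_display} {T : measurableType d}
  (P : probability T R).

(** Two terms that are close to the limit with large probability are close to
    each other at some common sample point. *)
Lemma cvg_probability_bounded (Y : nat -> T -> R) (Z : T -> R) (s : nat -> R) :
  (forall n, measurable_fun setT (Y n)) -> measurable_fun setT Z ->
  (forall n, {ae P, forall w, Y n w = s n}) ->
  (forall e : R, 0 < e -> P [set w | (e <= `|Y n w - Z w|)%R] @[n --> \oo] --> 0%E) ->
  exists M : R, \forall n \near \oo, `|s n| <= M.
Proof.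
move=> mY mZ Ys h.
have mS n : measurable [set w | 1 <= `|Y n w - Z w|] by exact: measurable_ge_dist.
have e4 : 0 < 4^-1 :> R by rewrite invr_gt0.
have /(cvg_probability0 P mS)/(_ _ e4)[N _ hN] := h _ ltr01.
exists (`|s N| + 2); exists N => // n Nn.
pose A k := [set w | 1 <= `|Y k w - Z w|].
have [w [nA wn wN]] : exists w, [/\ ~ (A n `|` A N) w, Y n w = s n & Y N w = s N].
  apply: contrapT => nex.
  have mU : measurable (A n `|` A N) by apply: measurableU; exact: mS.
  have : P (A n `|` A N) = 1%E.
    apply: ae_probability1 => //; have := Ys n; have := Ys N.
    apply: filterS2 => w wN wn; apply: contrapT => nA; apply: nex.
    by exists w.
  have : (P (A n `|` A N) <= P (A n) + P (A N))%E by apply: measureU2; exact: mS.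
  move=> + E; rewrite E => /le_trans/(_ (leeD (hN n Nn) (hN N (leqnn N)))).
  by rewrite -EFinD lee_fin; lra.
have [n1 N1] : ~ (1 <= `|Y n w - Z w|) /\ ~ (1 <= `|Y N w - Z w|).
  by split => ?; apply: nA; [left|right].
move: n1 N1; rewrite wn wN => /negP; rewrite -ltNge => n1 /negP; rewrite -ltNge => N1.
have -> : s n = (s n - Z w) - (s N - Z w) + s N by rewrite opprB addrA subrK subrK.
have := ler_normD ((s n - Z w) - (s N - Z w)) (s N).
have := ler_normB (s n - Z w) (s N - Z w).
rewrite /=; lra.
Qed.

End deterministic_limits.

Section degenerate_integrability.
Context {R : realType} {d : nat}.
Variables (a b : \bar R) (f : R -> R).
Local Notation D := [set s : R | (a < s%:E < b)%E].
Hypothesis mf : measurable_fun D f.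
Local Notation leb := (@lebesgue_measure R).
Import HBSimple.

(** For a deterministic random measure the simple integrals are Lebesgue
    integrals; their boundedness over all Borel subsets of a compact interval
    forces integrability. *)
Lemma degenerate_locally_integrable {dO : measure_display}
    {Omega : measurableType dO} {P : probability Omega R}
    {mu : probability 'rV[R]_d R} {X : set R -> {RV P >-> 'rV[R]_d}}
    (v : 'rV[R]_d) (l : 'I_d) :
  is_random_measure mu X -> (forall A, measurable A -> mu A = \d_v A) ->
  v 0 l = 1 -> locally_X_integrable a b X f -> locally_integrable_on a b f.
Proof.
move=> rmX muv vl [fn [fnf cfn]] p q ap pq qb.
have mI : measurable (`[p, q]%classic : set (measurableTypeR R)) by exact: measurable_itv.
have IS : `[p, q]%classic `<=` D by exact: itv_sub_open.
have mfI : measurable_fun (`[p, q]%classic : set (measurableTypeR R)) f.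
  exact: (measurable_funS (measurable_open a b) IS mf).
have mgI n : measurable_fun (`[p, q]%classic : set (measurableTypeR R)) (fn n).
  exact: measurable_funTS (measurable_funP (fn n)).
have finI : (leb `[p, q]%classic < +oo)%E.
  by apply: lebesgue_bounded_borel_lty; exact: bounded_borel_itv.
have bnd n : exists M, forall x, (`[p, q]%classic : set (measurableTypeR R)) x -> `|fn n x| <= M.
  have fr : finite_set (range (fn n)) by exact: fimfunP.
  exists (\sum_(r <- finmap.enum_fset (fset_set (range (fn n)))) `|r|) => x _.
  have hs : fn n x \in finmap.enum_fset (fset_set (range (fn n))).
    by have := in_fset_set fr (fn n x); rewrite [RHS]mem_set//; exists x.
  by rewrite (bigD1_seq _ hs)/= ?finmap.fset_uniq// lerDl sumr_ge0.
have cvgI : {ae leb, forall x, (`[p, q]%classic : set (measurableTypeR R)) x -> fn n x @[n --> \oo] --> f x}.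
  move: fnf; apply: (@filterS _ _ (ae_filter_ringOfSetsType leb)) => x fx xI.
  exact/fx/IS.
have HB B : measurable B -> B `<=` `[p, q]%classic -> exists M : R,
    \forall n \near \oo, `|\int[leb]_(x in B) fn n x| <= M.
  move=> mB BI; have iB : inner_borel a b B by exact: inner_borel_sub mB BI.
  have bB := inner_bounded_borel iB.
  have [Z hZ] := cfn B iB.
  apply: (@cvg_probability_bounded _ _ _ P
    (fun n w => simple_integral X (fn n) B w 0 l) (fun w => Z w 0 l)).
  - by move=> n; exact: measurable_simple_integral_coord.
  - exact: measurable_RV_coord.
  - move=> n; have : {ae P, forall w, forall r, r \in finmap.enum_fset (fset_set (range (fn n))) ->
        X (B `&` fn n @^-1` [set r]) w 0 l = fine (leb (B `&` fn n @^-1` [set r]))}.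
      elim: (finmap.enum_fset _) => [|r s IH]; first by apply: aeW => w r; rewrite in_nil.
      have mr : measurable (fn n @^-1` [set r]) by exact: measurable_funPTI.
      have br : bounded_borel (B `&` fn n @^-1` [set r]).
        by apply: (bounded_borelS _ _ bB); [exact: measurableI|move=> x []].
      have := degenerate_coord l rmX muv br.
      move: IH; apply: filterS2 => w h1 h2 r'; rewrite in_cons => /predU1P[->|]; last exact: h1.
      by rewrite h2 vl mul1r.
    apply: filterS => w h; rewrite simple_integral_coord fsbig_finite//=.
    rewrite (Rintegral_simple (fn n) id bB) big_seq [RHS]big_seq.
    by apply: eq_bigr => r rs; rewrite h.
  - apply: cvg_in_probability_coord => //.
    + by move=> n k; exact: measurable_simple_integral_coord.
    + by move=> k; exact: measurable_RV_coord.
have pos := gliding_hump mI finI mgI mfI bnd cvgI HB.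
have mgN n : measurable_fun (`[p, q]%classic : set (measurableTypeR R)) (fun x => - fn n x).
  exact: measurable_funN (mgI n).
have mfN : measurable_fun (`[p, q]%classic : set (measurableTypeR R)) (fun x => - f x).
  exact: measurable_funN mfI.
have neg : (\int[leb]_(x in `[p, q]) ((fun x => - f x)^\+ x)%:E < +oo)%E.
  apply: (gliding_hump mI finI mgN mfN).
  - by move=> n; have [M HM] := bnd n; exists M => x /HM; rewrite normrN.
  - move: cvgI; apply: (@filterS _ _ (ae_filter_ringOfSetsType leb)) => x fx xI.
    exact: (@cvgN _ R^o _ _ _ _ _ (fx xI)).
  - move=> B mB BI; have [M hM] := HB B mB BI; exists M; move: hM.
    apply: filterS => n; under [X in _ -> is_true (`|X| <= _)]eq_Rintegral do rewrite -mulN1r.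
    rewrite RintegralZl ?mulN1r ?normrN//.
    have bB : bounded_borel B by apply: (bounded_borelS mB BI); exact: bounded_borel_itv.
    have [M' HM'] := bnd n; apply: (@bounded_borel_integrable _ _ _ M') => //.
      exact: (measurable_funS mI BI (mgI n)).
    by move=> x /BI; exact: HM'.
have mpos : measurable_fun (`[p, q]%classic : set (measurableTypeR R)) (fun x => (f^\+ x)%:E).
  by apply/measurable_EFinP; exact: measurable_funrpos.
have mneg : measurable_fun (`[p, q]%classic : set (measurableTypeR R)) (fun x => ((fun x => - f x)^\+ x)%:E).
  by apply/measurable_EFinP; exact: measurable_funrpos.
have -> : (\int[leb]_(s in `[p, q]) `|f s|%:E =
    \int[leb]_(s in `[p, q]) ((f^\+ s)%:E + ((fun x => - f x)^\+ s)%:E))%E.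
  apply: eq_integral => x _; rewrite -EFinD; congr EFin.
  have -> : (fun x => - f x)^\+ x = f^\- x by [].
  by have := congr1 (fun h => h x) (funrposDneg f).
rewrite ge0_integralD//; first exact: lte_add_pinfty.
- by move=> x _; rewrite lee_fin funrpos_ge0.
- by move=> x _; rewrite lee_fin funrpos_ge0.
Qed.

End degenerate_integrability.

(** * Infinite divisibility *)

Section random_measure_additivity.
Context {R : realType} {d : nat} {dO : measure_display}
  {Omega : measurableType dO} {P : probability Omega R}.
Context {mu : probability 'rV[R]_d R} {X : set R -> {RV P >-> 'rV[R]_d}}.
Hypothesis rmX : is_random_measure mu X.

Lemma random_measure_set0 : {ae P, forall w, X set0 w = 0}.
Proof.
have h l : {ae P, forall w, X set0 w 0 l = 0}.
  exact: (Y_set0 (Y := fun B w => X B w 0 l) (coord_sigma_additive rmX l)).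
have : {ae P, forall w, forall l, X set0 w 0 l = 0} by exact: filter_forall.
by apply: filterS => w hw; apply/rowP => l; rewrite hw mxE.
Qed.

Lemma random_measure_setU A B : bounded_borel A -> bounded_borel B ->
  A `&` B = set0 -> {ae P, forall w, X (A `|` B) w = X A w + X B w}.
Proof.
move=> bA bB AB; have h l : {ae P, forall w, X (A `|` B) w 0 l = X A w 0 l + X B w 0 l}.
  exact: (Y_setU (Y := fun B w => X B w 0 l) (coord_sigma_additive rmX l) bA bB AB).
have : {ae P, forall w, forall l, X (A `|` B) w 0 l = X A w 0 l + X B w 0 l}.
  exact: filter_forall.
by apply: filterS => w hw; apply/rowP => l; rewrite hw mxE.
Qed.

Let mpre (Y : {RV P >-> 'rV[R]_d}) (A : set 'rV[R]_d) : measurable A ->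
  measurable (Y @^-1` A).
Proof. by move=> mA; rewrite -[X in measurable X]setTI; exact: measurable_funP. Qed.

Lemma distribution_ae_eq (Y Z : {RV P >-> 'rV[R]_d}) (A : set 'rV[R]_d) :
  {ae P, forall w, Y w = Z w} -> measurable A ->
  distribution P Y A = distribution P Z A.
Proof.
move=> YZ mA; have h (U V : {RV P >-> 'rV[R]_d}) : {ae P, forall w, U w = V w} ->
    (distribution P U A <= distribution P V A)%E.
  move=> [N [mN N0 HN]]; rewrite /distribution /pushforward.
  apply: (@le_trans _ _ (P (V @^-1` A `|` N))).
    apply: le_measure; rewrite ?inE; [exact: mpre|apply: measurableU => //; exact: mpre|].
    move=> w Aw; have [E|nE] := pselect (U w = V w); first by left; rewrite /preimage/= -E.
    by right; exact: HN.
  have := measureU2 P (mpre V mA) mN.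
  by rewrite [X in (_ <= _ + X)%E](_ : _ = 0%E) ?adde0.
apply/eqP; rewrite eq_le !h//.
by move: YZ; apply: filterS => w ->.
Qed.

(** The convolution formula: the law of an independent pair is a product
    measure. *)
Lemma distribution_sum_independent (W V : {RV P >-> 'rV[R]_d})
    (nu : probability 'rV[R]_d R) :
  (forall A B, measurable A -> measurable B ->
     P (W @^-1` A `&` V @^-1` B) = (nu A * distribution P V B)%E) ->
  forall A, measurable A ->
  P [set w | A (W w + V w)] = (\int[nu]_x distribution P V [set y | A (x + y)%R])%E.
Proof.
move=> ind A mA.
pose WV (w : Omega) : 'rV[R]_d * 'rV[R]_d := (W w, V w).
have mWV : measurable_fun setT WV by apply/measurable_fun_pairP; split; exact: measurable_funP.
pose S := [set z : 'rV[R]_d * 'rV[R]_d | A (z.1 + z.2)].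
have madd : measurable_fun setT (fun z : 'rV[R]_d * 'rV[R]_d => z.1 + z.2).
  apply: measurable_rV => l; under eq_fun do rewrite mxE.
  by apply: measurable_funD; apply: (measurableT_comp (@measurable_coord R d l)).
have mS : measurable S by rewrite -[S]setTI; exact: madd.
have := @product_measure_unique _ _ _ _ _ nu (distribution P V) (image_measure P mWV).
move=> /(_ _ S mS) H; transitivity ((nu \x distribution P V)%E S).
  by apply: esym; apply: H => B C mB mC; exact: ind.
rewrite /product_measure1; apply: eq_integral => x _; congr (distribution P V _).
by apply/seteqP; split => y /=; rewrite /xsection/= inE.
Qed.

(** The values on the intervals of length [1 / n] are independent with a
    common law, and add up to the value on the unit interval. *)
Lemma random_measure_infinitely_divisible : infinitely_divisible mu.
Proof.
move=> n n0; have [_ ind _ sh law1] := rmX.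
pose h : R := n%:R^-1.
have h0 : 0 < h by rewrite invr_gt0 ltr0n.
pose I k : set R := `]0, k%:R * h]%classic.
pose nu : probability 'rV[R]_d R := distribution P (X (I 1%N)).
exists nu.
suff H k A : measurable A -> convolution_power nu k A = distribution P (X (I k)) A.
  move=> A mA; rewrite H// -(law1 0 A mA) add0r.
  by rewrite /I divff// pnatr_eq0 -lt0n.
elim: k A => [|k IH] A mA.
  rewrite /= -(distribution_cst random_measure_set0)//.
  by rewrite /I mul0r set_itvoc0.
pose B k : set R := `]k%:R * h, k.+1%:R * h]%classic.
have bI m : bounded_borel (I m) by exact: bounded_borel_itv.
have bB : bounded_borel (B k) by exact: bounded_borel_itv.
have kh : 0 <= k%:R * h by rewrite mulr_ge0// ltW.
have kk : k%:R * h <= k.+1%:R * h by rewrite ler_wpM2r ?ler_nat// ltW.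
have BI0 : B k `&` I k = set0.
  rewrite -subset0 => x [] /=; rewrite /B /I/= !in_itv/= => /andP[h1 _] /andP[_ h2].
  by have := lt_le_trans h1 h2; rewrite ltxx.
have IU : I k.+1 = B k `|` I k.
  apply/seteqP; split => x; rewrite /B /I/= !in_itv/=.
    by move=> /andP[x0 xk]; case: (leP x (k%:R * h)) => ?; [right|left]; apply/andP.
  by case=> /andP[x1 x2]; apply/andP; split => //; [exact: le_lt_trans kh x1|exact: le_trans x2 kk].
have lawB C : measurable C -> distribution P (X (B k)) C = nu C.
  move=> mC; transitivity (distribution P (X [set s + k%:R * h | s in I 1%N]) C).
    2: exact: (sh (I 1%N) (k%:R * h) (bI 1%N) C mC).
  congr (distribution P (X _) C); rewrite shift_preimage /B /I.
  by apply/seteqP; split => x /=; rewrite !in_itv/= -natr1 mulrDl !mul1r; lra.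
rewrite [LHS]/=.
have mtr x : measurable [set y | A (x + y)].
  have : measurable_fun setT (fun y : 'rV[R]_d => x + y).
    apply: measurable_rV => l; under eq_fun do rewrite mxE.
    by apply: measurable_funD => //; exact: measurable_coord.
  by move=> /(_ measurableT A mA); rewrite setTI.
under eq_integral do rewrite IH//.
rewrite -(@distribution_sum_independent (X (B k)) (X (I k)) nu)//.
  rewrite IU; have := random_measure_setU bB (bI k) BI0 => hU.
  have mS : measurable_fun setT (fun w => X (B k) w + X (I k) w).
    apply: measurable_rV => l; under eq_fun do rewrite mxE.
    by apply: measurable_funD; exact: measurable_RV_coord.
  exact: (esym (@distribution_ae_eq (X (B k `|` I k)) (mkRV P mS) A hU mA)).
move=> C1 C2 mC1 mC2; rewrite -lawB//.
pose BB (i : 'I_2) := bigcup2 (B k) (I k) i.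
have bBB i : bounded_borel (BB i).
  by rewrite /BB; case: i => -[|[|m]] //= _; exact: bI.
have tBB : trivIset setT BB.
  have : trivIset setT (bigcup2 (B k) (I k)) by rewrite -trivIset_bigcup2.
  by move/trivIsetP => t; apply/trivIsetP => i j _ _ ij; exact: t.
pose CC (i : 'I_2) := bigcup2 C1 C2 i.
have mCC i : measurable (CC i) by rewrite /CC; case: i => -[|[|m]].
have := ind 2 BB bBB tBB CC mCC; rewrite !big_ord_recl big_ord0 mule1/= => <-.
congr (P _); apply/seteqP; split => w.
  by move=> [h1 h2] [[|[|]]].
by move=> hh; split; [exact: (hh ord0)|exact: (hh (lift ord0 ord0))].
Qed.

End random_measure_additivity.

(** * Degenerate laws belong to the domain *)

Section degenerate_domain.
Context {R : realType} {d : nat}.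
Variables (a b : \bar R) (f : R -> R).
Local Notation D := [set s : R | (a < s%:E < b)%E].
Hypothesis mf : measurable_fun D f.
Local Notation leb := (@lebesgue_measure R).
Local Notation U := (@unif R).
Import HBSimple.

Lemma cvg_in_probability_cst {I : Type} (F : set_system I) {FF : Filter F}
    {dO : measure_display} {Omega : measurableType dO} (P : probability Omega R)
    (u : I -> 'rV[R]_d) (u0 : 'rV[R]_d) :
  u i @[i --> F] --> u0 ->
  cvg_in_probability P F (fun i (_ : Omega) => u i) (fun=> u0).
Proof.
move=> uu e e0.
have mS i : measurable [set w : Omega | e <= `|u i - u0|].
  have [h|h] := pselect (e <= `|u i - u0|).
    by rewrite (_ : [set w | _] = setT)//; apply/seteqP; split.
  by rewrite (_ : [set w | _] = set0)//; apply/seteqP; split.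
apply/(cvg_probability0 P mS) => r r0.
have /cvgrPdist_lt/(_ _ e0) := uu; apply: filterS => i hi.
have -> : [set w : Omega | e <= `|u i - u0|] = set0.
  by apply/seteqP; split => // w /=; rewrite distrC leNgt hi.
by rewrite measure0 lee_fin ltW.
Qed.

Variable v : 'rV[R]_d.

Let X (B : set R) : {RV U >-> 'rV[R]_d} := cstRV U (fine (leb B) *: v).

Let XE B w : X B w = fine (leb B) *: v. Proof. by []. Qed.

(** Constants are independent of each other, so that only properties of
    Lebesgue measure remain. *)
Lemma degenerate_random_measure (mu : probability 'rV[R]_d R) :
  (forall A, measurable A -> mu A = \d_v A) -> is_random_measure mu X.
Proof.
move=> muv; split.
- move=> B bB tB bU.
  have bU' : bounded_borel (\bigcup_n B n).
    by split => //; apply: bigcup_measurable => n _; case: (bB n).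
  have fin n : leb (B n) \is a fin_num by exact: lebesgue_bounded_borel_fin.
  have c : \sum_(i < n) fine (leb (B i)) @[n --> \oo] --> fine (leb (\bigcup_n B n)).
    have mB n : measurable (B n : set (measurableTypeR R)) by case: (bB n).
    have mU : measurable (\bigcup_n B n : set (measurableTypeR R)) by exact: bigcup_measurable.
    have := @measure_semi_sigma_additive _ _ _ leb B mB tB mU.
    have E n : (\sum_(0 <= i < n) leb (B i))%E = (\sum_(i < n) fine (leb (B i)))%:E.
      by rewrite big_mkord -sumEFin; apply: eq_bigr => i _; rewrite fineK.
    under eq_fun do rewrite E.
    move=> h; have h2 : (\sum_(i < n) fine (leb (B i)))%:E @[n --> \oo] -->
        (fine (leb (\bigcup_n B n)))%:E.
      by rewrite fineK//; exact: lebesgue_bounded_borel_fin.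
    by move/fine_cvgP : h2 => [].
  apply: aeW => w.
  rewrite [X in X @ _ --> _](_ : _ = (fun n => (\sum_(i < n) fine (leb (B i))) *: v)).
    by apply: cvgZr_tmp.
  by apply/funext => n; rewrite scaler_suml; apply: eq_bigr.
- move=> n B bB tB A mA.
  have [h|] := pselect (forall i, A i (fine (leb (B i)) *: v)).
    rewrite (_ : \bigcap_(i in _) _ = setT); last first.
      by apply/seteqP; split => // w _ i _; exact: h.
    rewrite probability_setT big1// => i _.
    rewrite (_ : _ @^-1` _ = setT) ?probability_setT//.
    by apply/seteqP; split => // w _; exact: h.
  move=> /existsNP[i hi].
  rewrite (_ : \bigcap_(i in _) _ = set0); last first.
    by apply/seteqP; split => // w /(_ i Logic.I).
  rewrite measure0 (bigD1 i)//= (_ : _ @^-1` _ = set0) ?measure0 ?mul0e//.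
  by apply/seteqP; split.
- move=> t; apply: aeW => w; rewrite XE.
  by rewrite [leb _](_ : _ = 0%E) ?scale0r//; exact: lebesgue_measure_set1.
- move=> B t [mB _] A mA; have E : leb [set s + t | s in B] = leb B by exact: lebesgue_measure_shift.
  by rewrite /X E.
- move=> t A mA; rewrite muv//; apply: distribution_cst => //; apply: aeW => w.
  rewrite XE; have -> : fine (leb `]t, t + 1]%classic) = 1.
    have := @lebesgue_itvoc R t (t + 1) ltac:(lra) => ->/=; lra.
  by rewrite scale1r.
Qed.

Lemma degenerate_simple_integral (h : {sfun R >-> R}) B w : bounded_borel B ->
  simple_integral X h B w = (\int[leb]_(x in B) h x) *: v.
Proof.
move=> bB; rewrite (Rintegral_simple h id bB) /simple_integral fsbig_finite//=.
by rewrite scaler_suml; apply: eq_bigr => r _; exact: scalerA.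
Qed.

(** All integrals are deterministic and converge by dominated convergence;
    centring by their values leaves zero. *)
Lemma delta_in_essential_domain (mu : probability 'rV[R]_d R) :
  locally_integrable_on a b f -> (forall A, measurable A -> mu A = \d_v A) ->
  essential_domain d a b f mu.
Proof.
move=> fint muv; have rmX := degenerate_random_measure muv.
have mD : measurable D by exact: measurable_open.
have [fn [fnf fnle]] := simple_approximation mD mf.
have cvgI (B : set R) p q : (a < p%:E)%E -> (q%:E < b)%E -> measurable B ->
    B `<=` `]p, q]%classic ->
    \int[leb]_(x in B) fn n x @[n --> \oo] --> \int[leb]_(x in B) f x.
  move=> ap qb mB Bpq.
  have BD : B `<=` D by exact: subset_trans Bpq (itvoc_sub_open ap qb).
  have mfB : measurable_fun (B : set (measurableTypeR R)) f by exact: (measurable_funS mD BD mf).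
  apply: (@Rintegral_dominated_cvg _ _ _ leb B _ _ (fun x => `|f x|)) => //.
  - by move=> n; apply: measurable_funTS; exact: (measurable_funP (fn n)).
  - by apply: aeW => x Bx; apply: fnf; exact: BD.
  - apply/integrableP; split; first by apply/measurable_EFinP; exact: measurableT_comp.
    have [pq|qp] := ltP p q; last first.
      rewrite (_ : B = set0) ?integral_set0//; apply/seteqP; split => // x /Bpq.
      by rewrite set_itv_ge// bnd_simp -leNgt.
    apply: le_lt_trans (fint p q ap pq qb).
    under eq_integral do rewrite /= normr_id.
    have IS : `[p, q]%classic `<=` D by exact: itv_sub_open.
    apply: ge0_subset_integral => //.
    - apply/measurable_EFinP; apply: measurableT_comp => //.
      exact: (measurable_funS mD IS mf).
    - move=> x /Bpq; rewrite /= !in_itv/= => /andP[x1 x2]; by rewrite ltW.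
  - by move=> n x /BD; exact: fnle.
have bnd (B : set R) p q : measurable B -> B `<=` `]p, q]%classic -> bounded_borel B.
  by move=> mB Bpq; apply: (bounded_borelS mB Bpq); exact: bounded_borel_itv.
have conv (B : set R) p q : (a < p%:E)%E -> (q%:E < b)%E -> measurable B ->
    B `<=` `]p, q]%classic ->
    cvg_in_probability U \oo (fun n => simple_integral X (fn n) B)
      (cstRV U ((\int[leb]_(x in B) f x) *: v)).
  move=> ap qb mB Bpq; have bB := bnd B p q mB Bpq.
  have E n : simple_integral X (fn n) B = fun=> (\int[leb]_(x in B) fn n x) *: v.
    by apply/funext => w; exact: degenerate_simple_integral.
  under [X in cvg_in_probability _ _ X _]eq_fun do rewrite E.
  apply: cvg_in_probability_cst; apply: cvgZr_tmp; exact: cvgI Bpq.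
have app : approximating a b X f fn.
  split.
    apply: (@filterS _ _ (ae_filter_ringOfSetsType leb) setT); last exact: filterT.
    by move=> x _ xD; exact: fnf.
  move=> B iB; have [p [q [ap qb Bpq]]] := inner_borel_itv iB.
  have mB : measurable B by case: iB.
  by exists (cstRV U ((\int[leb]_(x in B) f x) *: v)); exact: conv Bpq.
split; first exact: random_measure_infinitely_divisible rmX.
exists _, _, U, X; split => //; first by exists fn.
exists (fun p q => (\int[leb]_(x in `]p, q]) f x) *: v).
exists (fun p q => cstRV U ((\int[leb]_(x in `]p, q]) f x) *: v)).
exists (cstRV U (0 : 'rV[R]_d)); split.
  move=> p q ap pq qb; exists fn => //.
  by apply: conv ap qb _ _ => //; exact: measurable_itv.
have PF := ends_proper a b.
rewrite [X in cvg_in_probability _ _ X _](_ : _ = fun _ _ => 0).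
  by apply: cvg_in_probability_cst; exact: cvg_cst.
by apply/funext => x; apply/funext => w; rewrite cstRVE subrr.
Qed.

End degenerate_domain.

(** * The Poisson random measure and its compensated sums *)

Section poisson_random_measure.
Context {R : realType} {d : nat}.
Local Notation U := (@unif R).
Local Notation leb := (@lebesgue_measure R).
Local Notation one := (const_mx 1 : 'rV[R]_d).

Lemma measurable_points_real (B : set R) :
  measurable_fun setT (fun w => (points B w)%:R : R).
Proof.
by move=> _ A _; rewrite setTI; exact: (measurable_points B [set n | A n%:R]).
Qed.

Lemma measurable_diagonal (h : R -> R) : measurable_fun setT h ->
  measurable_fun setT (fun w => h w *: one).
Proof.
move=> mh; apply: measurable_rV => l; under eq_fun do rewrite !mxE mulr1.
exact: mh.
Qed.

(** The counts are put on the diagonal, so that the vector-valued statements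
    follow from those on counts in every dimension. *)
Definition poisson_measure (B : set R) : {RV U >-> 'rV[R]_d} :=
  mkRV U (measurable_diagonal (measurable_points_real B)).

Lemma poisson_measureE B w : poisson_measure B w = (points B w)%:R *: one.
Proof. by []. Qed.

(** A point lies in at most one of the sets. *)
Lemma indic_bigcup_cvg (B : (set R)^nat) x : trivIset setT B ->
  \sum_(i < n) (\1_(B i) x : R) @[n --> \oo] --> (\1_(\bigcup_n B n) x : R).
Proof.
move=> tB; have [[k _ Bx]|nB] := pselect ((\bigcup_n B n) x); last first.
  rewrite indicE memNset//; rewrite (_ : (fun n => _) = cst 0); first exact: cvg_cst.
  apply/funext => n; rewrite big1//= => i _; rewrite indicE memNset// => Bx.
  by apply: nB; exists i.
rewrite indicE mem_set; last by exists k.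
apply: cvg_near_cst; exists k.+1 => // n /= kn.
rewrite (bigD1 (Ordinal kn))//= indicE mem_set// big1 ?addr0// => i ik.
rewrite indicE memNset// => Bi; move/trivIsetP : tB => /(_ i k Logic.I Logic.I).
by rewrite -(inj_eq val_inj)/= in ik => /(_ ik); rewrite -subset0 => /(_ x); apply.
Qed.

(** Every bounded region contains finitely many points, so sigma-additivity
    holds surely. *)
Lemma poisson_random_measure :
  is_random_measure (distribution U (poisson_measure `]0, 1]%classic)) poisson_measure.
Proof.
have bI t : bounded_borel (`]t, t + 1]%classic : set R) by exact: bounded_borel_itv.
split.
- move=> B bB tB bU; apply: aeW => w.
  have bU' : bounded_borel (\bigcup_n B n).
    by split => //; apply: bigcup_measurable => n _; case: (bB n).
  have [L HL] := bounded_borel_nat bU'.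
  have HB n x : B n x -> `|x| < L%:R by move=> Bx; apply: HL; exists n.
  have c : \sum_(i < n) (points (B i) w)%:R @[n --> \oo] --> ((points (\bigcup_n B n) w)%:R : R).
    rewrite (points_sumE w bU' HL).
    rewrite [X in X @ _ --> _](_ : _ =
        (fun n => point_sum (fun x => \sum_(i < n) \1_(B i) x) L.*2 w)).
      by apply: point_sum_cvg => x; exact: indic_bigcup_cvg.
    apply/funext => n; rewrite point_sum_sum; apply: eq_bigr => i _.
    by rewrite (points_sumE w (bB i) (@HB i)).
  rewrite [X in X @ _ --> _](_ : _ = (fun n => (\sum_(i < n) (points (B i) w)%:R) *: one)).
    by rewrite poisson_measureE; apply: cvgZr_tmp.
  by apply/funext => n; rewrite scaler_suml; apply: eq_bigr.
- move=> n B bB tB A mA.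
  exact: (points_independent (fun i => [set k | A i (k%:R *: one)]) bB tB).
- move=> t; have bt : bounded_borel [set t].
    by apply: (bounded_borelS (measurable_set1 t) _ (bounded_borel_itv t t true false)) => x /= ->; rewrite in_itv/= lexx.
  have mN : measurable [set w | (0 < points [set t] w)%N].
    exact: (measurable_points [set t] [set n | (0 < n)%N]).
  exists [set w | (0 < points [set t] w)%N]; split => //.
    apply/eqP; rewrite eq_le measure_ge0 andbT.
    have -> : 0%E = leb [set t] by rewrite lebesgue_measure_set1.
    exact: points_gt0_le.
  move=> w /= nw; rewrite lt0n; apply/negP => /eqP h; apply: nw.
  by have := poisson_measureE [set t] w; rewrite h scale0r.
- move=> B t bB A mA.
  apply: (points_law [set k | A (k%:R *: one)]) => //; first exact: bounded_borel_shift.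
  by apply: lebesgue_measure_shift; case: bB.
- move=> t A mA; apply: (points_law [set k | A (k%:R *: one)]) => //.
    exact: bounded_borel_itv.
  rewrite lebesgue_itvoc; last by rewrite lerDl.
  by rewrite lebesgue_itvoc// subr0 addrAC subrr add0r.
Qed.

(** A degenerate law would make [s ^ n] equal to [exp (s - 1)] for a fixed
    number [n] of points and every [s] in the unit interval. *)
Lemma poisson_not_delta : (0 < d)%N ->
  ~ delta_distributions d (distribution U (poisson_measure `]0, 1]%classic)).
Proof.
have h2 : 0 < (2^-1 : R) <= 1 by lra.
have h4 : 0 < (2^-1 ^+ 2 : R) <= 1 by rewrite expr2; lra.
have hne : 2%:R * (2^-1 - 1) <> 2^-1 ^+ 2 - 1 :> R by rewrite expr2; lra.
move=> d0 [v hv]; pose l : 'I_d := Ordinal d0.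
have bI : bounded_borel (`]0, 1]%classic : set R) by exact: bounded_borel_itv.
have I1 : fine (leb (`]0, 1]%classic : set R)) = 1 by rewrite lebesgue_itvoc//= subr0.
have := degenerate_coord l poisson_random_measure hv bI.
rewrite I1 mulr1 => hc.
have [n hn] : exists n, {ae U, forall w, points `]0, 1]%classic w = n}.
  have [w0 hw0] := ae_exists hc.
  exists (points `]0, 1]%classic w0); move: hc; apply: filterS => w.
  rewrite -hw0 (poisson_measureE _ w) (poisson_measureE _ w0) !mxE !mulr1 => /eqP.
  by rewrite eqr_nat => /eqP.
have ms (s : R) : measurable_fun setT (fun w => s ^+ points `]0, 1]%classic w).
  by move=> _ A _; rewrite setTI; exact: (measurable_points _ [set n | A (s ^+ n)]).
have E (s : R) : 0 < s <= 1 -> s ^+ n = expR (s - 1).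
  move=> s01; have := points_generating1 bI s01; rewrite I1 mulr1 => <-.
  rewrite -[LHS](Rintegral_prob_cst U) /Rintegral; congr fine.
  apply: ae_eq_integral => //; first by apply/measurable_EFinP; exact: ms.
  by move: hn; apply: filterS => w hw _; rewrite hw.
by have := E _ h4; rewrite exprAC (E _ h2) -expRM_natl => /expR_inj.
Qed.

End poisson_random_measure.

Section compensated_sums.
Context {R : realType}.
Local Notation U := (@unif R).
Local Notation leb := (@lebesgue_measure R).

(** From [exp (- y) >= 1 - y]. *)
Lemma expR_le_quadratic (y : R) : y <= 2^-1 -> expR y <= 1 + y + 2 * y ^+ 2.
Proof.
move=> y2; have h1 := expR_ge1Dx (- y).
have h2 : 0 < 1 - y by lra.
have h3 : expR y <= (1 - y)^-1.
  by rewrite -[expR y]invrK -expRN lef_pV2 ?posrE ?expR_gt0.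
apply: (le_trans h3); rewrite -[leLHS]mul1r ler_pdivrMr//.
rewrite [leRHS](_ : _ = 1 + y ^+ 2 * (1 - 2 * y)); last by ring.
by rewrite lerDl mulr_ge0 ?sqr_ge0//; lra.
Qed.

(** The right-hand side is the square of [exp (y / 2) - exp (- y / 2)]. *)
Lemma quadratic_le_cosh (y : R) : y ^+ 2 / 4 <= expR y + expR (- y) - 2.
Proof.
wlog y0 : y / 0 <= y.
  move=> H; have [|/ltW y0] := leP 0 y; first exact: H.
  have := H (- y); rewrite sqrrN opprK oppr_ge0 => /(_ y0).
  by rewrite [expR (- y) + _]addrC.
have h1 := expR_ge1Dx (y / 2).
have h2 : expR (- (y / 2)) <= 1 by rewrite -[leRHS]expR0 ler_expR; lra.
have e1 : expR (y / 2) * expR (- (y / 2)) = 1 by rewrite -expRD subrr expR0.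
have -> : expR y = expR (y / 2) ^+ 2 by rewrite expr2 -expRD -splitr.
have -> : expR (- y) = expR (- (y / 2)) ^+ 2.
  by rewrite expr2 -expRD -opprD -splitr.
have -> : y ^+ 2 / 4 = (y / 2) ^+ 2 by field.
have -> : expR (y / 2) ^+ 2 + expR (- (y / 2)) ^+ 2 - 2 =
    (expR (y / 2) - expR (- (y / 2))) ^+ 2.
  by rewrite sqrrB e1; ring.
by rewrite ler_sqr ?nnegrE; lra.
Qed.

Variables (h : R -> R) (L : nat).
Hypotheses (mh : measurable_fun setT h) (h1 : forall x, `|h x| <= 1).
Local Notation W := (`[- L%:R, L%:R[%classic : set R).

Let bW : bounded_borel W. Proof. exact: bounded_borel_itv. Qed.

Let mW : measurable (W : set (measurableTypeR R)). Proof. exact: measurable_itv. Qed.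

Let int (g : R -> R) (M : R) : measurable_fun setT g -> (forall x, `|g x| <= M) ->
  leb.-integrable W (EFin \o g).
Proof.
by move=> mg gM; apply: (@bounded_borel_integrable _ _ _ M) => //; exact: measurable_funTS.
Qed.

Let theta : R := \int[leb]_(x in W) (h x ^+ 2).

(** Campbell's formula, with the quadratic bound of the exponential; the
    factor one half keeps the exponent in the range of [expR_le_quadratic]. *)
Let half_moment (s : R) : `|s| = 2^-1 ->
  (\int[U]_w (expR (s * (point_sum h L.*2 w - \int[leb]_(x in W) h x)))%:E <=
   (expR (theta / 2))%:E)%E.
Proof.
move=> s2; set I0 := \int[leb]_(x in W) h x.
have msh : measurable_fun setT (fun x => s * h x) by exact: measurable_funM.
have sh1 x : `|s * h x| <= 2^-1.
  by rewrite normrM s2 ler_piMr// invr_ge0.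
have E w : (expR (s * (point_sum h L.*2 w - I0)))%:E =
    ((expR (- (s * I0)))%:E * (expR (point_sum (fun x => s * h x) L.*2 w))%:E)%E.
  by rewrite -EFinM -expRD point_sumZ mulrBr addrC.
under eq_integral do rewrite E.
have mps : measurable_fun setT (fun w => (expR (point_sum (fun x => s * h x) L.*2 w))%:E).
  apply/measurable_EFinP; apply: (measurableT_comp (f := expR)); first exact: measurable_expR.
  exact: measurable_point_sum.
rewrite (ge0_integralZl U measurableT mps); last 2 first.
- by move=> w _; rewrite lee_fin expR_ge0.
- by rewrite lee_fin expR_ge0.
rewrite (exponential_functional L msh sh1) -EFinM -expRD lee_fin ler_expR.
have ih := int mh h1.
have ih2 : leb.-integrable W (EFin \o (fun x => h x ^+ 2)).
  apply: (@int _ 1); first exact: measurable_funX.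
  by move=> x; rewrite normrX exprn_ile1.
have ie : leb.-integrable W (EFin \o (fun x => expR (s * h x) - 1)).
  apply: (@int _ (expR 1 + 1)).
    apply: measurable_funB => //.
    by apply: (measurableT_comp (f := expR)) => //; exact: measurable_expR.
  move=> x; rewrite (le_trans (ler_normB _ _))// normr1 lerD2r ger0_norm ?expR_ge0//.
  by rewrite ler_expR; have := sh1 x; rewrite ler_norml; lra.
have is1 : leb.-integrable W (EFin \o (fun x => s * h x)) by exact: (int msh sh1).
have is2 : leb.-integrable W (EFin \o (fun x => 2^-1 * h x ^+ 2)).
  apply: (@int _ 2^-1); first by apply: measurable_funM => //; exact: measurable_funX.
  by move=> x; rewrite normrM normrX ger0_norm// ler_piMr// exprn_ile1.
have : \int[leb]_(x in W) (expR (s * h x) - 1) <=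
    \int[leb]_(x in W) (s * h x + 2^-1 * h x ^+ 2).
  apply: le_Rintegral => //; first exact: integrableD is1 is2.
  move=> x _; have : s * h x <= 2^-1 by have := sh1 x; rewrite ler_norml; lra.
  move/expR_le_quadratic; rewrite exprMn.
  have -> : s ^+ 2 = 4^-1.
    by rewrite -real_normK ?num_real// s2 expr2 -invfM; congr (_^-1); ring.
  lra.
rewrite [X in _ <= X -> _]RintegralD//.
rewrite RintegralZl; [|exact: mW|exact: ih].
rewrite RintegralZl; [|exact: mW|exact: ih2].
by rewrite -/theta -/I0; lra.
Qed.

(** Chebyshev's inequality with the moment generating function in place of the
    variance. *)
Lemma compensated_tail (e : R) : 0 < e ->
  (U [set w | (e <= `|point_sum h L.*2 w - \int[leb]_(x in W) h x|)%R] <=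
   (32 / e ^+ 2 * (expR (theta / 2) - 1))%:E)%E.
Proof.
move=> e0; set I0 := \int[leb]_(x in W) h x.
pose S w := point_sum h L.*2 w - I0.
have mS : measurable_fun setT S.
  by apply: measurable_funB => //; exact: measurable_point_sum.
pose A := [set w | e <= `|S w|].
have mA : measurable A.
  have := measurable_ge_dist e (measurable_point_sum L.*2 mh) (measurable_cst I0).
  by [].
have fA : U A \is a fin_num by exact: fin_num_measure.
have mexp (s : R) : measurable_fun setT (fun w => (expR (s * S w))%:E).
  apply/measurable_EFinP; apply: (measurableT_comp (f := expR)); first exact: measurable_expR.
  exact: measurable_funM.
have : (\int[U]_w ((e ^+ 2 / 16 * \1_A w + 2)%:E) <=
    \int[U]_w ((expR (2^-1 * S w))%:E + (expR (- 2^-1 * S w))%:E))%E.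
  apply: ge0_le_integral => //.
  - by move=> w _; rewrite lee_fin addr_ge0// mulr_ge0// divr_ge0// sqr_ge0.
  - apply/measurable_EFinP; apply: measurable_funD => //.
    by apply: (measurable_funM (measurable_cst (e ^+ 2 / 16))); exact: measurable_indic mA.
  - exact: emeasurable_funD.
  move=> w _; rewrite -EFinD lee_fin indicE.
  have := quadratic_le_cosh (2^-1 * S w); rewrite mulNr.
  case: (boolP (w \in A)) => [/set_mem|_]; rewrite /= ?mulr1n ?mulr0n ?mulr1 ?mulr0; last first.
    have := sqr_ge0 (2^-1 * S w); lra.
  rewrite /A/= => eS; have : e ^+ 2 <= S w ^+ 2.
    by rewrite -(real_normK (num_real (S w))) ler_sqr ?nnegrE// ltW.
  rewrite exprMn expr2; lra.
have g0 (s w : R) : [set: R] w -> (0 <= (expR (s * S w))%:E)%E by rewrite lee_fin expR_ge0.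
rewrite (ge0_integralD U measurableT (g0 _) (mexp _) (g0 _) (mexp _)).
have n1 : `|2^-1| = 2^-1 :> R by rewrite ger0_norm// invr_ge0.
have n2 : `|- 2^-1| = 2^-1 :> R by rewrite normrN.
move=> /le_trans/(_ (leeD (half_moment n1) (half_moment n2))).
have -> : (\int[U]_w ((e ^+ 2 / 16 * \1_A w + 2)%:E) = (e ^+ 2 / 16 * fine (U A) + 2)%:E)%E.
  have iA : U.-integrable setT (EFin \o (\1_A : R -> R)) by exact: integrable_indic.
  have iA2 := integrableZl measurableT (e ^+ 2 / 16) iA.
  have i2 : U.-integrable setT (EFin \o (fun _ : R => 2 : R)).
    by apply: (@bounded_integrable _ _ _ _ _ 2) => // w; rewrite ger0_norm.
  rewrite -[LHS]fineK; last exact: integrable_fin_num (integrableD measurableT iA2 i2).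
  congr EFin; transitivity (\int[U]_w (e ^+ 2 / 16 * \1_A w + 2)); first by [].
  rewrite RintegralD// Rintegral_prob_cst RintegralZl//; congr (_ * _ + _).
  by rewrite /Rintegral integral_indic// setIT.
rewrite -EFinD lee_fin -/A -(fineK fA) lee_fin => hA.
have e20 : 0 < e ^+ 2 by rewrite exprn_gt0.
rewrite -(ler_pM2l e20) mulrA (_ : e ^+ 2 * (32 / e ^+ 2) = 32); last first.
  by field; rewrite gt_eqF.
move: hA; move: (expR (theta / 2)) => X; rewrite -/A; move: (fine (U A)) => p /=; lra.
Qed.

End compensated_sums.

Section empty_sets.
Context {R : realType}.

Lemma point_sum_eq0 (K : set R) (h : R -> R) (L : nat) w : bounded_borel K ->
  (forall x, K x -> `|x| < L%:R) -> points K w = 0%N ->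
  (forall x, ~ K x -> h x = 0) -> point_sum h L.*2 w = 0.
Proof.
move=> bK KL; rewrite (pointsE w bK KL) /count_upto => /eqP.
rewrite sum_nat_eq0 => /forallP hm h0; rewrite /point_sum big1// => m _.
have := hm m; rewrite /= sum_nat_eq0 => /forallP hj; rewrite big1// => j _.
apply: h0 => Kx; have := hj j; rewrite /= mem_set//.
Qed.

End empty_sets.

(** * The Poisson law in the domain *)

Section poisson_domain.
Context {R : realType} {d : nat}.
Variables (a b : \bar R) (f : R -> R).
Local Notation D := [set s : R | (a < s%:E < b)%E].
Hypothesis ab : (a < b)%E.
Hypothesis mf : measurable_fun D f.
Hypothesis f_fin :
  (\int[@lebesgue_measure R]_(s in D) (Num.min (f s ^+ 2) 1)%:E < +oo)%E.
Local Notation leb := (@lebesgue_measure R).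
Local Notation U := (@unif R).
Local Notation one := (const_mx 1 : 'rV[R]_d).
Local Notation X := (@poisson_measure R d).
Import HBSimple.

Let F : R -> R := f \_ D.

Let mD : measurable D. Proof. exact: measurable_open. Qed.

Let mF : measurable_fun setT F.
Proof. exact/(measurable_restrictT _ mD). Qed.

Let FE x : D x -> F x = f x.
Proof. by move=> Dx; rewrite /F patchE mem_set. Qed.

Let part p q (x : R) : R := F x * \1_(`]p, q]%classic) x.

Let mpart p q : measurable_fun setT (part p q).
Proof.
apply: measurable_funM => //; apply: measurable_indic; exact: measurable_itv.
Qed.

Let bound (p q : R) : nat := (Num.truncn (Num.max `|p| `|q|)).+1.

Let boundP p q L x : (bound p q <= L)%N -> `]p, q]%classic x -> `|x| < L%:R.
Proof.
move=> bL; rewrite /= in_itv/= => /andP[px xq].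
have h : Num.max `|p| `|q| < L%:R.
  by apply: (lt_le_trans (truncnS_gt _)); rewrite ler_nat.
apply: le_lt_trans h; rewrite le_max ler_norml ler_norml.
have [x0|x0] := leP 0 x.
  by apply/orP; right; have := ler_norm q; lra.
by apply/orP; left; have := ler_norm (- p); rewrite normrN; lra.
Qed.

Let S p q w : R := point_sum (part p q) (bound p q).*2 w.

Let SE p q L w : (bound p q <= L)%N -> S p q w = point_sum (part p q) L.*2 w.
Proof.
move=> bL; rewrite /S; apply: esym; apply: point_sum_stable; last by rewrite leq_double.
move=> x Lx; rewrite /part indicE memNset ?mulr0// => /(boundP (leqnn _)).
by rewrite ltNge Lx.
Qed.

Let mS p q : measurable_fun setT (S p q).
Proof. exact: measurable_point_sum. Qed.

Let J p q : {RV U >-> 'rV[R]_d} := mkRV U (measurable_diagonal (d := d) (mS p q)).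

(** Both sides are linear in the level sets of [h]. *)
Lemma poisson_simple_integral (h : {sfun R >-> R}) B L w : bounded_borel B ->
  (forall x, B x -> `|x| < L%:R) ->
  simple_integral X h B w = point_sum (fun x => h x * \1_B x) L.*2 w *: one.
Proof.
move=> bB BL; rewrite /simple_integral fsbig_finite//=.
set s := finmap.enum_fset _.
have us : uniq s by exact: finmap.fset_uniq.
have mh r : measurable (h @^-1` [set r]) by exact: measurable_funPTI.
have hE : (fun x => h x * \1_B x) =
    (fun x => \sum_(r <- s) r * \1_(B `&` h @^-1` [set r]) x).
  apply/funext => x.
  have hs : h x \in s by have := in_fset_set (fimfunP h) (h x); rewrite [RHS]mem_set//; exists x.
  rewrite (bigD1_seq _ hs us)//= big1 ?addr0.
    congr (_ * _); rewrite !indicE; congr (_%:R); congr nat_of_bool.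
    by apply/idP/idP => /set_mem h1; apply/mem_set; [split|case: h1].
  by move=> r rx; rewrite indicE memNset ?mulr0// => -[_ /= hx]; move: rx; rewrite hx eqxx.
rewrite hE point_sum_sum scaler_suml; apply: eq_bigr => r _.
rewrite point_sumZ -scalerA.
transitivity (r *: ((points (B `&` h @^-1` [set r]) w)%:R *: one)); first by [].
congr (_ *: (_ *: _)).
apply: points_sumE.
  by apply: (bounded_borelS _ _ bB); [apply: measurableI => //; case: bB|move=> x []].
by move=> x [/BL].
Qed.

Lemma cvg_probability_everywhere (Y : nat -> R -> R) (Z : R -> R) :
  (forall n, measurable_fun setT (Y n)) -> measurable_fun setT Z ->
  (forall w, Y n w @[n --> \oo] --> Z w) ->
  forall e : R, 0 < e -> U [set w | (e <= `|Y n w - Z w|)%R] @[n --> \oo] --> 0%E.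
Proof.
move=> mY mZ YZ e e0.
have mA n : measurable [set w | e <= `|Y n w - Z w|] by exact: measurable_ge_dist.
have h : \int[U]_w (\1_[set w | e <= `|Y n w - Z w|] w : R) @[n --> \oo] --> \int[U]_w (0 : R).
  apply: (@bounded_Rintegral_cvg _ _ _ _ _ _ 1) => //.
  - by move=> n; exact: measurable_indic.
  - by move=> n w; rewrite indicE; case: (w \in [set w | _]); rewrite ?normr1 ?normr0.
  apply: aeW => w; apply: cvg_near_cst.
  have /cvgrPdist_lt/(_ _ e0) := YZ w; apply: filterS => n hn.
  by rewrite indicE memNset//= => hn'; move: hn; rewrite distrC ltNge hn'.
rewrite Rintegral_prob_cst in h.
have E n : U [set w | e <= `|Y n w - Z w|] =
    (\int[U]_w (\1_[set w | e <= `|Y n w - Z w|] w : R))%:E.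
  by rewrite /Rintegral integral_indic// setIT fineK// fin_num_measure.
under eq_fun do rewrite E.
by apply/fine_cvgP; split; [exact: nearW|exact: h].
Qed.

Lemma cvg_probability_diagonal {I : Type} (G : set_system I) {FG : Filter G}
    (Y : I -> R -> R) (Z : R -> R) :
  (forall i, measurable_fun setT (Y i)) -> measurable_fun setT Z ->
  (forall e : R, 0 < e -> U [set w | (e <= `|Y i w - Z w|)%R] @[i --> G] --> 0%E) ->
  cvg_in_probability U G (fun i w => Y i w *: one) (fun w => Z w *: one).
Proof.
move=> mY mZ h e e0.
have n1 : `|one| <= 1.
  by apply: norm_le_coord => // l; rewrite mxE normr1.
have mA i : measurable [set w | e <= `|Y i w - Z w|] by exact: measurable_ge_dist.
have mB i : measurable [set w | e <= `|Y i w *: one - Z w *: one|].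
  apply: measurable_ge_norm => // l; under eq_fun do rewrite !mxE !mulr1.
  exact: measurable_funB.
apply/(cvg_probability0 U mB) => r r0.
have /(cvg_probability0 U mA)/(_ _ r0) := h _ e0.
apply: filterS => i; apply: le_trans; apply: le_measure; rewrite ?inE//.
move=> w /=; rewrite -scalerBl normrZ => /le_trans; apply.
by rewrite ler_piMr.
Qed.

(** The simple functions converge everywhere on the interval, and sums over
    finitely many points follow them at every sample point. *)
Lemma poisson_approximating : exists fn : {sfun R >-> R}^nat,
  approximating a b X f fn /\ forall p q, (a < p%:E)%E -> (q%:E < b)%E ->
    cvg_in_probability U \oo (fun n => simple_integral X (fn n) `]p, q]%classic) (J p q).
Proof.
have [fn [fnf _]] := simple_approximation mD mf.
exists fn.
have conv B L : measurable B -> B `<=` D -> bounded_borel B ->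
    (forall x, B x -> `|x| < L%:R) ->
    measurable_fun setT (point_sum (fun x => F x * \1_B x) L.*2) /\
    cvg_in_probability U \oo (fun n => simple_integral X (fn n) B)
      (fun w => point_sum (fun x => F x * \1_B x) L.*2 w *: one).
  move=> mB BD bB BL.
  have mi : measurable_fun setT (\1_B : R -> R) by exact: measurable_indic.
  have mlim : measurable_fun setT (point_sum (fun x => F x * \1_B x) L.*2).
    by apply: measurable_point_sum; exact: measurable_funM.
  split => //.
  have E n : simple_integral X (fn n) B =
      (fun w => point_sum (fun x => fn n x * \1_B x) L.*2 w *: one).
    by apply/funext => w; exact: poisson_simple_integral.
  rewrite (_ : (fun n => simple_integral X (fn n) B) =
    (fun n w => point_sum (fun x => fn n x * \1_B x) L.*2 w *: one)); last exact/funext.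
  apply: cvg_probability_diagonal => //.
    move=> n; apply: measurable_point_sum; apply: measurable_funM => //.
  apply: cvg_probability_everywhere => //.
    move=> n; apply: measurable_point_sum; apply: measurable_funM => //.
  move=> w; apply: point_sum_cvg => x; rewrite indicE.
  have [Bx|Bx] := pselect (B x).
    rewrite mem_set// mulr1 FE; last exact: BD.
    by under eq_fun do rewrite mulr1; exact/fnf/BD.
  by rewrite memNset// mulr0; under eq_fun do rewrite mulr0; exact: cvg_cst.
have bI p q : bounded_borel (`]p, q]%classic : set R) by exact: bounded_borel_itv.
split; last first.
  move=> p q ap qb; have mI : measurable (`]p, q]%classic : set R) by exact: measurable_itv.
  have BL x : (`]p, q]%classic : set R) x -> `|x| < (bound p q)%:R by exact: boundP.
  exact: (conv _ _ mI (itvoc_sub_open ap qb) (bI p q) BL).2.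
split.
  apply: (@filterS _ _ (ae_filter_ringOfSetsType leb) setT); last exact: filterT.
  by move=> x _ xD; exact: fnf.
move=> B iB; have [p [q [ap qb Bpq]]] := inner_borel_itv iB.
have mB : measurable B by case: iB.
have bB := inner_bounded_borel iB.
have BL x : B x -> `|x| < (bound p q)%:R by move=> /Bpq; exact: boundP.
have BD : B `<=` D by case: iB.
have [m c] := conv B _ mB BD bB BL.
by exists (mkRV U (measurable_diagonal m)).
Qed.

Let big : set R := [set x | 1 < `|F x|].

Let mbig : measurable big.
Proof.
rewrite -[big]setTI; apply: measurable_fun_ltr => //; exact: measurableT_comp.
Qed.

Let small (x : R) : R := F x * \1_(~` big) x.

Let msmall : measurable_fun setT small.
Proof. by apply: measurable_funM => //; apply: measurable_indic; exact: measurableC. Qed.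

Let smallE x : small x = if 1 < `|F x| then 0 else F x.
Proof.
rewrite /small indicE; case: ifPn => h; first by rewrite memNset ?mulr0//= /setC/=; apply.
by rewrite mem_set ?mulr1//=; exact/negP.
Qed.

Let small_le1 x : `|small x| <= 1.
Proof. by rewrite smallE; case: ltP => //; rewrite normr0. Qed.

Let G p q : R := \int[leb]_(x in `]p, q]) small x.

Let window L : set R := `[- L%:R, L%:R[%classic.

Let IW p q L : (bound p q <= L)%N -> `]p, q]%classic `<=` window L.
Proof.
move=> bL x /(boundP bL); rewrite ltr_norml /window/= in_itv/= => /andP[/ltW -> ->//].
Qed.

Let GE p q L : (bound p q <= L)%N ->
  G p q = \int[leb]_(x in window L) (small x * \1_(`]p, q]%classic) x).
Proof.
move=> bL; rewrite /G /Rintegral; congr fine.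
rewrite -[in LHS](setIidr (IW bL)) integral_mkcondr; apply: eq_integral => x _.
rewrite patchE indicE; case: (x \in `]p, q]%classic); first by rewrite mulr1.
by rewrite mulr0.
Qed.

Let fmin (x : R) : \bar R := (Num.min (f x ^+ 2) 1)%:E.

Let mfmin : measurable_fun D fmin.
Proof.
by apply/measurable_EFinP; apply: measurable_minr => //; exact: measurable_funX.
Qed.

Let fmin0 x : (0 <= fmin x)%E.
Proof. by rewrite lee_fin le_min sqr_ge0 ler01. Qed.

(** On [~` big] the compensated sum is controlled by its exponential moments,
    on [big] the sum vanishes unless there is a point. *)
Lemma increment_tail p q p0 q0 (theta e : R) :
  (a < p%:E)%E -> (q%:E < b)%E -> p <= p0 -> q0 <= q ->
  (\int[leb]_(x in D `\` `]p0, q0]%classic) fmin x <= theta%:E)%E -> 0 < e ->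
  (U [set w | (e <= `|(S p q w - G p q) - (S p0 q0 w - G p0 q0)|)%R] <=
   (theta + 32 / e ^+ 2 * (expR (theta / 2) - 1))%:E)%E.
Proof.
move=> ap qb pp qq ht e0.
pose L := maxn (bound p q) (bound p0 q0).
have bL : (bound p q <= L)%N by exact: leq_maxl.
have bL0 : (bound p0 q0 <= L)%N by exact: leq_maxr.
pose E : set R := `]p, q]%classic `\` `]p0, q0]%classic.
have mE : measurable E by apply: measurableD; exact: measurable_itv.
pose u x := small x * \1_E x.
pose K := E `&` big.
have mK : measurable K by exact: measurableI.
have KI : K `<=` `]p, q]%classic by move=> x [[]].
have bK : bounded_borel K by apply: (bounded_borelS mK KI); exact: bounded_borel_itv.
have KL x : K x -> `|x| < L%:R by move=> /KI; exact: boundP.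
have ED : E `<=` D `\` `]p0, q0]%classic.
  by move=> x [xI nx]; split => //; exact: (itvoc_sub_open ap qb).
have I0I : `]p0, q0]%classic `<=` `]p, q]%classic.
  move=> x /=; rewrite !in_itv/= => /andP[h1 h2].
  by rewrite (le_lt_trans pp h1) (le_trans h2 qq).
pose v x := F x * \1_K x.
have mu_ : measurable_fun setT u by apply: measurable_funM => //; exact: measurable_indic.
have mv : measurable_fun setT v by apply: measurable_funM => //; exact: measurable_indic.
have u1 x : `|u x| <= 1.
  rewrite /u normrM mulr_ile1// indicE.
  by case: (x \in E); rewrite ?normr1 ?normr0.
have split_part x : part p q x = part p0 q0 x + (u x + v x).
  rewrite /part /u /v smallE !indicE.
  have [xI|xI] := pselect ((`]p, q]%classic : set R) x); last first.
    rewrite !memNset//; first by rewrite !mulr0 !addr0.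
    - by move=> /KI.
    - by case.
    - by move=> /I0I.
  have [x0|x0] := pselect ((`]p0, q0]%classic : set R) x).
    rewrite (mem_set xI) (mem_set x0) !memNset//; first by rewrite !mulr0 !addr0.
    - by move=> [[]].
    - by case.
  have Ex : E x by split.
  rewrite (mem_set xI) (mem_set Ex) (memNset x0) mulr0 add0r !mulr1.
  case: ifPn => h; first by rewrite mem_set ?mulr1 ?add0r//; split.
  by rewrite memNset ?mulr0 ?addr0// => -[_]; exact/negP.
have split_small x : small x * \1_(`]p, q]%classic) x =
    small x * \1_(`]p0, q0]%classic) x + u x.
  rewrite /u -mulrDr; congr (_ * _); rewrite !indicE.
  have [xI|xI] := pselect ((`]p, q]%classic : set R) x); last first.
    rewrite !memNset//; first by rewrite addr0.
    - by case.
    - by move=> /I0I.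
  have [x0|x0] := pselect ((`]p0, q0]%classic : set R) x).
    by rewrite (mem_set xI) (mem_set x0) memNset ?addr0//; case.
  by rewrite (mem_set xI) (memNset x0) mem_set ?add0r//; split.
have int (g : R -> R) : measurable_fun setT g -> (forall x, `|g x| <= 1) ->
    leb.-integrable (window L) (EFin \o g).
  move=> mg g1; apply: (@bounded_borel_integrable _ _ _ 1) => //.
    exact: bounded_borel_itv.
  exact: measurable_funTS.
have mW : measurable (window L : set (measurableTypeR R)) by exact: measurable_itv.
have GG : G p q = G p0 q0 + \int[leb]_(x in window L) u x.
  rewrite (GE bL) (GE bL0) -RintegralD//; last first.
  - exact: int.
  - apply: int; first by apply: measurable_funM => //; apply: measurable_indic; exact: measurable_itv.
    move=> x; rewrite normrM mulr_ile1// indicE.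
    by case: (x \in `]p0, q0]%classic); rewrite ?normr1 ?normr0.
  - by apply: eq_Rintegral => x _; rewrite split_small.
have diffE w : (S p q w - G p q) - (S p0 q0 w - G p0 q0) =
    (point_sum u L.*2 w - \int[leb]_(x in window L) u x) + point_sum v L.*2 w.
  rewrite (SE w bL) (SE w bL0) GG.
  rewrite (_ : part p q = fun x => part p0 q0 x + (u x + v x)); last exact/funext.
  by rewrite !point_sumD; ring.
have lebK : (leb K <= theta%:E)%E.
  apply: le_trans ht; rewrite -[leLHS]mul1e -integral_cst//.
  apply: (@le_trans _ _ (\int[leb]_(x in K) fmin x)%E).
    apply: ge0_le_integral => //.
    - by apply: (measurable_funS mD _ mfmin) => x /KI; exact: (itvoc_sub_open ap qb).
    move=> x [Ex bx]; have [Dx _] := ED x Ex.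
    rewrite lee_fin le_min lexx andbT -(real_normK (num_real (f x))) exprn_ege1//.
    by move: bx; rewrite /big/= FE// => /ltW.
  apply: ge0_subset_integral => //.
  - by apply: measurableD => //; exact: measurable_itv.
  - by apply: (measurable_funS mD _ mfmin) => x [].
  - by move=> x [Ex _]; exact: ED.
have thu : \int[leb]_(x in window L) (u x ^+ 2) <= theta.
  have iu : leb.-integrable (window L) (EFin \o (fun x => u x ^+ 2)).
    by apply: int; [exact: measurable_funX|move=> x; rewrite normrX exprn_ile1].
  rewrite -lee_fin fineK; last exact: integrable_fin_num.
  apply: le_trans ht.
  have -> : (\int[leb]_(x in window L) (u x ^+ 2)%:E)%E =
      (\int[leb]_(x in E) (small x ^+ 2)%:E)%E.
    have EW : E `<=` window L by move=> x [xI _]; exact: (IW bL).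
    rewrite -[in RHS](setIidr EW) integral_mkcondr; apply: eq_integral => x _.
    rewrite patchE /u indicE; case: (x \in E); first by rewrite mulr1.
    by rewrite mulr0 expr0n.
  apply: (@le_trans _ _ (\int[leb]_(x in E) fmin x)%E).
    apply: ge0_le_integral => //.
    - by move=> x _; rewrite lee_fin sqr_ge0.
    - by apply/measurable_EFinP; apply: measurable_funTS; exact: measurable_funX.
    - by apply: (measurable_funS mD _ mfmin) => x /ED[].
    move=> x Ex; have [Dx _] := ED x Ex.
    rewrite lee_fin smallE FE// le_min; case: ltP => h; first by rewrite expr0n sqr_ge0 ler01.
    by rewrite lexx/= -(real_normK (num_real (f x))) exprn_ile1.
  apply: ge0_subset_integral => //.
  - by apply: measurableD => //; exact: measurable_itv.
  - by apply: (measurable_funS mD _ mfmin) => x [].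
pose A1 := [set w : R | (0 < points K w)%N].
pose A2 := [set w | e <= `|point_sum u L.*2 w - \int[leb]_(x in window L) u x|].
have m1 : measurable A1 by exact: (measurable_points K [set n | (0 < n)%N]).
have m2 : measurable A2.
  by apply: measurable_ge_dist => //; exact: measurable_point_sum.
apply: (@le_trans _ _ (U (A1 `|` A2))).
  apply: le_measure; rewrite ?inE//.
  - apply: measurable_ge_dist; apply: measurable_funB => //; exact: mS.
  - exact: measurableU.
  move=> w /=; rewrite diffE; have [K0|Kpos] := posnP (points K w); last by move=> _; left.
  rewrite (@point_sum_eq0 _ K v L w bK KL K0) ?addr0; last first.
    by move=> x nK; rewrite /v indicE memNset// mulr0.
  by move=> h; right; exact: h.
apply: (le_trans (measureU2 _ m1 m2)); rewrite EFinD; apply: leeD.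
  exact: le_trans (points_gt0_le bK) lebK.
apply: (le_trans (compensated_tail L mu_ u1 e0)); rewrite lee_fin.
rewrite ler_wpM2l// ?divr_ge0 ?sqr_ge0// lerD2r ler_expR ler_pM2r// invr_gt0.
Qed.

(** Centring by the integral of the part of [f] of modulus at most one makes
    the integrals Cauchy in probability at the two ends. *)
Lemma poisson_in_essential_domain :
  essential_domain d a b f (distribution U (X `]0, 1]%classic)).
Proof.
have rmX := @poisson_random_measure R d.
split; first exact: random_measure_infinitely_divisible rmX.
have [fn [app cJ]] := poisson_approximating.
exists _, _, U, X; split => //; first by exists fn.
pose Y (x : R * R) w := S x.1 x.2 w - G x.1 x.2.
have mY x : measurable_fun setT (Y x) by apply: measurable_funB => //; exact: mS.
have PF := ends_proper a b.
have [Z [mZ hZ]] : exists Z : R -> R, measurable_fun setT Z /\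
    forall e : R, 0 < e -> U [set w | (e <= `|Y i w - Z w|)%R]
      @[i --> filter_prod (downto a) (upto b)] --> 0%E.
  apply: cauchy_cvg_in_probability => // e e0.
  have e30 : 0 < e ^+ 3 / 64 by rewrite divr_gt0// exprn_gt0.
  pose theta := Num.min 1 (Num.min (e / 2) (e ^+ 3 / 64)).
  have t0 : 0 < theta by rewrite !lt_min ltr01 divr_gt0.
  have t1 : theta <= 1 by rewrite ge_min lexx.
  have t2 : theta <= e / 2 by rewrite !ge_min lexx orbT.
  have t3 : theta <= e ^+ 3 / 64 by rewrite !ge_min lexx !orbT.
  (* The three bounds on [theta] serve the range of the quadratic bound, the
     large jumps and the compensated small jumps. *)
  have [p0 [q0 [ap0 qb0 ht]]] := open_integral_tail ab mfmin (fun x _ => fmin0 x) f_fin t0.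
  exists (p0, q0); have := ends_near ap0 qb0.
  apply: filterS => -[p q] /= [ap pp qb qq].
  apply: (le_trans (increment_tail ap qb pp qq ht e0)); rewrite lee_fin.
  have ex : expR (theta / 2) - 1 <= theta.
    have th : theta / 2 <= 2^-1 by lra.
    by have := expR_le_quadratic th; rewrite expr2; nra.
  have e20 : 0 < e ^+ 2 by rewrite exprn_gt0.
  have : 32 / e ^+ 2 * (expR (theta / 2) - 1) <= e / 2.
    apply: (@le_trans _ _ (32 / e ^+ 2 * (e ^+ 3 / 64))).
      by rewrite ler_wpM2l ?divr_ge0 ?sqr_ge0// (le_trans ex).
    rewrite le_eqVlt; apply/orP; left; apply/eqP; field.
    by rewrite gt_eqF.
  lra.
exists (fun p q => G p q *: one), J, (mkRV U (measurable_diagonal (d := d) mZ)); split.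
  by move=> p q ap pq qb; exists fn => //; exact: cJ.
rewrite (_ : (fun _ _ => _) = (fun x w => Y x w *: one)); last first.
  by apply/funext => x; apply/funext => w; rewrite /Y scalerBl.
exact: cvg_probability_diagonal.
Qed.

End poisson_domain.

(** * The characterization *)

Theorem theorem6p11 (R : realType) (d : nat) (hd : (0 < d)%N)
    (a b : \bar R) (hab : (a < b)%E) (f : R -> R)
    (hf : measurable_fun [set s : R | (a < s%:E < b)%E] f) :
  essential_domain d a b f = delta_distributions d <->
  locally_integrable_on a b f /\
  (\int[lebesgue_measure]_(s in [set s : R | (a < s%:E < b)%E])
     (Num.min (f s ^+ 2) 1)%:E = +oo)%E.
Proof.
split=> [DE|[fint foo]].
  split.
    pose v : 'rV[R]_d := const_mx 1.
    have dv : delta_distributions d (distribution (@unif R) (cstRV (@unif R) v)).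
      by exists v => A mA; apply: distribution_cst => //; exact: aeW.
    have := dv; rewrite -DE => -[] _ [] dO [] Omega [] P [] X [] rmX fX _.
    have muv A : measurable A -> distribution (@unif R) (cstRV (@unif R) v) A = \d_v A.
      by move=> mA; apply: distribution_cst => //; exact: aeW.
    apply: (degenerate_locally_integrable hf (l := Ordinal hd) rmX muv _ fX).
    by rewrite mxE.
  apply/eqP; rewrite -leye_eq leNgt; apply/negP => ffin.
  have := poisson_in_essential_domain (d := d) hab hf ffin.
  by rewrite DE; exact: poisson_not_delta.
apply/seteqP; split; first exact: essential_domain_sub_delta.
by move=> mu [v muv]; exact: (delta_in_essential_domain hf fint muv).
Qed.
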